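(* Let $\mathbf{P}$ be a $d$-dimensional complete simplicial toric variety and let $X\subset\mathbf{P}$ be an ample Cartier divisor defined by $f=0$, where $f\in S_\beta$. Then $$H^0(\mathbf{P},\Omega^{d-1}_{\mathbf{P}}(X))=\Bigl\{\frac{\sum_{i=1}^nA_i\Omega_i}{f}: A_i\in S_{\beta-\beta_0+\beta_i}\Bigr\},$$ where $\beta_0=\sum_{i=1}^n\beta_i$ and $z_i\in S_{\beta_i}$.
   Context: Setting: $M$ is a free abelian group of rank $d$, $N=\operatorname{Hom}(M,\mathbf{Z})$, $\Sigma$ a rational simplicial complete $d$-dimensional fan in $N_{\mathbf{R}}$, $\rho_1,\dots,\rho_n$ its one-dimensional cones, $e_i\in N$ the primitive generator of $\rho_i$, and $\mathbf{P}=\mathbf{P}_\Sigma$ the associated toric variety over $\mathbf{C}$ with torus $\mathbf{T}$. $S=\mathbf{C}[z_1,\dots,z_n]$ is graded by $Cl(\Sigma)=\mathbf{Z}^n/\alpha(M)$, $\alpha(m)=(\langle m,e_i\rangle)_i$; $\beta_i=\deg z_i$ is the class of the $i$-th basis vector. $\mathbf{P}=U(\Sigma)/\mathbf{D}(\Sigma)$ where $\mathbf{D}(\Sigma)=\operatorname{Spec}\mathbf{C}[Cl(\Sigma)]\subset(\mathbf{C}^* )^n$ and $U(\Sigma)=\mathbf{A}^n\setminus\mathbf{V}(\prod_{\rho_i\not\subset\sigma}z_i:\sigma\in\Sigma)$; a nonzero $f\in S_\beta$ defines the divisor $X=\{f=0\}\subset\mathbf{P}$ of class $\beta$. $\Omega^p_{\mathbf{P}}$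 is the sheaf of Zariski $p$-forms ($j_*\Omega^p_W$ for $j:W\to\mathbf{P}$ the smooth locus) and $\Omega^p_{\mathbf{P}}(X)=\Omega^p_{\mathbf{P}}\otimes\mathcal{O}_{\mathbf{P}}(X)$; its local sections are rational $p$-forms that become sections of $\Omega^p_{\mathbf{P}}$ after multiplication by a local equation of $X$. Rational forms on $\mathbf{P}$ are identified with their pullbacks to $U(\Sigma)$, written in $z_i,dz_i$; for $m\in M$ the character $t^m$ of $\mathbf{T}$ pulls back to $\prod_i z_i^{\langle m,e_i\rangle}$. Fix a $\mathbf{Z}$-basis $m_1,\dots,m_d$ of $M$. For an (ordered) $d$-element subset $I=\{i_1,\dots,i_d\}\subset\{1,\dots,n\}$ put $\det(e_I)=\det(\langle m_j,e_{i_k}\rangle_{1\le j,k\le d})$. For a subset $J=\{j_1,\dots,j_r\}$ put $dz_J=dz_{j_1}\wedge\cdots\wedge dz_{j_r}$ and $\widehat z_J=\prod_{l\notin J}z_l$. For $1\le i\le n$, $$\Omega_i=\sum_{|J|=d-1,\ i\notin J}\det(e_{J\cup\{i\}})\,\widehat z_{J\cup\{i\}}\,dz_J,$$ where $\det(e_{J\cup\{i\}})$ is computed by ordering $J\cup\{i\}$ with $i$ first, followed by $J$ in the order used for $dz_J$. *)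

(* Defs.v *)
From HB Require Import structures.
From mathcomp Require Import all_boot all_order all_algebra.
From mathcomp Require Import fraction.
From mathcomp Require Import mpoly.
From mathcomp Require Import complex reals ring.

Set Implicit Arguments.
Unset Strict Implicit.
Unset Printing Implicit Defensive.

Import Order.TTheory GRing.Theory Num.Theory.
Local Open Scope ring_scope.
Local Open Scope quotient_scope.

(* A Z-basis m_1, ..., m_d of M is fixed, so that M and N are both identified  *)
(* with 'rV[int]_d through dual bases: (e i) 0 j is <m_j, e_i>.                *)
Definition pairing (d : nat) (m v : 'rV[int]_d) : int :=
  \sum_(j < d) m 0 j * v 0 j.

Section Fan.

Variables (R : realType) (d n : nat) (e : 'I_n -> 'rV[int]_d).

Definition primitive_vec (v : 'rV[int]_d) : Prop :=
  forall (k : int) (w : 'rV[int]_d), v = k *: w -> k = 1 \/ k = -1.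

Definition ray_real (i : 'I_n) : 'rV[R]_d := map_mx intr (e i).

Definition in_cone (I : {set 'I_n}) (v : 'rV[R]_d) : Prop :=
  exists a : 'I_n -> R,
    (forall i, 0 <= a i) /\ v = \sum_(i in I) a i *: ray_real i.

(* A simplicial cone is encoded by the set I of (indices of) its rays; its     *)
(* faces are then the cones of the subsets of I.  By fan_rays together with    *)
(* fan_meet, distinct indices give distinct rays, and the rays of the fan are  *)
(* exactly rho_1, ..., rho_n.                                                  *)
Record simplicial_complete_fan (Sigma : {set {set 'I_n}}) : Prop := {
  fan_primitive : forall i, primitive_vec (e i);
  fan_rays : forall i, [set i] \in Sigma;
  fan_simplicial : forall I, I \in Sigma -> forall a : 'I_n -> R,
    \sum_(i in I) a i *: ray_real i = 0 -> forall i, i \in I -> a i = 0;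
  fan_faces : forall I J : {set 'I_n}, I \in Sigma -> J \subset I -> J \in Sigma;
  fan_meet : forall I J : {set 'I_n}, I \in Sigma -> J \in Sigma ->
    forall v, in_cone I v -> in_cone J v -> in_cone (I :&: J) v;
  fan_complete : forall v, exists2 I, I \in Sigma & in_cone I v }.

End Fan.

Section RationalFunctions.

Variables (F : fieldType) (n : nat).

Local Notation K := {fraction {mpoly F[n]}}.

Definition cstK (c : F) : K := tofrac c%:MP.
Definition zK (i : 'I_n) : K := tofrac 'X_i.

(* g is regular at the point u of affine space, with value c there. *)
Definition has_value (u : 'I_n -> F) (g : K) (c : F) : Prop :=
  exists p q : {mpoly F[n]},
    [/\ q.@[u] != 0, g = tofrac p / tofrac q & c = p.@[u] / q.@[u]].

(* d g / d z_i, by the quotient rule on a representative fraction; see         *)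
(* pderivE for the independence of the representative.                         *)
Definition pderiv (i : 'I_n) (g : K) : K :=
  let p := (frac (repr g)).1 in
  let q := (frac (repr g)).2 in
  tofrac (mderiv i p * q - p * mderiv i q) / tofrac (q ^+ 2).

(* A p-form sum_J w_J dz_J is given by its coefficients as an alternating      *)
(* multilinear form: w js is the value on (d/dz_(js 0), ..., d/dz_(js p.-1)),  *)
(* so that w_J is the value at the increasing enumeration of J.                *)
Definition dform (p : nat) := {ffun p.-tuple 'I_n -> K}.

Definition scale_form p (g : K) (w : dform p) : dform p :=
  [ffun js => g * w js].

(* d h_0 /\ ... /\ d h_(p-1) *)
Definition wedge_d p (h : p.-tuple K) : dform p :=
  [ffun js => \det (\matrix_(k < p, l < p) pderiv (tnth js l) (tnth h k))].

Definition dz p (J : p.-tuple 'I_n) : dform p := wedge_d (map_tuple zK J).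

(* The A-span of the forms dh_1 /\ ... /\ dh_p with all h_i in A: this is the  *)
(* image of the p-th exterior power of the Kaehler differentials of the ring A.*)
Definition forms_over (A : K -> Prop) p (w : dform p) : Prop :=
  exists s : seq (K * p.-tuple K),
    (forall x, x \in s -> A x.1 /\ forall k, A (tnth x.2 k)) /\
    w = \sum_(x <- s) scale_form x.1 (wedge_d x.2).

Lemma repr_fracE (g : K) :
  g = tofrac (frac (repr g)).1 / tofrac (frac (repr g)).2.
Proof.
have nz : tofrac (frac (repr g)).2 != 0 by rewrite tofrac_eq0 denom_ratioP.
apply: (mulIf nz); rewrite divfK // /tofrac -{1}[g]reprK.
case: (repr g) => [[a b] /= b0]; unlock FracField.tofrac.
rewrite -[LHS]FracField.pi_mul.
apply/eqmodP; rewrite /= FracField.equivfE /FracField.mulf /=.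
by rewrite !numden_Ratio ?mulr1 ?oner_neq0 //= mulrC.
Qed.

Lemma pderivE i (p q : {mpoly F[n]}) : q != 0 ->
  pderiv i (tofrac p / tofrac q) =
    tofrac (mderiv i p * q - p * mderiv i q) / tofrac (q ^+ 2).
Proof.
move=> q0; rewrite /pderiv; set g := tofrac p / tofrac q.
have := repr_fracE g; have := denom_ratioP (repr g).
move: (frac (repr g)).1 (frac (repr g)).2 => a b b0 gE.
have Kn r : r != 0 -> tofrac r != 0 by rewrite tofrac_eq0.
have eq1 : a * q = p * b.
  apply/eqP; rewrite -tofrac_eq !tofracM.
  by rewrite -eqr_div ?Kn // -gE.
have eq2 : mderiv i a * q + a * mderiv i q = mderiv i p * b + p * mderiv i b.
  by rewrite -!mderivM eq1.
apply/eqP; rewrite eqr_div ?Kn ?expf_neq0 //; apply/eqP.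
rewrite -!tofracM; congr tofrac.
move: eq1 eq2; move: (mderiv i a) (mderiv i b) (mderiv i p) (mderiv i q).
move=> a' b' p' q' eq1 eq2.
have -> : (a' * b - a * b') * q ^+ 2 =
  (a' * q + a * q') * (b * q) - (a * q) * (b * q') - (a * q) * (b' * q) by ring.
by rewrite eq2 eq1; ring.
Qed.

End RationalFunctions.

Section ToricVariety.

Variables (F : fieldType) (d n : nat) (e : 'I_n -> 'rV[int]_d).
Variable Sigma : {set {set 'I_n}}.

Local Notation K := {fraction {mpoly F[n]}}.
Local Notation S := {mpoly F[n]}.
Local Notation pt := ('I_n -> F).

(* An element of Cl(Sigma) = Z^n / alpha(M) is represented by some b in Z^n.   *)
Definition divclass := 'I_n -> int.

Definition same_class (a b : divclass) : Prop :=
  exists m : 'rV[int]_d, forall i, a i - b i = pairing m (e i).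

Definition in_degree (b : divclass) (f : S) : Prop :=
  forall m : 'X_{1..n}, m \in msupp f -> same_class (fun i => (m i)%:Z) b.

(* beta - beta_0 + beta_i *)
Definition shifted_class (b : divclass) (i : 'I_n) : divclass :=
  fun l => b l - 1 + (l == i)%:Z.

(* The variety is the quotient of U(Sigma) by D(Sigma): its points are the     *)
(* points of U(Sigma) modulo same_pt, and a rational function on it is regular *)
(* at the image of u iff its pullback is regular at u.                         *)

Definition inU (u : pt) : Prop :=
  exists2 I, I \in Sigma & \prod_(i | i \notin I) u i != 0.

Definition inD (t : pt) : Prop :=
  (forall i, t i != 0) /\
  forall m : 'rV[int]_d, \prod_(i < n) t i ^ pairing m (e i) = 1.

Definition same_pt (u v : pt) : Prop :=
  exists2 t, inD t & forall i, v i = t i * u i.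

(* Pullback of the character t^m of the torus. *)
Definition chi (m : 'rV[int]_d) : K := \prod_(i < n) zK F i ^ pairing m (e i).

Definition torus_regular (g : K) : Prop :=
  exists s : seq (F * 'rV[int]_d), g = \sum_(x <- s) cstK n x.1 * chi x.2.

(* Pullbacks of the rational functions on the variety, i.e. on its torus. *)
Definition function_field (g : K) : Prop :=
  exists a b, [/\ torus_regular a, torus_regular b, b != 0 & g = a / b].

(* The local ring at the image of u, and its maximal ideal. *)
Definition local_ring (u : pt) (g : K) : Prop :=
  function_field g /\ exists c, has_value u g c.

Definition max_ideal (u : pt) (g : K) : Prop :=
  function_field g /\ has_value u g 0.

(* The smooth locus W: the local ring is regular, of dimension d. *)
Definition smooth_pt (u : pt) : Prop :=
  exists t : 'I_d -> K, (forall k, max_ideal u (t k)) /\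
    forall g, max_ideal u g -> exists a : 'I_d -> K,
      (forall k, local_ring u (a k)) /\ g = \sum_(k < d) a k * t k.

Section Divisor.

Variable f : S.

(* h is an equation of the divisor X = {f = 0} near the image of u: h and f    *)
(* differ by a unit of the local ring of U(Sigma) at u.                        *)
Definition local_equation (u : pt) (h : K) : Prop :=
  function_field h /\ exists2 c, c != 0 & has_value u (h / tofrac f) c.

Definition Cartier : Prop := forall u, inU u -> exists h, local_equation u h.

(* Global sections of O(k X), as rational functions. *)
Definition section_O (k : nat) (g : K) : Prop :=
  function_field g /\
  forall u, inU u -> forall h, local_equation u h -> local_ring u (g * h ^+ k).

(* y is a vector of homogeneous coordinates of the image of u under the map to *)
(* P^N given by the sections s_0, ..., s_N of O(k X).                          *)
Definition proj_map (k N : nat) (s : 'I_N.+1 -> K) (u : pt)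
    (y : 'I_N.+1 -> F) : Prop :=
  (exists j, y j != 0) /\
  exists2 h, local_equation u h & forall j, has_value u (s j * h ^+ k) (y j).

Definition proj_eq (N : nat) (y y' : 'I_N.+1 -> F) : Prop :=
  exists2 c, c != 0 & forall j, y' j = c * y j.

(* Closed subsets of the quotient, as D-stable closed subsets of U(Sigma). *)
Definition closed_subset (Z : pt -> Prop) : Prop :=
  (exists E : S -> Prop,
     forall u, Z u <-> inU u /\ forall p, E p -> p.@[u] = 0) /\
  forall u v, same_pt u v -> Z u -> Z v.

(* The sections s_0, ..., s_N define a closed embedding into P^N: they have no *)
(* common zero, and the resulting map is injective, closed, and surjective on  *)
(* local rings.                                                                *)
Record closed_embedding (k N : nat) (s : 'I_N.+1 -> K) : Prop := {
  emb_defined : forall u, inU u -> exists y, proj_map k s u y;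
  emb_injective : forall u v y y', inU u -> inU v ->
    proj_map k s u y -> proj_map k s v y' -> proj_eq y y' -> same_pt u v;
  emb_closed : forall (Z : pt -> Prop) (y : 'I_N.+1 -> F),
    closed_subset Z -> (exists j, y j != 0) ->
    (forall u y', Z u -> proj_map k s u y' -> ~ proj_eq y y') ->
    exists (r : nat) (G : {mpoly F[N.+1]}),
      [/\ G \is r.-homog, G.@[y] != 0 &
          forall u y', Z u -> proj_map k s u y' -> G.@[y'] = 0];
  emb_local_rings : forall u y, inU u -> proj_map k s u y ->
    forall a, local_ring u a ->
    exists (r : nat) (G H : {mpoly F[N.+1]}),
      [/\ G \is r.-homog, H \is r.-homog, H.@[y] != 0 &
          a = mmap (@cstK F n) s G / mmap (@cstK F n) s H] }.

Definition ample : Prop :=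
  exists (k N : nat) (s : 'I_N.+1 -> K),
    [/\ (0 < k)%N, forall j, section_O k (s j) & closed_embedding k s].

(* H^0(P, Omega^p(X)), Omega^p being the sheaf of Zariski forms.  Regularity   *)
(* of h * w is only required at smooth points because Omega^p is the direct    *)
(* image of the sheaf of p-forms on W; a local equation of X at a point is     *)
(* also one at all nearby points, so nothing is lost in working pointwise.     *)
Definition global_section_Omega (p : nat) (w : dform F n p) : Prop :=
  forms_over function_field w /\
  forall u, inU u -> smooth_pt u -> forall h, local_equation u h ->
    forms_over (local_ring u) (scale_form h w).

End Divisor.

(* det(e_I) for an ordered list I of d indices; x0 is an unused default. *)
Definition det_e (x0 : 'I_n) (I : seq 'I_n) : int :=
  \det (\matrix_(j < d, k < d) (e (nth x0 I k)) 0 j).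

(* A subset J with d - 1 elements is given by its increasing enumeration. *)
Definition Omega (i : 'I_n) : dform F n d.-1 :=
  \sum_(J : d.-1.-tuple 'I_n | sorted ltn (map val J) && (i \notin J))
    scale_form
      ((det_e i (i :: J))%:~R * \prod_(l | l \notin i :: J) zK F l) (dz F J).

End ToricVariety.

(* Main.v *)
Require Import Defs.
From HB Require Import structures.
From mathcomp Require Import all_boot all_order all_algebra.
From mathcomp Require Import fraction.
From mathcomp Require Import mpoly.
From mathcomp Require Import complex reals.
From mathcomp Require Import perm ring zify.
From mathcomp Require boolp.

Set Implicit Arguments.
Unset Strict Implicit.
Unset Printing Implicit Defensive.

Import Order.TTheory GRing.Theory Num.Theory.
Local Open Scope ring_scope.

(* A rational (d-1)-form on the torus is the contraction of the invariant volume
   form with a unique vector G of rational functions, and Omega_i is the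
   contraction with (prod_l z_l / z_i) e_i.

   If the form is a global section, regularity on the torus and at the generic
   points of the divisors z_i = 0 shows that f G is a vector P of polynomials of
   class beta, parallel to e_i along z_i = 0.  So the coefficient vector of a
   monomial of P divisible by every z_l is arbitrary, hence a combination of the
   e_i; if only z_i is missing, it is a multiple of e_i; if z_i and z_j are
   missing, it is 0, except possibly when e_j = - e_i.  In that exceptional case
   no section of any multiple of X involves z_i, which contradicts ampleness.
   Dividing by prod_(l != i) z_l gives the A_i.

   Conversely, a point of U is smooth only if the cone of its vanishing
   coordinates is unimodular, and there the forms are visibly regular in terms
   of characters t^m dual to that cone. *)

(** * Rational functions regular in codimension one *)

(** Smoothness is defined by generators of a maximal ideal, and the two directions need opposite
    facts about it. Points with at most one vanishing coordinate are smooth, and their complement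
    has codimension two, so a function regular at all of them is a polynomial; this gives
    numerators. For the converse, smoothness must force unimodularity: if a ray of the cone had no
    dual character, there would be one irreducible exponent too many, and each gives a point
    derivation independent of the others. Parallelism to [e_i] along [z_i = 0] comes from duality:
    the logarithmic gradient of a function regular there is orthogonal to [e_i], because
    [z_i d/dz_i] of it vanishes, and the cross product of d - 1 vectors orthogonal to [e_i] is
    parallel to [e_i]. Ampleness enters through injectivity. If [e_j = - e_i] and a monomial of
    class beta avoids [z_i] and [z_j], then every monomial [nu] of class k beta satisfies
    [nu_i + nu_j = 0], so sections cannot separate points that differ only in [z_i]. *)

Lemma mpoly_rmorph_ext (A B : comNzRingType) n (f g : {rmorphism {mpoly A[n]} -> B}) :
  (forall c, f c%:MP = g c%:MP) -> (forall i, f 'X_i = g 'X_i) -> f =1 g.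
Proof.
move=> hC hX p; rewrite (mpolyE p) !rmorph_sum /=; apply: eq_bigr => m _.
rewrite -mul_mpolyC !rmorphM hC; congr (_ * _).
rewrite mpolyXE_id !rmorph_prod; apply: eq_bigr => i _.
by rewrite !rmorphXn hX.
Qed.

Section Uni.
Variables (n : nat) (F : fieldType).
Implicit Types (p q : {mpoly F[n.+1]}) (u : 'I_n -> F).

Definition ext_pt u (a : F) : 'I_n.+1 -> F :=
  fun i => if unlift ord_max i is Some j then u j else a.

Lemma ext_pt_max u a : ext_pt u a ord_max = a.
Proof. by rewrite /ext_pt unlift_none. Qed.

Lemma widen_lift (i : 'I_n) : widen_ord (leqnSn n) i = lift ord_max i.
Proof. by apply: val_inj; rewrite /= /bump leqNgt ltn_ord. Qed.

Lemma ext_pt_widen u a i : ext_pt u a (widen_ord (leqnSn n) i) = u i.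
Proof. by rewrite widen_lift /ext_pt liftK. Qed.

Lemma muni_eval u a p : (map_poly (meval u) (muni p)).[a] = p.@[ext_pt u a].
Proof.
rewrite muniE rmorph_sum horner_sum mevalE; apply: eq_bigr => m _.
rewrite /= map_polyZ /= map_polyXn hornerZ hornerXn mevalZ mevalX -mulrA.
rewrite big_ord_recr /= ext_pt_max; congr (_ * (_ * _)).
by apply: eq_bigr => i _; rewrite mnmE ext_pt_widen; congr (_ ^+ m _); apply: val_inj.
Qed.

Definition umulti (T : {poly {mpoly F[n]}}) : {mpoly F[n.+1]} :=
  (map_poly (@mwiden n F) T).['X_ord_max].

Lemma umultiM : {morph umulti : S T / S * T}.
Proof. by move=> S T; rewrite /umulti rmorphM hornerM. Qed.

Lemma muniX_max : muni ('X_ord_max : {mpoly F[n.+1]}) = 'X.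
Proof.
rewrite muniE msuppX big_seq1 mcoeffX eqxx scale1r mnm1E eqxx expr1.
have -> : [multinom (U_(ord_max) (widen_ord (leqnSn n) i))%MM | i < n] = 0%MM :> 'X_{1..n}.
  by apply/mnmP => i; rewrite mnmE mnm1E widen_lift (negbTE (neq_lift _ _)) mnm0E.
by rewrite mpolyX0 scale1r.
Qed.

Lemma muniX_widen i : muni ('X_(widen_ord (leqnSn n) i) : {mpoly F[n.+1]}) = ('X_i)%:P.
Proof.
rewrite muniE msuppX big_seq1 mcoeffX eqxx scale1r mnm1E widen_lift eq_sym.
rewrite (negbTE (neq_lift _ _)) expr0 alg_polyC; congr ('X_[_])%:P.
by apply/mnmP => j; rewrite mnmE !mnm1E widen_lift (inj_eq lift_inj).
Qed.

Lemma muniK : cancel (@muni n F) umulti.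
Proof.
pose g : {rmorphism {mpoly F[n.+1]} -> {mpoly F[n.+1]}} :=
  horner_eval 'X_ord_max \o map_poly (@mwiden n F) \o @muni n F.
apply: (mpoly_rmorph_ext (f := g) (g := idfun)) => [c|i] /=.
  by rewrite /horner_eval muniC map_polyC hornerC /= mwidenC.
rewrite /horner_eval; case: (unliftP ord_max i) => [j|] ->.
  rewrite -widen_lift muniX_widen map_polyC hornerC /= mwidenX.
  by rewrite mnmwiden1; congr 'X_[U_(_)]; apply: val_inj.
by rewrite muniX_max map_polyX hornerX.
Qed.

Lemma muni_inj : injective (@muni n F). Proof. exact: can_inj muniK. Qed.

Lemma muni_eq0 p : (muni p == 0) = (p == 0).
Proof. by rewrite -(inj_eq muni_inj) rmorph0. Qed.

End Uni.

Section TorusPoints.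
Variable F : numClosedFieldType.

Lemma poly_nonroot (g : {poly F}) : g != 0 -> exists2 a, a != 0 & g.[a] != 0.
Proof.
(* Positive integers are distinct and nonzero in characteristic 0, and there are more of them here
   than ['X * g] can have roots. *)
move=> g0; pose s := [seq i.+1%:R : F | i <- iota 0 (size ('X * g))].
have us : uniq s.
  by rewrite map_inj_uniq ?iota_uniq // => i j /eqP; rewrite eqr_nat => /eqP [].
have [/allP /= all0|] := boolP (all (root ('X * g)) s).
  have Xg0 : 'X * g != 0 by rewrite mulf_neq0 ?polyX_eq0.
  by have := max_poly_roots Xg0 (introT allP all0) us; rewrite size_map size_iota ltnn.
case/allPn => a /mapP [i _ ->]; rewrite /root hornerM hornerX mulf_eq0 negb_or.
by case/andP => ? ?; exists i.+1%:R.
Qed.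

(** Induction on the number of variables: keep the leading coefficient in the last variable nonzero,
    then choose a last coordinate that is not a root. *)
Lemma torus_nonzero n (p : {mpoly F[n]}) :
  p != 0 -> exists2 u, (forall i, u i != 0) & p.@[u] != 0.
Proof.
elim: n p => [|n IH] p p0.
  exists (fun=> 0) => [[]//|].
  by move: p0; rewrite (nvar0_mpolyC p) mevalC mpolyC_eq0.
have c0 : lead_coef (muni p) != 0 by rewrite lead_coef_eq0 muni_eq0.
have [u u0 cu] := IH _ c0.
have g0 : map_poly (meval u) (muni p) != 0.
  by apply: contraNneq cu => /polyP /(_ (size (muni p)).-1); rewrite coef_map coef0 /= => ->.
have [a a0 ga] := poly_nonroot g0.
exists (ext_pt u a); last by rewrite -muni_eval.
by move=> i; rewrite /ext_pt; case: unlift.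
Qed.

End TorusPoints.

(** With [p / q] a reduced form of [P / Q], this carries an equation [P / Q = t / s] over to
    [p / q]. *)
Lemma cross_cancel (A : idomainType) (c g p q P Q s t : A) : g != 0 ->
  c * P = g * p -> c * Q = g * q -> P * s = t * Q -> p * s = t * q.
Proof.
move=> g0 EP EQ PQ; apply: (mulfI g0).
by rewrite mulrA -EP -mulrA PQ mulrCA EQ mulrCA.
Qed.

Section PolyOverDomain.

Variables (A : idomainType) (k : fieldType) (f : {rmorphism A -> k}).
Hypothesis f_inj : injective f.
Hypothesis f_frac : forall a : k, exists2 x : A * A, x.2 != 0 & a * f x.2 = f x.1.

Let io : {poly A} -> {poly k} := map_poly f.

Lemma clear_denom (G : {poly k}) :
  exists2 c : A, c != 0 & exists H : {poly A}, io H = (f c)%:P * G.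
Proof.
elim/poly_ind: G => [|G a [c c0 [H HG]]].
  by exists 1; [exact: oner_neq0|exists 0; rewrite mulr0 /io rmorph0].
have [[x y] /= y0 xE] := f_frac a.
exists (c * y); first exact: mulf_neq0.
exists (y%:P * H * 'X + (c * x)%:P).
rewrite /io rmorphD !rmorphM /= map_polyX !map_polyC -/io HG /= -xE !rmorphM /=; ring.
Qed.

(** Take the gcd and a Bezout relation over the quotient field [k]; clearing denominators costs only
    constants of [A]. This stands in for unique factorisation: [p] and [q] have no common zero where
    the constant [cd.2] does not vanish. *)
Lemma gcd_over_domain (P Q : {poly A}) : Q != 0 ->
  exists cd : A * A, [/\ cd.1 != 0, cd.2 != 0 & exists g p q a b : {poly A},
    [/\ cd.1%:P * P = g * p, cd.1%:P * Q = g * q & p * a + q * b = cd.2%:P]].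
Proof.
move=> Q0.
have io_inj : injective io by apply: map_inj_poly => //; exact: rmorph0.
have io0 : io 0 = 0 by exact: rmorph0.
have ioC c : io c%:P = (f c)%:P by exact: map_polyC.
have ioM : {morph io : x y / x * y} by exact: rmorphM.
have ioD : {morph io : x y / x + y} by exact: rmorphD.
have iQ0 : io Q != 0 by rewrite -io0 (inj_eq io_inj).
pose g := gcdp (io P) (io Q).
have g0 : g != 0 by rewrite gcdp_eq0 negb_and iQ0 orbT.
have eP : io P = io P %/ g * g by rewrite divpK ?dvdp_gcdl.
have eQ : io Q = io Q %/ g * g by rewrite divpK ?dvdp_gcdr.
have cop : coprimep (io P %/ g) (io Q %/ g) by apply: coprimep_div_gcd; rewrite iQ0 orbT.
move: eP eQ cop; move: (io P %/ g) (io Q %/ g) => P1 Q1 eP eQ.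
case/Bezout_eq1_coprimepP => -[al be] /= bez.
have [c1 c10 [p1 e1]] := clear_denom P1.
have [c2 c20 [q1 e2]] := clear_denom Q1.
have [c3 c30 [a1 e3]] := clear_denom al.
have [c4 c40 [b1 e4]] := clear_denom be.
have [c5 c50 [g1 e5]] := clear_denom g.
exists (c1 * c2 * c5, c1 * c2 * c3 * c4); split; rewrite /= ?mulf_neq0 //.
exists g1, (c2%:P * p1), (c1%:P * q1), (c4%:P * a1), (c3%:P * b1).
split; apply: io_inj; rewrite ?ioD !ioM !ioC ?e1 ?e2 ?e3 ?e4 ?e5 ?eP ?eQ !rmorphM /=.
- by ring.
- by ring.
by rewrite -[RHS]mulr1 -bez; ring.
Qed.

End PolyOverDomain.

Section RegularInCodimensionOne.
Variable F : numClosedFieldType.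

(** Inverts the Vandermonde matrix of the nodes 1, ..., N. The nodes are nonzero, so fixing the last
    coordinate at one of them creates no new vanishing coordinate. *)
Lemma interpolation n N (k : 'I_N) : exists lam : 'I_N -> F,
  forall T : {poly {mpoly F[n]}}, (size T <= N)%N ->
    T`_k = \sum_(j < N) lam j *: T.[(j.+1%:R)%:MP].
Proof.
pose V := Vandermonde N (\row_(j < N) (j.+1%:R : F)).
have Vu : V \in unitmx.
  rewrite unitmxE det_Vandermonde unitfE; apply/prodf_neq0 => i _.
  apply/prodf_neq0 => j ij; rewrite !mxE subr_eq0 eqr_nat eqSS.
  by rewrite neq_ltn ij orbT.
exists (fun j => invmx V j k) => T sT.
have /matrixP VV := mulmxV Vu.
transitivity (\sum_(i < N) (i == k)%:R *: T`_i).
  by rewrite (bigD1 k) //= eqxx scale1r big1 ?addr0 // => i /negbTE ->; rewrite scale0r.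
under [RHS]eq_bigr => j _ do rewrite (horner_coef_wide _ sT) scaler_sumr.
rewrite exchange_big /=; apply: eq_bigr => i _.
have := VV i k; rewrite !mxE => <-; rewrite scaler_suml; apply: eq_bigr => j _.
by rewrite !mxE -(rmorphXn (@mpolyC n F)) [T`_i * _]mulrC mul_mpolyC scalerA mulrC.
Qed.

(** The complement of this locus has codimension two, and the locus lies in U for every fan, since
    each ray is a cone. *)
Definition few_zeros n (u : 'I_n -> F) := forall i j, u i = 0 -> u j = 0 -> i = j.

Lemma few_zeros_ext n (u : 'I_n -> F) a :
  few_zeros u -> a != 0 -> few_zeros (ext_pt u a).
Proof.
move=> hu a0 i j; rewrite /ext_pt.
case: (unliftP ord_max i) => [i'|] ->; last by move=> /eqP; rewrite (negbTE a0).
case: (unliftP ord_max j) => [j'|] ->; last by move=> _ /eqP; rewrite (negbTE a0).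
by move=> h1 h2; rewrite (hu _ _ h1 h2).
Qed.

Lemma torus_few_zeros_ext n (u : 'I_n -> F) a :
  (forall i, u i != 0) -> few_zeros (ext_pt u a).
Proof.
move=> hu i j; rewrite /ext_pt.
case: (unliftP ord_max i) => [i'|] ->; first by move/eqP; rewrite (negbTE (hu _)).
by case: (unliftP ord_max j) => [j'|] -> // _ /eqP; rewrite (negbTE (hu _)).
Qed.

(** If the reduced denominator had positive degree in the last variable, it would have a zero over a
    general torus point of the other variables. Such a point has at most one vanishing coordinate,
    and regularity there makes the reduced numerator vanish too, against Bezout. *)
Lemma denom_is_constant n (p q : {mpoly F[n.+1]}) : q != 0 ->
  (forall u, few_zeros u -> exists p' q', q'.@[u] != 0 /\ p * q' = p' * q) ->
  exists c (T : {poly {mpoly F[n]}}), c != 0 /\ c%:P * muni p = muni q * T.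
Proof.
move=> q0 hreg; set P := muni p; set Q := muni q.
have Q0 : Q != 0 by rewrite muni_eq0.
have f_frac (a : {fraction {mpoly F[n]}}) : exists2 x : {mpoly F[n]} * {mpoly F[n]},
    x.2 != 0 & a * tofrac x.2 = tofrac x.1.
  exists (frac (repr a)); first exact: denom_ratioP.
  by rewrite {1}(repr_fracE a) divfK // tofrac_eq0 denom_ratioP.
have f_inj : injective (@FracField.tofrac {mpoly F[n]}).
  by move=> x y /eqP; rewrite tofrac_eq => /eqP.
have [[c de] /= [c0 de0 [g [p1 [q1 [a1 [b1 [EP EQ B]]]]]]]] := gcd_over_domain f_inj f_frac P Q0.
have /andP [g0 q10] : (g != 0) && (q1 != 0).
  by rewrite -negb_or -mulf_eq0 -EQ mulf_neq0 // polyC_eq0.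
have [sq1|sq1] := boolP (size q1 == 1)%N.
  case/size_poly1P: sq1 => e e0 q1e; exists (e * c), (c%:P * p1); split; first exact: mulf_neq0.
  rewrite rmorphM /= -mulrA EP [RHS]mulrCA [RHS]mulrA EQ q1e; ring.
(* Both the Bezout constant and the leading coefficient of [q1] must survive at [u], so that [q1]
   keeps its degree and has a root there. *)
have [|u u0] := @torus_nonzero _ _ (de * lead_coef q1).
  by rewrite !mulf_neq0 ?lead_coef_eq0.
rewrite mevalM mulf_eq0 negb_or => /andP [du lu].
pose ev (x : {poly {mpoly F[n]}}) := map_poly (meval u) x.
have sm : size (ev q1) = size q1 by apply: size_map_poly_id0; rewrite /= lu.
have /closed_rootP [a /rootP ra] : size (ev q1) != 1%N by rewrite sm.
have [p' [q' [q'u pq]]] := hreg _ (torus_few_zeros_ext (a := a) u0).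
have PQ : P * muni q' = muni p' * Q.
  exact: etrans (esym (muniM p q')) (etrans (congr1 (@muni n F) pq) (muniM p' q)).
have PQ2 : p1 * muni q' = muni p' * q1.
  exact: cross_cancel g0 EP EQ PQ.
have evM (x y : {poly {mpoly F[n]}}) : (ev (x * y)).[a] = (ev x).[a] * (ev y).[a].
  by rewrite /ev rmorphM hornerM.
have p1u : (ev p1).[a] = 0.
  move/(congr1 (fun x => (ev x).[a])): PQ2.
  by rewrite !evM ra mulr0 [(ev (muni q')).[a]]muni_eval => /eqP; rewrite mulf_eq0 (negbTE q'u) orbF => /eqP.
move/(congr1 (fun x => (ev x).[a])): B.
rewrite /ev rmorphD hornerD -/ev !evM ra p1u !mul0r addr0 map_polyC hornerC /= => /esym/eqP.
by rewrite (negbTE du).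
Qed.

(** Induction on the number of variables. Once the denominator is a constant [c] in the last
    variable, it remains to divide each coefficient of [T] by [c]; these coefficients are
    combinations of values of [T] at nonzero constants, where regularity of [p / q] is inherited. *)
Lemma regular_dvd n (p q : {mpoly F[n]}) : q != 0 ->
  (forall u, few_zeros u -> exists p' q', q'.@[u] != 0 /\ p * q' = p' * q) ->
  exists r, p = q * r.
Proof.
elim: n p q => [|n IH] p q q0 hreg.
  rewrite (nvar0_mpolyC q) mpolyC_eq0 in q0 *.
  exists ((q@_0)^-1%:MP * p); by rewrite mulrA -mpolyCM divff // mul1r.
have [c [T [c0 cT]]] := denom_is_constant q0 hreg.
have /fin_all_exists [r hr] : forall k : 'I_(size T), exists r, T`_k = c * r.
  move=> k; apply: IH => // u hu.
  (* [D x] says that [x / c] is regular at [u]; it is closed under sums, hence passes through the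
     interpolation formula. *)
  pose D x := exists p' q' : {mpoly F[n]}, q'.@[u] != 0 /\ x * q' = p' * c.
  have [lam ->] := interpolation n k; last by [].
  apply: (big_ind D) => [|x y [p1 [q1 [q1u e1]]] [p2 [q2 [q2u e2]]]|j _].
  - by exists 0, 1; rewrite meval1 oner_neq0 !mul0r.
  - exists (p1 * q2 + p2 * q1), (q1 * q2); rewrite mevalM mulf_neq0 //; split=> //.
    by rewrite mulrDl mulrA e1 mulrCA e2; ring.
  have a0 : j.+1%:R != 0 :> F by rewrite pnatr_eq0.
  have [p' [q' [q'u pq]]] := hreg _ (few_zeros_ext hu a0).
  have hev (x : {poly {mpoly F[n]}}) (b : F) : x.[b%:MP].@[u] = (map_poly (meval u) x).[b].
    by rewrite -[b in RHS](mevalC u b) horner_map.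
  exists (lam j *: (muni p').[(j.+1%:R)%:MP]), (muni q').[(j.+1%:R)%:MP].
  rewrite hev muni_eval; split=> //; rewrite -!scalerAl; congr (_ *: _).
  rewrite -hornerM -[c in RHS](hornerC c (j.+1%:R)%:MP) -hornerM; congr (_.[_]).
  have Q0 : muni q != 0 by rewrite muni_eq0.
  apply: cross_cancel Q0 cT (mulrC _ _) _.
  exact: etrans (esym (muniM p q')) (etrans (congr1 (@muni n F) pq) (muniM p' q)).
exists (umulti (\poly_(k < size T) (if insub k is Some k' then r k' else 0))).
rewrite -[LHS]muniK -[q in RHS]muniK -umultiM; congr umulti.
have C0 : c%:P != 0 by rewrite polyC_eq0.
apply: (mulfI C0); rewrite cT mulrCA; congr (_ * _).
apply/polyP => k; rewrite coefCM coef_poly; case: ltnP => kT; last by rewrite nth_default ?mulr0.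
by rewrite (insubT (fun k => (k < size T)%N) kT) -hr.
Qed.

End RegularInCodimensionOne.

(** * Values and derivatives of rational functions *)

Section Values.

Variables (F : fieldType) (n : nat).
Local Notation K := {fraction {mpoly F[n]}}.
Local Notation tf := (@FracField.tofrac {mpoly F[n]}).
Implicit Types (p q : {mpoly F[n]}) (g h : K) (u : 'I_n -> F) (c : F).

Lemma tofrac_inj : injective tf.
Proof. by move=> x y /eqP; rewrite tofrac_eq => /eqP. Qed.

Lemma tofrac_neq0 u q : q.@[u] != 0 -> tf q != 0.
Proof. by rewrite tofrac_eq0; apply: contraNneq => ->; rewrite meval0. Qed.

Lemma hv_tofrac u p : has_value u (tf p) p.@[u].
Proof. by exists p, 1; rewrite !rmorph1 !divr1 oner_neq0. Qed.

Lemma hv_frac u p q : q.@[u] != 0 -> has_value u (tf p / tf q) (p.@[u] / q.@[u]).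
Proof. by move=> q0; exists p, q. Qed.

Lemma hv_cst u c : has_value u (cstK n c) c.
Proof. by have := hv_tofrac u c%:MP; rewrite mevalC. Qed.

Lemma hv_zK u i : has_value u (zK F i) (u i).
Proof. by have := hv_tofrac u 'X_i; rewrite mevalXU. Qed.

Lemma hv0 u : has_value u 0 0.
Proof. by have := hv_tofrac u 0; rewrite rmorph0 meval0. Qed.

Lemma hv1 u : has_value u 1 1.
Proof. by have := hv_tofrac u 1; rewrite rmorph1 meval1. Qed.

Lemma hvD u g h a b : has_value u g a -> has_value u h b -> has_value u (g + h) (a + b).
Proof.
move=> [p [q [q0 -> ->]]] [r [s [s0 -> ->]]].
exists (p * s + r * q), (q * s); rewrite mevalM mulf_neq0 //; split=> //.
  by rewrite addf_div ?(tofrac_neq0 (u := u)) // -!tofracM -tofracD.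
by rewrite addf_div // mevalD !mevalM.
Qed.

Lemma hvM u g h a b : has_value u g a -> has_value u h b -> has_value u (g * h) (a * b).
Proof.
move=> [p [q [q0 -> ->]]] [r [s [s0 -> ->]]].
exists (p * r), (q * s); rewrite mevalM mulf_neq0 //; split=> //.
  by rewrite mulf_div -!tofracM.
by rewrite mulf_div !mevalM.
Qed.

Lemma hvN u g a : has_value u g a -> has_value u (- g) (- a).
Proof.
move=> [p [q [q0 -> ->]]]; exists (- p), q; split=> //; first by rewrite rmorphN mulNr.
by rewrite mevalN mulNr.
Qed.

Lemma hvB u g h a b : has_value u g a -> has_value u h b -> has_value u (g - h) (a - b).
Proof. by move=> ga hb; apply: hvD ga (hvN hb). Qed.

Lemma hvV u g a : a != 0 -> has_value u g a -> has_value u g^-1 a^-1.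
Proof.
move=> a0 [p [q [q0 -> aE]]].
have p0 : p.@[u] != 0 by apply: contraNneq a0 => p0; rewrite aE p0 mul0r.
by exists q, p; rewrite p0 aE !invf_div.
Qed.

Lemma hv_inj u g a b : has_value u g a -> has_value u g b -> a = b.
Proof.
move=> [p [q [q0 -> ->]]] [r [s [s0 /eqP e ->]]].
move: e; rewrite eqr_div ?(tofrac_neq0 (u := u)) // -!tofracM => /eqP /tofrac_inj e.
by apply/eqP; rewrite eqr_div // -!mevalM e.
Qed.

Lemma hv_neq0 u g a : a != 0 -> has_value u g a -> g != 0.
Proof. by move=> a0 h; apply/eqP => g0; rewrite g0 in h; case/eqP: a0; apply: hv_inj h (hv0 u). Qed.

Lemma hv_sum u I (r : seq I) (P : pred I) (G : I -> K) (C : I -> F) :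
  (forall i, P i -> has_value u (G i) (C i)) ->
  has_value u (\sum_(i <- r | P i) G i) (\sum_(i <- r | P i) C i).
Proof. by move=> h; apply: (big_ind2 (has_value u)) => //; [apply: hv0|move=> *; apply: hvD]. Qed.

Lemma hv_prod u I (r : seq I) (P : pred I) (G : I -> K) (C : I -> F) :
  (forall i, P i -> has_value u (G i) (C i)) ->
  has_value u (\prod_(i <- r | P i) G i) (\prod_(i <- r | P i) C i).
Proof. by move=> h; apply: (big_ind2 (has_value u)) => //; [apply: hv1|move=> *; apply: hvM]. Qed.

Lemma hvX u g a k : has_value u g a -> has_value u (g ^+ k) (a ^+ k).
Proof.
move=> ga; elim: k => [|k IH]; first by rewrite !expr0; apply: hv1.
by rewrite !exprS; apply: hvM.
Qed.

Lemma hvXz u g a (z : int) : a != 0 -> has_value u g a -> has_value u (g ^ z) (a ^ z).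
Proof.
move=> a0 ga; case: z => k; first exact: hvX.
by rewrite NegzE -!exprnN; apply: hvV (hvX _ ga); rewrite expf_neq0.
Qed.

Lemma hv_det u m (M : 'M[K]_m) (N : 'M[F]_m) :
  (forall i j, has_value u (M i j) (N i j)) -> has_value u (\det M) (\det N).
Proof.
move=> h; apply: hv_sum => s _; apply: hvM; last by apply: hv_prod => i _; apply: h.
case: (perm.odd_perm s); last by rewrite !expr0; apply: hv1.
by rewrite !expr1; apply/hvN/hv1.
Qed.

Definition regular u g := exists c, has_value u g c.

Lemma hv_int u (z : int) : has_value u z%:~R z%:~R.
Proof.
have := hv_cst u z%:~R; rewrite /cstK.
suff -> : tf (z%:~R : F)%:MP = z%:~R by [].
by rewrite !rmorph_int.
Qed.

Section Deriv.
Variable i : 'I_n.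
Local Notation D := (pderiv i).

Lemma pderiv_frac p q : q != 0 ->
  D (tf p / tf q) = (tf (mderiv i p) * tf q - tf p * tf (mderiv i q)) / tf q ^+ 2.
Proof. by move=> q0; rewrite pderivE // tofracB !tofracM. Qed.

Lemma frac_ex g : exists p q, q != 0 /\ g = tf p / tf q.
Proof.
by exists (frac (repr g)).1, (frac (repr g)).2; rewrite denom_ratioP -repr_fracE.
Qed.

Lemma pderiv_tofrac p : D (tf p) = tf (mderiv i p).
Proof.
have := pderiv_frac p (oner_neq0 _).
by rewrite rmorph1 -mpolyC1 mderivC rmorph0 mulr0 subr0 expr1n !divr1 mulr1.
Qed.

Lemma quotient_rule_add (L : fieldType) (p q r s p' q' r' s' : L) : q != 0 -> s != 0 ->
  ((p' * s + p * s' + (r' * q + r * q')) * (q * s) - (p * s + r * q) * (q' * s + q * s'))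
     / (q * s) ^+ 2
  = (p' * q - p * q') / q ^+ 2 + (r' * s - r * s') / s ^+ 2.
Proof. by move=> q0 s0; field; rewrite q0 s0. Qed.

Lemma quotient_rule_mul (L : fieldType) (p q r s p' q' r' s' : L) : q != 0 -> s != 0 ->
  ((p' * r + p * r') * (q * s) - p * r * (q' * s + q * s')) / (q * s) ^+ 2
  = (p' * q - p * q') / q ^+ 2 * (r / s) + p / q * ((r' * s - r * s') / s ^+ 2).
Proof. by move=> q0 s0; field; rewrite q0 s0. Qed.

Lemma pderivD g h : D (g + h) = D g + D h.
Proof.
have [p [q [q0 ->]]] := frac_ex g; have [r [s [s0 ->]]] := frac_ex h.
have [tq ts] : tf q != 0 /\ tf s != 0 by rewrite !tofrac_eq0.
have -> : tf p / tf q + tf r / tf s = tf (p * s + r * q) / tf (q * s).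
  by rewrite tofracD !tofracM (addf_div _ _ tq ts).
rewrite (pderiv_frac _ q0) (pderiv_frac _ s0) (pderiv_frac _ (mulf_neq0 q0 s0)).
rewrite mderivD !mderivM !tofracD !tofracM; exact: (quotient_rule_add _ _ _ _ _ _ tq ts).
Qed.

Lemma pderivM g h : D (g * h) = D g * h + g * D h.
Proof.
have [p [q [q0 ->]]] := frac_ex g; have [r [s [s0 ->]]] := frac_ex h.
have [tq ts] : tf q != 0 /\ tf s != 0 by rewrite !tofrac_eq0.
have -> : tf p / tf q * (tf r / tf s) = tf (p * r) / tf (q * s).
  by rewrite !tofracM mulf_div.
rewrite (pderiv_frac _ q0) (pderiv_frac _ s0) (pderiv_frac _ (mulf_neq0 q0 s0)).
rewrite !mderivM !tofracD !tofracM; exact: (quotient_rule_mul _ _ _ _ _ _ tq ts).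
Qed.

Lemma pderiv_cst c : D (cstK n c) = 0.
Proof. by rewrite pderiv_tofrac mderivC rmorph0. Qed.

Lemma pderiv_zK j : D (zK F j) = (i == j)%:R.
Proof.
rewrite pderiv_tofrac mderivX mnm1E eq_sym; case: eqP => [->|_]; last by rewrite scale0r rmorph0.
have -> : (U_(j) - U_(j) = 0)%MM by apply/mnmP => k; rewrite mnmBE subnn mnm0E.
by rewrite mpolyX0 scale1r rmorph1.
Qed.

Lemma regular_pderiv u g : regular u g -> regular u (D g).
Proof.
move=> [c [p [q [q0 -> _]]]].
have qn : q != 0 by apply: contraNneq q0 => ->; rewrite meval0.
exists ((mderiv i p * q - p * mderiv i q).@[u] / (q ^+ 2).@[u]).
rewrite pderivE //; apply: hv_frac; by rewrite rmorphXn /= expf_neq0.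
Qed.

End Deriv.
End Values.

(** * The function field and logarithmic gradients *)

Section FunctionField.

Variables (F : fieldType) (d n : nat) (e : 'I_n -> 'rV[int]_d).
Local Notation K := {fraction {mpoly F[n]}}.
Implicit Types (g h : K) (m : 'rV[int]_d).

Lemma zK_neq0 i : zK F i != 0 :> K.
Proof. by rewrite tofrac_eq0 -msupp_eq0 msuppX. Qed.

Lemma pairingD m m' v : pairing (m + m') v = pairing m v + pairing m' v.
Proof. by rewrite -big_split /=; apply: eq_bigr => j _; rewrite mxE mulrDl. Qed.

Lemma pairingN m v : pairing (- m) v = - pairing m v.
Proof. by rewrite -sumrN; apply: eq_bigr => j _; rewrite mxE mulNr. Qed.

Lemma pairing0 v : pairing (0 : 'rV_d) v = 0.
Proof. by apply: big1 => j _; rewrite mxE mul0r. Qed.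

Local Notation chi := (chi F e).

Lemma chiD m m' : chi (m + m') = chi m * chi m'.
Proof.
rewrite -big_split; apply: eq_bigr => i _.
by rewrite pairingD expfzDr // zK_neq0.
Qed.

Lemma chi0 : chi 0 = 1.
Proof. by apply: big1 => i _; rewrite pairing0 expr0z. Qed.

Lemma chi_neq0 m : chi m != 0.
Proof. by apply/prodf_neq0 => i _; rewrite expfz_neq0 ?zK_neq0. Qed.

Lemma chiN m : chi (- m) = (chi m)^-1.
Proof.
have h : chi (- m) * chi m = 1 by rewrite -chiD addNr chi0.
by rewrite -[LHS](mulfK (chi_neq0 m)) h mul1r.
Qed.

Local Notation TR := (@torus_regular F d n e).
Local Notation FF := (@function_field F d n e).

Lemma cstK0 : cstK n 0 = 0 :> K.
Proof. by rewrite /cstK !rmorph0. Qed.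
Lemma cstK1 : cstK n 1 = 1 :> K.
Proof. by rewrite /cstK !rmorph1. Qed.
Lemma cstKD (a b : F) : cstK n (a + b) = cstK n a + cstK n b.
Proof. by rewrite /cstK !rmorphD. Qed.
Lemma cstKM (a b : F) : cstK n (a * b) = cstK n a * cstK n b.
Proof. by rewrite /cstK !rmorphM. Qed.
Lemma cstKN (a : F) : cstK n (- a) = - cstK n a.
Proof. by rewrite /cstK !rmorphN. Qed.
Lemma cstK_int (z : int) : cstK n (z%:~R : F) = z%:~R.
Proof. by rewrite /cstK !rmorph_int. Qed.

Lemma tr_cst c : TR (cstK n c).
Proof. by exists [:: (c, 0)]; rewrite big_seq1 /= chi0 mulr1. Qed.

Lemma tr_chi m : TR (chi m).
Proof. by exists [:: (1, m)]; rewrite big_seq1 cstK1 mul1r. Qed.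

Lemma trD g h : TR g -> TR h -> TR (g + h).
Proof. by move=> [s ->] [t ->]; exists (s ++ t); rewrite big_cat. Qed.

Lemma trM g h : TR g -> TR h -> TR (g * h).
Proof.
move=> [s ->] [t ->].
exists [seq (x.1 * y.1, x.2 + y.2) | x <- s, y <- t].
rewrite big_distrlr big_allpairs_dep /=; apply: eq_bigr => x _; apply: eq_bigr => y _.
by rewrite cstKM chiD mulrACA.
Qed.

Lemma ff_tr g : TR g -> FF g.
Proof.
move=> gT; exists g, 1; split; rewrite ?oner_neq0 ?divr1 //.
by rewrite -cstK1; apply: tr_cst.
Qed.

Lemma ff_cst c : FF (cstK n c). Proof. exact/ff_tr/tr_cst. Qed.
Lemma ff_chi m : FF (chi m). Proof. exact/ff_tr/tr_chi. Qed.
Lemma ff0 : FF 0. Proof. by rewrite -cstK0; apply: ff_cst. Qed.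
Lemma ff1 : FF 1. Proof. by rewrite -cstK1; apply: ff_cst. Qed.
Lemma ff_int (z : int) : FF z%:~R. Proof. by rewrite -cstK_int; apply: ff_cst. Qed.

Lemma ffD g h : FF g -> FF h -> FF (g + h).
Proof.
move=> [a [b [ta tb b0 ->]]] [a' [b' [ta' tb' b0' ->]]].
exists (a * b' + a' * b), (b * b'); split.
- by apply: trD; [exact (trM ta tb')|exact (trM ta' tb)].
- exact (trM tb tb').
- exact (mulf_neq0 b0 b0').
exact (addf_div a a' b0 b0').
Qed.

Lemma ffM g h : FF g -> FF h -> FF (g * h).
Proof.
move=> [a [b [ta tb b0 ->]]] [a' [b' [ta' tb' b0' ->]]].
exists (a * a'), (b * b'); split.
- exact (trM ta ta').
- exact (trM tb tb').
- exact (mulf_neq0 b0 b0').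
exact (mulf_div a b a' b').
Qed.

Lemma ffN g : FF g -> FF (- g).
Proof. by move=> gF; rewrite -mulN1r; apply: ffM gF; rewrite -cstK1 -cstKN; apply: ff_cst. Qed.

Lemma ffB g h : FF g -> FF h -> FF (g - h).
Proof. by move=> gF /ffN; apply: ffD. Qed.

Lemma ffV g : FF g -> FF g^-1.
Proof.
move=> [a [b [ta tb b0 ->]]]; have [->|a0] := eqVneq a 0.
  by rewrite mul0r invr0; apply: ff0.
exists b, a; split; [exact tb|exact ta|exact a0|exact (invf_div a b)].
Qed.

Lemma ff_sum I (r : seq I) (P : pred I) (G : I -> K) :
  (forall i, P i -> FF (G i)) -> FF (\sum_(i <- r | P i) G i).
Proof. by move=> h; apply: (big_ind FF) => //; [apply: ff0|apply: ffD]. Qed.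

Lemma ff_prod I (r : seq I) (P : pred I) (G : I -> K) :
  (forall i, P i -> FF (G i)) -> FF (\prod_(i <- r | P i) G i).
Proof. by move=> h; apply: (big_ind FF) => //; [apply: ff1|apply: ffM]. Qed.

Lemma ff_det (k : nat) (M : 'M[K]_k) : (forall i j, FF (M i j)) -> FF (\det M).
Proof.
move=> h; apply: ff_sum => s _; apply: ffM; last by apply: ff_prod.
by case: (perm.odd_perm s); rewrite ?expr1 ?expr0; [apply: ffN|]; apply: ff1.
Qed.

Definition euler l g : K := zK F l * pderiv l g.

Lemma eulerD l g h : euler l (g + h) = euler l g + euler l h.
Proof. by rewrite /euler pderivD mulrDr. Qed.

Lemma eulerM l g h : euler l (g * h) = euler l g * h + g * euler l h.
Proof. rewrite /euler pderivM mulrDr; congr (_ + _); [exact (mulrA _ _ _)|exact (mulrCA _ _ _)]. Qed.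

Lemma euler_cst l c : euler l (cstK n c) = 0.
Proof. by rewrite /euler pderiv_cst mulr0. Qed.

Lemma euler1 l : euler l 1 = 0.
Proof. by rewrite -cstK1 euler_cst. Qed.

Lemma inverse_rule (L : fieldType) (g a b : L) :
  g != 0 -> a * g^-1 + g * b = 0 -> b = - a / g ^+ 2.
Proof.
move=> g0 /eqP; rewrite addrC addr_eq0 => /eqP h.
by rewrite -[b](mulKf g0) h; field.
Qed.

Lemma eulerV l g : euler l g^-1 = - euler l g / g ^+ 2.
Proof.
have [->|g0] := eqVneq g 0.
  by rewrite invr0 -cstK0 euler_cst oppr0 mul0r.
have := euler1 l; rewrite -(divff g0) eulerM; exact (inverse_rule g0).
Qed.

Lemma log_inverse_rule (L : fieldType) (g z : L) :
  g != 0 -> - (z * g) / g ^+ 2 = - z * g^-1.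
Proof. by move=> g0; field. Qed.

Lemma euler_monomial l (a : 'I_n -> int) :
  euler l (\prod_i zK F i ^ a i) = (a l)%:~R * \prod_i zK F i ^ a i.
Proof.
(* [lg g z]: [g] is an eigenvector of weight [z]. Weights add under products and change sign under
   inversion. *)
pose lg g (z : int) := euler l g = z%:~R * g.
have lg1 : lg 1 0 by rewrite /lg euler1 mul0r.
have lgM g h y z : lg g y -> lg h z -> lg (g * h) (y + z).
  rewrite /lg eulerM => -> ->; rewrite intrD mulrDl.
  by congr (_ + _); [exact (esym (mulrA _ _ _))|exact (mulrCA _ _ _)].
have lgX g z k : lg g z -> lg (g ^+ k) (z *+ k).
  move=> gz; elim: k => [//|k IH]; rewrite exprS mulrS; exact: lgM.
have lgV g z : lg g z -> lg g^-1 (- z).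
  rewrite /lg eulerV => ->; have [->|g0] := eqVneq g 0; first by rewrite invr0 !mulr0 oppr0 mul0r.
  by rewrite intrN; exact (log_inverse_rule _ g0).
have lgz i : lg (zK F i) (i == l)%:Z.
  by rewrite /lg /euler pderiv_zK eq_sym; case: eqP => [->|_]; rewrite ?mulr1 ?mul1r ?mulr0 ?mul0r.
have lgXz i z : lg (zK F i ^ z) ((i == l)%:Z * z).
  have lgp k : lg (zK F i ^+ k) ((i == l)%:Z * k%:Z).
    by rewrite -[k%:Z]natz mulr_natr; apply/lgX/lgz.
  case: z => k; first exact: lgp.
  by rewrite NegzE -exprnN mulrN; apply/lgV/lgp.
have sumE : \sum_i (i == l)%:Z * a i = a l.
  by rewrite (bigD1 l) //= eqxx mul1r big1 ?addr0 // => i /negbTE ->; rewrite mul0r.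
rewrite -[in RHS]sumE -/(lg _ _).
by apply: (big_ind2 lg) => [|g x h y|i _]; [exact: lg1|exact: lgM|exact: lgXz].
Qed.

Lemma euler_chi l m : euler l (chi m) = (pairing m (e l))%:~R * chi m.
Proof. exact: euler_monomial. Qed.

(* [theta] is the logarithmic gradient of [g] in the basis [dt_a / t_a] of the
   differentials of the torus. *)
Definition log_grad g (theta : 'rV[K]_d) :=
  forall l, euler l g = \sum_a theta 0 a * (e l 0 a)%:~R.

Lemma log_grad_chi m : log_grad (chi m) (chi m *: map_mx intr m).
Proof.
move=> l; rewrite euler_chi /pairing rmorph_sum mulr_suml; apply: eq_bigr => a _.
by rewrite !mxE rmorphM mulrAC [_ * chi m]mulrC.
Qed.

Lemma log_grad_cst c : log_grad (cstK n c) 0.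
Proof. by move=> l; rewrite euler_cst big1 // => a _; rewrite mxE mul0r. Qed.

Lemma log_gradD g h t s : log_grad g t -> log_grad h s -> log_grad (g + h) (t + s).
Proof.
move=> gt hs l; rewrite eulerD gt hs -big_split; apply: eq_bigr => a _.
by rewrite mxE mulrDl.
Qed.

Lemma log_gradM g h t s :
  log_grad g t -> log_grad h s -> log_grad (g * h) (h *: t + g *: s).
Proof.
move=> gt hs l; rewrite eulerM gt hs mulrC !mulr_sumr -big_split; apply: eq_bigr => a _.
by rewrite !mxE mulrDl !mulrA.
Qed.

Lemma log_gradV g t : log_grad g t -> log_grad g^-1 (- g ^- 2 *: t).
Proof.
move=> gt l; rewrite eulerV gt mulNr mulrC -mulNr mulr_sumr; apply: eq_bigr => a _.
by rewrite !mxE mulrA.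
Qed.

(** Characters have a logarithmic gradient, and the sum, product and quotient rules extend it to
    their rational functions without leaving the function field. *)
Lemma ff_log_grad g : FF g -> exists2 t, log_grad g t & forall a, FF (t 0 a).
Proof.
have tr_grad h : TR h -> exists2 t, log_grad h t & forall a, FF (t 0 a).
  case=> s ->; pose Q g := exists2 t, log_grad g t & forall a, FF (t 0 a).
  apply: (big_ind Q) => [|x y [t xt tF] [t' yt tF']|[c m] _].
  - exists 0; last by move=> a; rewrite mxE; apply: ff0.
    by rewrite -cstK0; apply: log_grad_cst.
  - by exists (t + t'); [apply: log_gradD|move=> a; rewrite mxE; apply: ffD].
  exists (chi m *: 0 + cstK n c *: (chi m *: map_mx intr m)).
    exact: log_gradM (log_grad_cst _) (log_grad_chi _).
  move=> a; rewrite !mxE mulr0 add0r; apply: ffM; first exact: ff_cst.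
  by apply: ffM; [exact: ff_chi|exact: ff_int].
case=> a [b [ta tb b0 ->]].
have [t at_ tF] := tr_grad _ ta; have [s bs sF] := tr_grad _ tb.
have aF := ff_tr ta; have bF := ff_tr tb.
exists (b^-1 *: t + a *: (- b ^- 2 *: s)); first exact: log_gradM (log_gradV _).
move=> k; rewrite !mxE; apply: ffD; first by apply: ffM; [exact: ffV|exact: tF].
apply: ffM; first exact: aF.
apply: ffM; last exact: sF.
by apply/ffN/ffV; rewrite expr2; apply: ffM.
Qed.

End FunctionField.

(** * Contractions of the volume form *)

Section CrossProduct.

Variables (L : comNzRingType) (D : nat).
Implicit Types (v : 'rV[L]_D.+1) (T B : 'M[L]_(D, D.+1)).

Definition stack v T : 'M[L]_D.+1 :=
  \matrix_(i, a) if unlift ord0 i is Some k then T k a else v 0 a.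

(** The generalised cross product of the rows of [T]: the coordinates of their exterior product as
    signed maximal minors. *)
Definition cross T : 'rV[L]_D.+1 := \row_a ((-1) ^+ a * \det (col' a T)).

Lemma stack0 v T a : stack v T ord0 a = v 0 a.
Proof. by rewrite mxE unlift_none. Qed.

Lemma stackS v T k a : stack v T (lift ord0 k) a = T k a.
Proof. by rewrite mxE liftK. Qed.

Lemma det_stack v T : \det (stack v T) = \sum_a v 0 a * cross T 0 a.
Proof.
rewrite (expand_det_row _ ord0); apply: eq_bigr => a _.
rewrite stack0 mxE /cofactor add0n; congr (_ * (_ * \det _)).
by apply/matrixP => i j; rewrite !mxE liftK.
Qed.

Lemma cross_row' k (M : 'M[L]_D.+1) :
  cross (row' k M) = (-1) ^+ k *: row k (\adj M)^T.
Proof.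
apply/rowP => a; rewrite !mxE /cofactor exprD -mulrA mulrA -expr2 sqrr_sign mul1r.
by congr (_ * \det _); apply/matrixP => i j; rewrite !mxE.
Qed.

Lemma cross_row_perm s T : cross (row_perm s T) = (-1) ^+ perm.odd_perm s *: cross T.
Proof.
apply/rowP => a; rewrite !mxE mulrCA; congr (_ * _).
have -> : col' a (row_perm s T) = row_perm s (col' a T) by apply/matrixP => i j; rewrite !mxE.
by rewrite row_permE det_mulmx det_perm.
Qed.

Lemma cross_dot k T : \sum_a T k a * cross T 0 a = 0.
Proof.
transitivity (\det (stack (row k T) T)).
  by rewrite det_stack; apply: eq_bigr => a _; rewrite !mxE.
apply: (determinant_alternate (neq_lift ord0 k)) => a.
by rewrite stack0 stackS mxE.
Qed.

(** The product of [stack v T] with the transpose of [stack (cross T) B] is block triangular,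
    because [cross T] is orthogonal to the rows of [T]. *)
Lemma det_stack_mul v T B :
  \det (stack v T) * \det (stack (cross T) B) = \det (stack v T) * \det (T *m B^T).
Proof.
rewrite -[\det (stack (cross T) B)]det_tr -det_mulmx (expand_det_col _ ord0) big_ord_recl.
rewrite big1 ?addr0 => [|k _].
  rewrite det_stack /cofactor addn0 expr0 mul1r; congr (_ * _).
    by rewrite !mxE; apply: eq_bigr => a _; rewrite !mxE unlift_none.
  apply: (congr1 (fun M : 'M_D => \det M)); apply/matrixP => i j.
  by rewrite !mxE; apply: eq_bigr => a _; rewrite !mxE !liftK.
suff -> : (stack v T *m (stack (cross T) B)^T) (lift ord0 k) ord0 = 0 by rewrite mul0r.
rewrite mxE -[RHS](cross_dot k T); apply: eq_bigr => a _.
by rewrite !mxE liftK unlift_none.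
Qed.

End CrossProduct.

(** A form of the Cauchy-Binet formula. If [cross T] is nonzero, some [v] makes [stack v T]
    nonsingular and [det_stack_mul] can be cancelled. If it is zero, the rows of [T] are dependent
    and both sides vanish. *)
Lemma cross_det (L : fieldType) D (T B : 'M[L]_(D, D.+1)) :
  \det (T *m B^T) = \det (stack (cross T) B).
Proof.
have [T0|] := eqVneq (cross T) 0; last first.
  case/rV0Pn => a; set v : 'rV[L]_D.+1 := delta_mx 0 a => ca.
  have : \det (stack v T) != 0.
    rewrite det_stack (bigD1 a) //= big1 => [|b /negbTE ba]; last by rewrite mxE ba mul0r.
    by rewrite mxE !eqxx mul1r addr0.
  by move/mulfI; apply; rewrite det_stack_mul.
have -> : \det (stack (cross T) B) = 0.
  by rewrite det_stack big1 // => a _; rewrite T0 mxE mul0r.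
have [fT|] := boolP (row_free T); last first.
  rewrite -kermx_eq0 => /rowV0Pn [v] /sub_kermxP vT v0.
  by apply/eqP/det0P; exists v => //; rewrite mulmxA vT mul0mx.
have [v vT] : exists v : 'rV[L]_D.+1, ~~ (v <= T)%MS.
  suff : ~~ ((1%:M : 'M[L]_D.+1) <= T)%MS by case/row_subPn => k; exists (row k 1%:M).
  by rewrite sub1mx /row_full neq_ltn (leq_ltn_trans (rank_leq_row T)).
exfalso; move/negP: vT; apply.
have : \det (stack v T) = 0 by rewrite det_stack big1 // => a _; rewrite T0 mxE mulr0.
move/eqP/det0P => [w w0 wS].
have wE : w 0 ord0 *: v + \row_k w 0 (lift ord0 k) *m T = 0.
  rewrite -[RHS]wS; apply/rowP => a; rewrite !mxE big_ord_recl stack0; congr (_ + _).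
  by apply: eq_bigr => k _; rewrite stackS mxE.
have [w00|w00] := eqVneq (w 0 ord0) 0; last first.
  have -> : v = - (w 0 ord0)^-1 *: (\row_k w 0 (lift ord0 k) *m T).
    move/eqP: wE; rewrite addrC addr_eq0 => /eqP ->.
    by rewrite scalerN scaleNr opprK scalerA mulVf // scale1r.
  by rewrite scalemx_sub // submxMl.
case/negP: w0; move: wE; rewrite w00 scale0r add0r => /eqP; rewrite mulmx_free_eq0 // => /eqP wE.
apply/eqP/rowP => a; rewrite mxE; case: (unliftP ord0 a) => [k|] -> //.
by have /rowP /(_ k) := wE; rewrite !mxE.
Qed.

Section Contraction.

Variables (F : fieldType) (D n : nat) (e : 'I_n -> 'rV[int]_D.+1).
Local Notation K := {fraction {mpoly F[n]}}.
Implicit Types (G : 'rV[K]_D.+1) (js : D.-tuple 'I_n).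

Definition ray_rows js : 'M[K]_(D, D.+1) := \matrix_(l, a) (e (tnth js l) 0 a)%:~R.

(* The contraction of the invariant volume form of the torus with [G]. *)
Definition contract G : dform F n D :=
  [ffun js : D.-tuple 'I_n => \det (stack G (ray_rows js)) / \prod_l zK F (tnth js l)].

Lemma contractE G js :
  contract G js = (\sum_a G 0 a * cross (ray_rows js) 0 a) / \prod_l zK F (tnth js l).
Proof. by rewrite ffunE det_stack. Qed.

Lemma contractD G H js : contract (G + H) js = contract G js + contract H js.
Proof.
rewrite !contractE -mulrDl -big_split; congr (_ / _); apply: eq_bigr => a _.
by rewrite mxE mulrDl.
Qed.

Lemma contractZ g G : contract (g *: G) = scale_form g (contract G).
Proof.
apply/ffunP => js; rewrite [RHS]ffunE !contractE mulrA mulr_sumr; congr (_ / _).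
by apply: eq_bigr => a _; rewrite mxE mulrA.
Qed.

Lemma contract0 : contract 0 = 0.
Proof.
apply/ffunP => js; rewrite contractE ffunE big1 ?mul0r // => a _.
by rewrite mxE mul0r.
Qed.

Lemma contract_sum I (r : seq I) (P : pred I) (G : I -> 'rV[K]_D.+1) :
  contract (\sum_(i <- r | P i) G i) = \sum_(i <- r | P i) contract (G i).
Proof.
elim/big_rec2: _ => [|i H w _ IH]; first exact: contract0.
by apply/ffunP => js; rewrite contractD IH [RHS]ffunE.
Qed.

(** The Jacobian matrix is [T] times the transposed rays times the diagonal matrix of the [1 / z_l],
    so [cross_det] applies. From here on a form is handled through its vector. *)
Lemma wedge_d_log_grad (h : D.-tuple K) (T : 'M[K]_(D, D.+1)) :
  (forall k, log_grad e (tnth h k) (row k T)) -> wedge_d h = contract (cross T).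
Proof.
move=> hT; apply/ffunP => js; rewrite !ffunE -cross_det.
have -> : \matrix_(k, l) pderiv (tnth js l) (tnth h k) =
    (T *m (ray_rows js)^T) *m diag_mx (\row_l (zK F (tnth js l))^-1) :> 'M[K]_D.
  apply/matrixP => k l; rewrite mul_mx_diag !mxE.
  have z0 := zK_neq0 F (tnth js l); apply: (mulfI z0); rewrite -[LHS]/(euler _ _) hT.
  rewrite mulrCA mulfV // mulr1; apply: eq_bigr => a _; by rewrite !mxE.
rewrite det_mulmx det_diag; congr (_ * _).
rewrite -prodfV; apply: eq_bigr => l _; by rewrite mxE.
Qed.

Lemma dz_tupleE (J js : D.-tuple 'I_n) :
  dz F J js = \det (\matrix_(k, l) (tnth js l == tnth J k)%:R).
Proof.
rewrite ffunE; congr (\det _); apply/matrixP => k l.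
by rewrite !mxE tnth_map pderiv_zK.
Qed.

Lemma dz_perm (J js : D.-tuple 'I_n) (p : 'S_D) : uniq js ->
  (forall k, tnth J k = tnth js (p k)) -> dz F J js = (-1) ^+ odd_perm p.
Proof.
move=> ujs hp; rewrite dz_tupleE -det_perm; congr (\det _); apply/matrixP => k l.
by rewrite !mxE hp (inj_eq (tuple_uniqP _ ujs)) eq_sym.
Qed.

Lemma dz_neq0_perm (J js : D.-tuple 'I_n) : uniq J -> dz F J js != 0 -> perm_eq J js.
Proof.
move=> uJ J0; have sub : {subset J <= js}.
  move=> x /tnthP [k ->]; apply: contraNT J0 => Jk; rewrite dz_tupleE (expand_det_row _ k).
  rewrite big1 // => l _; rewrite mxE; case: eqP => [jl|_]; last by rewrite mul0r.
  by case/negP: Jk; rewrite -jl mem_tnth.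
have sJ : (size js <= size J)%N by rewrite !size_tuple.
have [_ eqJ] := uniq_min_size uJ sub sJ.
exact: uniq_perm uJ (leq_size_uniq uJ sub sJ) eqJ.
Qed.

Lemma ray_rows_perm (J js : D.-tuple 'I_n) (p : 'S_D) :
  (forall k, tnth J k = tnth js (p k)) -> ray_rows J = row_perm p (ray_rows js).
Proof. by move=> hp; apply/matrixP => k a; rewrite !mxE hp. Qed.

Lemma det_eE i (J : D.-tuple 'I_n) :
  (det_e e i (i :: J))%:~R = \sum_a (e i 0 a)%:~R * cross (ray_rows J) 0 a :> K.
Proof.
transitivity (\det (stack (map_mx intr (e i)) (ray_rows J))); last first.
  by rewrite det_stack; apply: eq_bigr => a _; rewrite mxE.
rewrite -[RHS]det_tr /det_e -det_map_mx; congr (\det _); apply/matrixP => j k.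
rewrite !mxE; case: (unliftP ord0 k) => [l|] -> /=; rewrite ?mxE //.
by rewrite (tnth_nth i).
Qed.

Lemma prod_not_cons i (J js : D.-tuple 'I_n) : perm_eq J js -> uniq js -> i \notin js ->
  \prod_(l | l \notin i :: J) zK F l = \prod_l zK F l / zK F i / \prod_l zK F (tnth js l) :> K.
Proof.
move=> pJ ujs ijs; have uiJ : uniq (i :: J) by rewrite /= (perm_mem pJ) ijs (perm_uniq pJ).
rewrite [in RHS](bigID (fun l => l \in i :: J)) /= -(big_uniq _ uiJ) big_cons.
have -> : \prod_(l <- J) zK F l = \prod_l zK F (tnth js l) :> K.
  by rewrite (perm_big _ pJ) big_tuple.
have z0 := zK_neq0 F i; have p0 : \prod_l zK F (tnth js l) != 0 :> K.
  by apply/prodf_neq0 => l _; apply: zK_neq0.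
have cancel_xy (L : fieldType) (x y r : L) : x != 0 -> y != 0 -> r = x * y * r / x / y.
  by move=> x0 y0; field; rewrite x0 y0.
exact (cancel_xy _ _ _ _ z0 p0).
Qed.

Lemma Omega_contract i :
  Omega F e i = contract ((\prod_l zK F l / zK F i) *: map_mx intr (e i)).
Proof.
apply/ffunP => js; rewrite sum_ffunE contractZ [RHS]ffunE.
(* On a tuple with a repetition or containing [i] both sides vanish. On any other tuple only its
   increasing rearrangement [J0] contributes to the sum. *)
have [/andP [ujs ijs]|bad] := boolP (uniq js && (i \notin js)); last first.
  rewrite big1 => [|J /andP [sJ iJ]].
    rewrite ffunE; suff -> : \det (stack (map_mx intr (e i)) (ray_rows js)) = 0.
      by rewrite mul0r mulr0.
    move: bad; rewrite negb_and negbK => /orP [].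
      move/tuple_uniqP/injectiveP/injectivePn => [k [l kl jkl]].
      have lkl : lift ord0 k != lift ord0 l by rewrite (inj_eq lift_inj).
      apply: (determinant_alternate lkl) => a; by rewrite !stackS !mxE jkl.
    move/tnthP => [k ijk]; apply: (determinant_alternate (neq_lift ord0 k)) => a.
    by rewrite stack0 stackS !mxE -ijk.
  rewrite ffunE; have [->|J0] := eqVneq (dz F J js) 0; first by rewrite mulr0.
  have uJ : uniq J by have := sorted_uniq ltn_trans ltnn sJ; rewrite map_inj_uniq //; exact: val_inj.
  have pJ := dz_neq0_perm uJ J0.
  by case/negP: bad; rewrite -(perm_uniq pJ) uJ -(perm_mem pJ).
pose J0 : D.-tuple 'I_n := sort_tuple (fun x y : 'I_n => (x <= y)%N) js.
have pJ0 : perm_eq J0 js by rewrite /J0 /= perm_sort.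
have sJ0 : sorted ltn (map val J0).
  rewrite ltn_sorted_uniq_leq map_inj_uniq ?(perm_uniq pJ0) ?ujs; last exact: val_inj.
  by rewrite sorted_map; apply: sort_sorted => x y; apply: leq_total.
have iJ0 : i \notin J0 by rewrite (perm_mem pJ0).
rewrite (bigD1 J0) ?sJ0 //= [X in _ + X]big1 ?addr0 => [|J /andP [/andP [sJ iJ] JJ0]]; last first.
  rewrite ffunE; have [->|dJ0] := eqVneq (dz F J js) 0; first by rewrite mulr0.
  have uJ : uniq J by have := sorted_uniq ltn_trans ltnn sJ; rewrite map_inj_uniq //; exact: val_inj.
  have pJ := dz_neq0_perm uJ dJ0.
  case/negP: JJ0; apply/eqP/val_inj; apply: (inj_map val_inj).
  apply: (irr_sorted_eq ltn_trans ltnn sJ sJ0) => x.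
  by apply/perm_mem/perm_map; rewrite (perm_trans pJ) // perm_sym.
have /tuple_permP [p pE] := pJ0.
have hp k : tnth J0 k = tnth js (p k).
  have -> : J0 = [tuple tnth js (p k) | k < D] by apply: val_inj.
  by rewrite tnth_mktuple.
rewrite ffunE (dz_perm ujs hp) det_eE (prod_not_cons pJ0 ujs ijs) (ray_rows_perm hp) cross_row_perm.
rewrite ffunE det_stack.
have -> : \sum_a (e i 0 a)%:~R * ((-1) ^+ odd_perm p *: cross (ray_rows js)) 0 a =
    (-1) ^+ odd_perm p * \sum_a map_mx intr (e i) 0 a * cross (ray_rows js) 0 a :> K.
  by rewrite mulr_sumr; apply: eq_bigr => a _; rewrite !mxE mulrCA.
(* The sign of the sorting permutation occurs once in [dz] and once in the determinant of the
   rays. *)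
have sign_cancel (L : fieldType) (b : bool) (S P x y : L) :
    (-1) ^+ b * S * (P / x / y) * (-1) ^+ b = P / x * (S / y).
  by case: b; rewrite /= ?expr0 ?expr1; ring.
exact (sign_cancel _ _ _ _ _ _).
Qed.

End Contraction.

(** * Forms as vectors of rational functions, and their values at a point *)

Section Basis.

Variables (F : numClosedFieldType) (D n : nat) (e : 'I_n -> 'rV[int]_D.+1).
Local Notation K := {fraction {mpoly F[n]}}.
Variable sigma : 'I_D.+1 -> 'I_n.
Hypothesis sigma_basis : \det (\matrix_(k, a) e (sigma k) 0 a) != 0.
Implicit Types (g h : K) (G : 'rV[K]_D.+1) (u : 'I_n -> F).

Local Notation FF := (@function_field F D.+1 n e).

Lemma cstK_eq0 (c : F) : (cstK n c == 0) = (c == 0).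
Proof. by rewrite /cstK tofrac_eq0 mpolyC_eq0. Qed.

Lemma intK_eq0 (z : int) : (z%:~R == 0 :> K) = (z == 0).
Proof. by rewrite -cstK_int cstK_eq0 intr_eq0. Qed.

Lemma dual_basis : exists N : 'M[F]_D.+1, forall a b,
  \sum_k (e (sigma k) 0 b)%:~R * N k a = (b == a)%:R.
Proof.
pose M : 'M[F]_D.+1 := map_mx intr (\matrix_(k, a) e (sigma k) 0 a).
have Mu : M \in unitmx by rewrite unitmxE unitfE det_map_mx intr_eq0.
exists (invmx M)^T => a b; have /matrixP /(_ a b) := mulVmx Mu.
rewrite !mxE eq_sym => <-; apply: eq_bigr => k _; by rewrite !mxE mulrC.
Qed.

(** Solving the defining equations along the basis rays expresses the gradient by Euler derivatives
    with constant coefficients, so it is regular wherever [g] is. *)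
Lemma log_grad_euler : exists N : 'M[F]_D.+1, forall g t, log_grad e g t ->
  forall a, t 0 a = \sum_k cstK n (N k a) * euler (sigma k) g.
Proof.
have [N hN] := dual_basis; exists N => g t gt a.
transitivity (\sum_b t 0 b * cstK n (b == a)%:R).
  rewrite (bigD1 a) //= eqxx cstK1 mulr1 big1 ?addr0 // => b /negbTE ->.
  by rewrite cstK0 mulr0.
under eq_bigr => b _ do rewrite -hN /cstK !rmorph_sum mulr_sumr.
rewrite exchange_big /=; apply: eq_bigr => k _; rewrite gt mulr_sumr.
apply: eq_bigr => b _; rewrite -/(cstK n _) cstKM cstK_int.
by rewrite mulrA [LHS]mulrC.
Qed.

Lemma regular_euler u l g : regular u g ->
  exists2 c, has_value u (euler l g) c & u l = 0 -> c = 0.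
Proof.
move=> /(regular_pderiv l) [c hc]; exists (u l * c); first exact: hvM (hv_zK u l) hc.
by move->; rewrite mul0r.
Qed.

(** Orthogonality to [e i] holds because the pairing with [e i] is [z_i] times a regular
    derivative. *)
Lemma regular_log_grad u g t : log_grad e g t -> regular u g ->
  exists c : 'I_D.+1 -> F, (forall a, has_value u (t 0 a) (c a)) /\
    forall i, u i = 0 -> \sum_a c a * (e i 0 a)%:~R = 0.
Proof.
move=> gt ug; have [N hN] := log_grad_euler.
have /fin_all_exists [y hy] : forall k, exists c, has_value u (euler (sigma k) g) c.
  by move=> k; have [c hc _] := regular_euler (sigma k) ug; exists c.
exists (fun a => \sum_k N k a * y k).
have hc a : has_value u (t 0 a) (\sum_k N k a * y k).
  by rewrite (hN _ _ gt); apply: hv_sum => k _; apply: hvM; [exact: hv_cst|exact: hy].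
split=> // i ui; have [c hec c0] := regular_euler i ug.
rewrite -[RHS](c0 ui); apply: hv_inj hec; rewrite gt; apply: hv_sum => a _.
by apply: hvM; [exact: hc|exact: hv_int].
Qed.

(** Evaluating on all basis rays but [sigma k] gives, up to sign and a nonzero factor, the entry [k]
    of [G *m \adj M], and [\adj M] is invertible. *)
Lemma contract_inj : injective (@contract F D n e).
Proof.
suff h G : contract e G = 0 -> G = 0.
  move=> G H GH; apply/eqP; rewrite -subr_eq0; apply/eqP/h.
  rewrite -scaleN1r; apply/ffunP => js; rewrite contractD contractZ GH !ffunE mulN1r.
  exact (addrN _).
move=> /ffunP G0; pose M : 'M[K]_D.+1 := map_mx intr (\matrix_(k, a) e (sigma k) 0 a).
have dM : \det M != 0 by rewrite det_map_mx intK_eq0.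
suff /eqP : G *m \adj M = 0.
  have Mu : \adj M \in unitmx.
    have := mul_mx_adj M; move=> /(congr1 (fun X => \det X)).
    rewrite det_mulmx det_scalar unitmxE unitfE; apply: contra_eq_neq => ->.
    by rewrite mulr0 eq_sym expf_neq0.
  by move=> /eqP /(congr1 (fun X => X *m invmx (\adj M))); rewrite mulmxK // mul0mx.
apply/rowP => k; pose js := [tuple sigma (lift k j) | j < D].
have := G0 js; rewrite contractE ffunE => /eqP; rewrite mulf_eq0 invr_eq0.
have /negbTE -> : \prod_l zK F (tnth js l) != 0 :> K.
  by apply/prodf_neq0 => l _; exact: zK_neq0.
have -> : ray_rows F e js = row' k M.
  by apply/matrixP => l a; rewrite !mxE tnth_mktuple.
rewrite orbF cross_row' => /eqP h; rewrite !mxE.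
transitivity ((-1) ^+ k * \sum_a G 0 a * ((-1) ^+ k *: row k (\adj M)^T) 0 a).
  rewrite mulr_sumr; apply: eq_bigr => a _.
  by rewrite !mxE [_ ^+ k * (_ * _)]mulrCA signrMK.
by rewrite h mulr0.
Qed.

Lemma forms_function_field (w : dform F n D) : forms_over FF w ->
  exists2 G, w = contract e G & forall a, FF (G 0 a).
Proof.
case=> s [hs ->]; elim: s hs => [|[g h] s IH] hs.
  by exists 0; [rewrite big_nil contract0|move=> a; rewrite mxE; apply: ff0].
have [|G GE GF] := IH; first by move=> x xs; apply: hs; rewrite inE xs orbT.
have [/= gF hF] := hs _ (mem_head _ _).
have /fin_all_exists2 [t ht tF] : forall k, exists2 t, log_grad e (tnth h k) t & forall a, FF (t 0 a).
  by move=> k; apply: ff_log_grad.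
exists (g *: cross (\matrix_k t k) + G).
  rewrite big_cons GE; apply/ffunP => js; rewrite contractD contractZ ffunE; congr (_ + _).
  rewrite -(wedge_d_log_grad (h := h)) // => k; rewrite rowK; exact: ht.
move=> a; rewrite mxE; apply: ffD; last exact: GF.
rewrite !mxE; apply: ffM; first exact: gF.
apply: ffM; last by apply: ff_det => i j; rewrite !mxE; apply: tF.
by case: (odd a) (signr_odd K a) => <-; rewrite ?expr0 ?expr1; [apply: ffN|]; apply: ff1.
Qed.

Lemma cross_parallel (T : 'M[F]_(D, D.+1)) (v : 'I_D.+1 -> F) :
  (forall k, \sum_a T k a * v a = 0) -> forall a b, cross T 0 a * v b = cross T 0 b * v a.
Proof.
move=> Tv a b; have [[c vc]|v0] : (exists c, v c != 0) \/ (forall c, v c = 0).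
- have [/existsP|/existsPn h] := boolP [exists c, v c != 0]; first by left.
  by right=> c; apply/eqP; rewrite -[_ == _]negbK.
(* [x] is orthogonal to [v], so [v] lies in the kernel of [stack x T]; the vanishing determinant is
   the required 2 by 2 minor. *)
- pose x : 'rV[F]_D.+1 := v b *: delta_mx 0 a - v a *: delta_mx 0 b.
  have xE : \sum_c x 0 c * cross T 0 c = v b * cross T 0 a - v a * cross T 0 b.
    have dE k : \sum_c (delta_mx 0 k : 'rV[F]_D.+1) 0 c * cross T 0 c = cross T 0 k.
      rewrite (bigD1 k) //= big1 ?addr0 => [|k' /negbTE ck]; rewrite !mxE ?ck ?mul0r //.
      by rewrite !eqxx mul1r.
    rewrite -[in RHS](dE a) -[in RHS](dE b) !mulr_sumr -sumrB; apply: eq_bigr => k _.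
    by rewrite !mxE mulrBl !mulrA.
  suff : \det (stack x T) = 0.
    by rewrite det_stack xE => /eqP; rewrite subr_eq0 => /eqP h; rewrite mulrC h mulrC.
  rewrite -det_tr; apply/eqP/det0P; exists (\row_c v c).
    by apply/rV0Pn; exists c; rewrite mxE.
  apply/rowP => k; rewrite [RHS]mxE mxE; case: (unliftP ord0 k) => [l|] ->.
    by rewrite -[RHS](Tv l); apply: eq_bigr => i _; rewrite !mxE liftK mulrC.
  have dE i : \sum_c (delta_mx 0 i : 'rV[F]_D.+1) 0 c * v c = v i.
    rewrite (bigD1 i) //= big1 ?addr0 => [|k' /negbTE ck]; rewrite !mxE ?ck ?mul0r //.
    by rewrite !eqxx mul1r.
  transitivity (v b * v a - v a * v b); last by rewrite mulrC subrr.
  rewrite -[in v b * v a](dE a) -[in X in _ - _ * X](dE b) !mulr_sumr -sumrB; apply: eq_bigr => k' _.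
  by rewrite [in LHS]mxE [X in _ * X]mxE stack0 !mxE mulrC mulrBl !mulrA.
by rewrite !v0 !mulr0.
Qed.

(** At a point of [z_i = 0] each differential contributes a vector orthogonal to [e i], so the cross
    product is parallel to [e i], a condition stable under sums. *)
Lemma forms_local u (w : dform F n D) : forms_over (local_ring e u) w ->
  exists2 G, w = contract e G & exists c : 'I_D.+1 -> F,
    (forall a, has_value u (G 0 a) (c a)) /\
    forall i, u i = 0 -> forall a b, c a * (e i 0 b)%:~R = c b * (e i 0 a)%:~R.
Proof.
case=> s [hs ->]; elim: s hs => [|[g h] s IH] hs.
  exists 0; first by rewrite big_nil contract0.
  exists (fun=> 0); split=> [a|i _ a b]; last by rewrite !mul0r.
  by rewrite mxE; apply: hv0.
have [|G GE [c [hc pc]]] := IH; first by move=> x xs; apply: hs; rewrite inE xs orbT.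
have [/= [gF [y gy]] hF] := hs _ (mem_head _ _).
have /fin_all_exists [t ht] : forall k, exists t, log_grad e (tnth h k) t.
  by move=> k; have [t kt _] := ff_log_grad (hF k).1; exists t.
have /fin_all_exists2 [z hz tz] : forall k, exists2 z : 'I_D.+1 -> F,
    (forall a, has_value u (t k 0 a) (z a)) &
    forall i, u i = 0 -> \sum_a z a * (e i 0 a)%:~R = 0.
  move=> k; have [z [h1 h2]] := regular_log_grad (ht k) (hF k).2; by exists z.
pose T : 'M[F]_(D, D.+1) := \matrix_(k, a) z k a.
exists (g *: cross (\matrix_k t k) + G).
  rewrite big_cons GE; apply/ffunP => js; rewrite contractD contractZ ffunE; congr (_ + _).
  rewrite -(wedge_d_log_grad (h := h)) // => k; rewrite rowK; exact: ht.
exists (fun a => y * cross T 0 a + c a); split=> [a|i ui a b].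
  rewrite mxE; apply: hvD; last exact: hc.
  rewrite mxE; apply: hvM; first exact: gy.
  rewrite !mxE; apply: hvM; last by apply: hv_det => i j; rewrite !mxE; apply: hz.
  by apply: hvX; apply/hvN/hv1.
rewrite !mulrDl (pc _ ui a b) -!mulrA; congr (_ * _ + _).
apply: (cross_parallel (v := fun a => (e i 0 a)%:~R)) => k.
by rewrite -[RHS](tz k i ui); apply: eq_bigr => a' _; rewrite mxE.
Qed.

End Basis.

(** * Homogeneous components and local rings *)

Section Graded.

Variables (F : fieldType) (n : nat) (Gam : 'rV[int]_n -> Prop).
Hypotheses (Gam0 : Gam 0) (GamB : forall a b, Gam a -> Gam b -> Gam (a - b)).
Implicit Types (p q : {mpoly F[n]}) (g : 'rV[int]_n) (m : 'X_{1..n}).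

Lemma GamN a : Gam a -> Gam (- a).
Proof. by move=> ha; rewrite -sub0r; apply: GamB. Qed.

Lemma GamD a b : Gam a -> Gam b -> Gam (a + b).
Proof. by move=> ha /GamN hb; rewrite -[b]opprK; apply: GamB. Qed.

Definition mvec m : 'rV[int]_n := \row_i (m i)%:Z.

Lemma mvecD m1 m2 : mvec (m1 + m2)%MM = mvec m1 + mvec m2.
Proof. by apply/rowP => i; rewrite !mxE mnmDE PoszD. Qed.

(** Homogeneity for the grading by Z^n modulo the subgroup [Gam]. It is used with three subgroups:
    the image of alpha, the vectors whose coordinate [i] is zero, and [orbit_lattice]. *)
Definition in_class g p := forall m, m \in msupp p -> Gam (mvec m - g).

Definition comp_pred g m : bool := boolp.asbool (Gam (mvec m - g)).

Definition component g p : {mpoly F[n]} :=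
  \sum_(m <- msupp p | comp_pred g m) p@_m *: 'X_[m].

Lemma mcoeff_component g p m :
  (component g p)@_m = if comp_pred g m then p@_m else 0.
Proof.
rewrite raddf_sum /=; have [mp|mp] := boolP (m \in msupp p); last first.
  rewrite big1_seq => [|m' /andP [_ m'p]].
    by rewrite (memN_msupp_eq0 mp); case: ifP.
  rewrite mcoeffZ mcoeffX; case: eqP => [mm|]; last by rewrite mulr0.
  by rewrite -mm m'p in mp.
rewrite -big_filter; case: ifP => gm.
  rewrite (bigD1_seq m) ?filter_uniq ?msupp_uniq ?mem_filter ?gm //=.
  rewrite mcoeffZ mcoeffX eqxx mulr1 big1 ?addr0 // => m' /negbTE mm'.
  by rewrite mcoeffZ mcoeffX mm' mulr0.
rewrite big1_seq // => m' /andP [_]; rewrite mem_filter => /andP [gm' _].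
rewrite mcoeffZ mcoeffX; case: eqP => [mm|]; last by rewrite mulr0.
by rewrite -mm gm' in gm.
Qed.

Lemma component_id g p : in_class g p -> component g p = p.
Proof.
move=> hp; apply/mpolyP => m; rewrite mcoeff_component; case: ifP => // /negbT gm.
apply/esym/memN_msupp_eq0; apply: contra gm => /hp; exact: boolp.asboolT.
Qed.

Lemma component_in_class g p : in_class g (component g p).
Proof.
by move=> m; rewrite mcoeff_msupp mcoeff_component; case: ifP; rewrite ?eqxx // => /boolp.asboolP.
Qed.

Lemma component_mull g dl a p : in_class dl a ->
  component (g + dl) (a * p) = a * component g p.
Proof.
move=> ha; apply/mpolyP => m; rewrite mcoeff_component !mcoeffM.
rewrite -[if _ then _ else _]/(if comp_pred (g + dl) m then _ else _).
case: ifP => gm; [apply: eq_bigr|apply/esym/big1] => -[k1 k2] /= /eqP mE; rewrite mcoeff_component;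
  have [->|] := eqVneq a@_k1 0; rewrite ?mul0r // -mcoeff_msupp => /ha hk1;
  have mv : mvec m = mvec k1 + mvec k2 by rewrite -mvecD; congr mvec.
- case: ifP => // /negP []; apply: boolp.asboolT.
  have -> : mvec k2 - g = (mvec m - (g + dl)) - (mvec k1 - dl).
    by rewrite mv; apply/rowP => i; rewrite !mxE; ring.
  by apply: GamB => //; move/boolp.asboolP: gm.
case: ifP => [/boolp.asboolP gk2|_]; last by rewrite mulr0.
case/negP: (negbT gm); apply: boolp.asboolT.
have -> : mvec m - (g + dl) = (mvec k1 - dl) + (mvec k2 - g).
  by rewrite mv; apply/rowP => i; rewrite !mxE; ring.
exact: GamD.
Qed.

Lemma meval_component u g p :
  (forall m, \prod_i u i ^+ m i != 0 -> Gam (mvec m - g)) -> (component g p).@[u] = p.@[u].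
Proof.
move=> hu; rewrite [RHS]mevalE [LHS]rmorph_sum big_mkcond; apply: eq_bigr => m _.
case: ifP => [_|gm]; first by rewrite /= mevalZ mevalX.
have [->|/hu h] := eqVneq (\prod_i u i ^+ m i) 0; first by rewrite mulr0.
by rewrite /comp_pred (boolp.asboolT h) in gm.
Qed.

(** A polynomial is the sum of its components, so they cannot all vanish at [u]. The induction
    removes one class of monomials at a time. *)
Lemma component_nonvanishing u p : p.@[u] != 0 -> exists g, (component g p).@[u] != 0.
Proof.
have h (t : 'X_{1..n} -> F) k (s : seq 'X_{1..n}) : (size s <= k)%N ->
    \sum_(m <- s) t m != 0 -> exists g, \sum_(m <- s | comp_pred g m) t m != 0.
  elim: k s => [|k IH] [|m0 s] //=; rewrite ?big_nil ?eqxx // => sk hs.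
  have m00 : comp_pred (mvec m0) m0 by apply: boolp.asboolT; rewrite subrr.
  have [z0|] := eqVneq (\sum_(m <- m0 :: s | comp_pred (mvec m0) m) t m) 0; last first.
    by exists (mvec m0).
  (* If the class of [m0] contributes 0, the other monomials still have a nonzero sum; any class [g]
     found among them differs from that of [m0], so it loses no monomial in passing to [s']. *)
  pose s' := [seq m <- m0 :: s | ~~ comp_pred (mvec m0) m].
  have [||g hg] := IH s'.
  - rewrite /s' /= m00 /=; rewrite size_filter; exact: leq_trans (count_size _ _) sk.
  - by move: hs; rewrite (bigID (comp_pred (mvec m0))) /= z0 add0r big_filter.
  exists g; apply: contraNneq hg => hg0; rewrite /s' big_filter_cond /=.
  have [/boolp.asboolP m0g|m0g] := boolP (comp_pred g m0).
    rewrite big_pred0 // => m; apply/negbTE; rewrite negb_and negbK orbC.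
    case: (boolP (comp_pred g m)) => //= /boolp.asboolP mg; apply: boolp.asboolT.
    have -> : mvec m - mvec m0 = (mvec m - g) - (mvec m0 - g) by rewrite opprB addrA subrK.
    exact: GamB.
  apply/eqP; apply: etrans hg0; apply: eq_bigl => m; case: (boolP (comp_pred g m)) => [/boolp.asboolP mg|]; rewrite ?andbF //.
  rewrite andbT; apply: contra m0g => /boolp.asboolP mm0; apply: boolp.asboolT.
  have -> : mvec m0 - g = (mvec m - g) - (mvec m - mvec m0) by apply/rowP => i; rewrite !mxE; ring.
  exact: GamB.
rewrite mevalE => /(h _ _ _ (leqnn _)) [g hg]; exists g; move: hg; rewrite rmorph_sum /=.
by under [X in _ -> X != 0]eq_bigr => m _ do rewrite mevalZ mevalX.
Qed.

End Graded.

Section DegreeZero.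

Variables (F : fieldType) (d n : nat) (e : 'I_n -> 'rV[int]_d).
Variable Gam : 'rV[int]_n -> Prop.
Hypotheses (Gam0 : Gam 0) (GamB : forall a b, Gam a -> Gam b -> Gam (a - b)).
Hypothesis Gam_alpha : forall m, Gam (\row_i pairing m (e i)).
Local Notation K := {fraction {mpoly F[n]}}.
Local Notation tf := (@FracField.tofrac {mpoly F[n]}).
Implicit Types (g h : K).

Lemma tofracX (m : 'X_{1..n}) : tf 'X_[m] = \prod_i zK F i ^+ m i.
Proof. by rewrite mpolyXE_id rmorph_prod; apply: eq_bigr => i _; rewrite rmorphXn. Qed.

Lemma in_classD dl (p q : {mpoly F[n]}) :
  in_class Gam dl p -> in_class Gam dl q -> in_class Gam dl (p + q).
Proof.
by move=> hp hq m /msuppD_le; rewrite mem_cat => /orP [/hp|/hq].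
Qed.

Lemma clear_character (m : 'rV[int]_d) (N : 'X_{1..n}) :
  (forall i, (`|pairing m (e i)| <= N i)%N) ->
  exists2 k : 'X_{1..n}, tf 'X_[N] * chi F e m = tf 'X_[k] &
     mvec k = mvec N + \row_i pairing m (e i).
Proof.
move=> hN; have hk i : (absz ((N i)%:Z + pairing m (e i)))%:Z = (N i)%:Z + pairing m (e i).
  by have := hN i; lia.
exists [multinom absz ((N i)%:Z + pairing m (e i))%R | i < n]; last first.
  by apply/rowP => i; rewrite !mxE mnmE hk.
rewrite !tofracX -big_split; apply: eq_bigr => i _ /=; rewrite mnmE.
have z0 := zK_neq0 F i.
by rewrite [RHS]exprnP hk expfzDr.
Qed.

(** Stated for every larger [N], so that a numerator and a denominator can be cleared by the same
    monomial. *)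
Lemma clear_torus_regular g : torus_regular e g -> exists N0 : 'X_{1..n},
  forall N, (N0 <= N)%MM -> exists2 p, tf 'X_[N] * g = tf p & in_class Gam (mvec N) p.
Proof.
case=> s ->; elim: s => [|[c m] s [N0 IH]].
  by exists 0%MM => N _; exists 0; [rewrite big_nil mulr0 rmorph0|move=> m; rewrite msupp0].
exists (N0 + [multinom absz (pairing m (e i)) | i < n])%MM => N hN.
have [|p pE pN] := IH N.
  by apply: lepm_trans hN; apply: lem_addr.
have [|k kE kN] := @clear_character m N.
  by move=> i; have /mnm_lepP /(_ i) := hN; rewrite mnmDE mnmE; lia.
exists (c *: 'X_[k] + p).
  rewrite big_cons mulrDr pE mulrCA kE tofracD -mul_mpolyC tofracM; by [].
apply: in_classD pN => m' /msuppZ_le; rewrite msuppX inE => /eqP ->.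
by rewrite kN addrC addKr.
Qed.

Lemma function_field_frac g : function_field e g -> exists p q : {mpoly F[n]}, exists dl,
  [/\ q != 0, g = tf p / tf q, in_class Gam dl p & in_class Gam dl q].
Proof.
case=> a [b [/clear_torus_regular [N1 h1] /clear_torus_regular [N2 h2] b0 ->]].
have [p pE pN] := h1 _ (lem_addr N1 N2); have [q qE qN] := h2 _ (lem_addl N1 N2).
have X0 : tf 'X_[N1 + N2] != 0 by rewrite tofrac_eq0 -msupp_eq0 msuppX.
exists p, q, (mvec (N1 + N2)); split=> //; last by rewrite -pE -qE -mulf_div divff // mul1r.
rewrite -tofrac_eq0 -qE; exact (mulf_neq0 X0 b0).
Qed.

(** Write [g = a / b] with [a] and [b] homogeneous of the same class; then [a * q = p * b] can be
    compared component by component. *)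
Lemma component_frac g (p q : {mpoly F[n]}) dl : function_field e g -> q != 0 ->
  g = tf p / tf q -> component Gam dl q != 0 ->
  g = tf (component Gam dl p) / tf (component Gam dl q).
Proof.
move=> /function_field_frac [a [b [eps [b0 gE ha hb]]]] q0.
have [tb tq] : tf b != 0 /\ tf q != 0 by rewrite !tofrac_eq0.
rewrite gE => /eqP; rewrite (eqr_div _ _ tb tq) => /eqP; rewrite -!tofracM => /tofrac_inj E Q0.
have tQ : tf (component Gam dl q) != 0 by rewrite tofrac_eq0.
apply/eqP; rewrite (eqr_div _ _ tb tQ) -!tofracM; apply/eqP/(congr1 tf).
rewrite -(component_mull Gam0 GamB _ _ ha) E mulrC (component_mull Gam0 GamB _ _ hb).
exact (mulrC _ _).
Qed.

End DegreeZero.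

(** The Smith normal form of a row vector makes [v] a multiple [c] of the first row of a unimodular
    matrix [R], with [c] a sign by primitivity. The rows of [B] are [c] times the basis dual to the
    rows of [R]. *)
Lemma adapted_basis D (v : 'rV[int]_D.+1) : primitive_vec v ->
  exists2 B : 'M[int]_D.+1, B \in unitmx & forall k, pairing (row k B) v = (k == ord0)%:Z.
Proof.
move=> pv; have [L Lu [R Ru [s _ vE]]] := int_Smith_normal_form v.
pose c := L 0 0 * s`_0.
have vR : v = c *: row ord0 R.
  apply/rowP => j; rewrite vE !mxE (bigD1 ord0) //= big1 ?addr0 => [|k /negbTE k0].
    by rewrite !mxE big_ord1 !mxE /= mulr1n.
  rewrite !mxE big_ord1 !mxE /= -[(0 == k)%N]/(0%N == k :> nat).
  have -> : (0%N == k :> nat) = false by rewrite eq_sym -k0.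
  by rewrite mulr0n mulr0 mul0r.
have c2 : c * c = 1 by case: (pv _ _ vR) => ->.
exists (c *: (invmx R)^T).
  have cu : c \is a GRing.unit by apply/unitrP; exists c.
  by rewrite unitmxE detZ det_tr unitrM unitrX //= -unitmxE unitmx_inv.
move=> k; transitivity (c * (v *m invmx R) 0 k).
  rewrite !mxE mulr_sumr; apply: eq_bigr => j _; rewrite !mxE; ring.
rewrite vR -scalemxAl -row_mul mulmxV // !mxE mulrA c2 mul1r eq_sym; by case: eqP.
Qed.

Section LocalRing.

Variables (F : fieldType) (d n : nat) (e : 'I_n -> 'rV[int]_d) (u : 'I_n -> F).
Local Notation K := {fraction {mpoly F[n]}}.
Local Notation tf := (@FracField.tofrac {mpoly F[n]}).
Local Notation FF := (@function_field F d n e).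
Local Notation LR := (@local_ring F d n e u).
Implicit Types (g h : K) (m : 'rV[int]_d).

Lemma lrD g h : LR g -> LR h -> LR (g + h).
Proof. by move=> [gF [a ga]] [hF [b hb]]; split; [exact: ffD|exists (a + b); exact: hvD]. Qed.

Lemma lrM g h : LR g -> LR h -> LR (g * h).
Proof. by move=> [gF [a ga]] [hF [b hb]]; split; [exact: ffM|exists (a * b); exact: hvM]. Qed.

Lemma lr_cst c : LR (cstK n c).
Proof. by split; [exact: ff_cst|exists c; exact: hv_cst]. Qed.

Lemma lr0 : LR 0. Proof. by rewrite -cstK0; apply: lr_cst. Qed.
Lemma lr1 : LR 1. Proof. by rewrite -cstK1; apply: lr_cst. Qed.

Lemma lrN g : LR g -> LR (- g).
Proof. by move=> [gF [a ga]]; split; [exact: ffN|exists (- a); exact: hvN]. Qed.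

Lemma lrV g a : a != 0 -> FF g -> has_value u g a -> LR g^-1.
Proof. by move=> a0 gF ga; split; [exact: ffV|exists a^-1; exact: hvV]. Qed.

(* The characters that extend to the affine chart of the cone spanned by the
   rays on whose divisors [u] lies. *)
Definition regular_char m := forall l, u l = 0 -> 0 <= pairing m (e l).

Lemma hv_chi m : regular_char m ->
  has_value u (chi F e m) (\prod_l u l ^ pairing m (e l)).
Proof.
move=> hm; apply: hv_prod => l _; have [ul|ul] := eqVneq (u l) 0.
  have := hm l ul; case: (pairing m (e l)) => // k _; exact: hvX (hv_zK u l).
exact: hvXz ul (hv_zK u l).
Qed.

Lemma lr_chi m : regular_char m -> LR (chi F e m).
Proof. by move=> /hv_chi hm; split; [exact: ff_chi|eexists; exact: hm]. Qed.

Definition regular_span g := exists2 s : seq (F * 'rV[int]_d),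
  g = \sum_(x <- s) cstK n x.1 * chi F e x.2 & forall x, x \in s -> regular_char x.2.

Definition alpha_image (v : 'rV[int]_n) := exists m, v = \row_l pairing m (e l).

Lemma alpha_image0 : alpha_image 0.
Proof. by exists 0; apply/rowP => l; rewrite !mxE pairing0. Qed.

Lemma alpha_imageB v w : alpha_image v -> alpha_image w -> alpha_image (v - w).
Proof.
move=> [m ->] [k ->]; exists (m - k); apply/rowP => l.
by rewrite !mxE pairingD pairingN.
Qed.

Lemma regular_spanP (p : {mpoly F[n]}) (nu : 'X_{1..n}) :
  in_class alpha_image (mvec nu) p -> (forall l, u l = 0 -> nu l = 0%N) ->
  regular_span (tf p / tf 'X_[nu]).
Proof.
move=> hp hnu; rewrite [in tf p](mpolyE p) rmorph_sum /= mulr_suml.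
have : forall m : 'X_{1..n}, m \in msupp p -> alpha_image (mvec m - mvec nu) by exact: hp.
elim: (msupp p) => [|m s IH] hs; first by exists [::]; rewrite ?big_nil.
have [|t tE ht] := IH; first by move=> k ks; apply: hs; rewrite inE ks orbT.
have [k kE] := hs _ (mem_head _ _).
have kl l : pairing k (e l) = (m l)%:Z - (nu l)%:Z.
  by have /rowP /(_ l) := kE; rewrite !mxE.
exists ((p@_m, k) :: t); last first.
  move=> x; rewrite inE => /orP [/eqP ->|/ht //] l ul /=.
  by rewrite kl hnu // subr0.
rewrite !big_cons tE; congr (_ + _).
rewrite -mul_mpolyC tofracM -mulrA; congr (_ * _).
rewrite !tofracX -prodfV -big_split; apply: eq_bigr => l _ /=.
by rewrite kl expfzDr ?zK_neq0 // -exprnN.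
Qed.

(** The local ring is a localisation of the algebra of the affine chart. Replace [p] and [q] by
    components with [q] still nonzero at [u], then divide both by a monomial of [q] that does not
    vanish at [u]. *)
Lemma local_ring_frac g : LR g -> exists P Q, [/\ regular_span P, regular_span Q,
  g = P / Q & exists2 c, c != 0 & has_value u Q c].
Proof.
case=> gF [c [p [q [qu gE _]]]].
have [dl qdu] := component_nonvanishing alpha_image0 alpha_imageB qu.
have q0 : q != 0 by apply: contraNneq qu => ->; rewrite meval0.
have qd0 : component alpha_image dl q != 0 by apply: contraNneq qdu => ->; rewrite meval0.
have hal (m : 'rV[int]_d) : alpha_image (\row_i pairing m (e i)) by exists m.
have gE' := component_frac alpha_image0 alpha_imageB hal gF q0 gE qd0.
have hP := @component_in_class F n alpha_image dl p.
have hQ := @component_in_class F n alpha_image dl q.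
move: hP hQ gE' qdu.
move: (component _ _ p) (component _ _ q) => {qd0 gE qu q0}P {q}Q hP hQ gE Qu.
have [nu nuQ nuu] : exists2 nu, nu \in msupp Q & \prod_l u l ^+ nu l != 0.
  apply/hasP; apply: contraNT Qu => /hasPn hQu; rewrite mevalE big1_seq // => m /andP [_ mQ].
  by have := hQu _ mQ; rewrite negbK => /eqP ->; rewrite mulr0.
have nu0 l : u l = 0 -> nu l = 0%N.
  move=> ul; apply/eqP; apply: contraNT nuu; rewrite -lt0n => nul.
  by rewrite (bigD1 l) //= ul expr0n (gtn_eqF nul) mul0r.
have cls (R : {mpoly F[n]}) : in_class alpha_image dl R -> in_class alpha_image (mvec nu) R.
  move=> hR m mR; have -> : mvec m - mvec nu = (mvec m - dl) - (mvec nu - dl).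
    by apply/rowP => l; rewrite !mxE; ring.
  by apply: alpha_imageB; [exact: hR|exact: hQ].
have X0 : tf 'X_[nu] != 0 by rewrite tofrac_eq0 -msupp_eq0 msuppX.
exists (tf P / tf 'X_[nu]), (tf Q / tf 'X_[nu]); split.
- by apply: regular_spanP (cls _ hP) nu0.
- by apply: regular_spanP (cls _ hQ) nu0.
- by rewrite gE -mulf_div divff ?invr_eq0 // mulr1.
exists (Q.@[u] / ('X_[nu] : {mpoly F[n]}).@[u]); last by apply: hv_frac; rewrite mevalX.
by rewrite mulf_neq0 // invr_eq0 mevalX.
Qed.

End LocalRing.

(** * Smooth points on at most one boundary divisor *)

Section SmoothPoints.

Variables (F : fieldType) (D n : nat) (e : 'I_n -> 'rV[int]_D.+1) (u : 'I_n -> F).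
Local Notation K := {fraction {mpoly F[n]}}.
Local Notation LR := (@local_ring F D.+1 n e u).
Local Notation chi := (chi F e).

Section Ideal.

Variable tau : 'I_D.+1 -> K.

Definition in_ideal (g : K) := exists a : 'I_D.+1 -> K,
  (forall k, LR (a k)) /\ g = \sum_k a k * tau k.

Lemma ideal0 : in_ideal 0.
Proof.
exists (fun=> 0); split=> [k|]; first exact: lr0.
by rewrite big1 // => k _; rewrite mul0r.
Qed.

Lemma idealD g h : in_ideal g -> in_ideal h -> in_ideal (g + h).
Proof.
move=> [a [ha ->]] [b [hb ->]]; exists (fun k => a k + b k); split=> [k|]; first exact: lrD.
by rewrite -big_split; apply: eq_bigr => k _; rewrite mulrDl.
Qed.

Lemma idealM c g : LR c -> in_ideal g -> in_ideal (c * g).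
Proof.
move=> hc [a [ha ->]]; exists (fun k => c * a k); split=> [k|]; first exact: lrM.
by rewrite mulr_sumr; apply: eq_bigr => k _; rewrite mulrA.
Qed.

Lemma ideal_gen k : in_ideal (tau k).
Proof.
exists (fun j => (j == k)%:R); split=> [j|].
  by case: eqP => _; [exact: lr1|exact: lr0].
by rewrite (bigD1 k) //= eqxx mul1r big1 ?addr0 // => j /negbTE ->; rewrite mul0r.
Qed.

Definition cong_char m := exists2 y, has_value u (chi m) y & in_ideal (chi m - cstK n y).

Lemma mul_sub_mul (L : comNzRingType) (a b x y : L) : a * b - x * y = a * (b - y) + y * (a - x).
Proof. by ring. Qed.

Lemma inv_sub_inv (L : fieldType) (a x : L) : a != 0 -> x != 0 ->
  a^-1 - x^-1 = - (a^-1 * x^-1) * (a - x).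
Proof. by move=> a0 x0; field; rewrite a0 x0. Qed.

Lemma cong_charD m k : cong_char m -> cong_char k -> cong_char (m + k).
Proof.
move=> [x mx ix] [y ky iy]; exists (x * y); first by rewrite chiD; exact: hvM.
rewrite chiD cstKM mul_sub_mul; apply: idealD; apply: idealM => //; last exact: lr_cst.
by split; [exact: ff_chi|exists x].
Qed.

Lemma cong_char0 : cong_char 0.
Proof.
by exists 1; rewrite chi0; [exact: hv1|rewrite cstK1 subrr; exact: ideal0].
Qed.

Lemma cong_charN m y : y != 0 -> has_value u (chi m) y -> cong_char m -> cong_char (- m).
Proof.
move=> y0 my [x mx ix]; have xy : x = y := hv_inj mx my.
rewrite {}xy {x mx} in ix; have c0 := chi_neq0 F e m.
exists y^-1; first by rewrite chiN; exact: hvV.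
have yK : cstK n y != 0 by rewrite /cstK tofrac_eq0 mpolyC_eq0.
have -> : cstK n y^-1 = (cstK n y)^-1.
  apply: (mulfI yK); rewrite -cstKM !divff // cstK1; exact (erefl _).
rewrite chiN (inv_sub_inv c0 yK); apply: idealM => //; apply: lrN; apply: lrM.
  exact: lrV y0 (ff_chi _ _ _) my.
exact: lrV y0 (ff_cst _ _) (hv_cst _ _).
Qed.

Lemma cong_charZ m y (z : int) : has_value u (chi m) y -> cong_char m ->
  y != 0 \/ 0 <= z -> cong_char (z *: m).
Proof.
move=> my hm hz; have hk k : cong_char (m *+ k).
  by elim: k => [|k IH]; [exact: cong_char0|rewrite mulrS; exact: cong_charD].
have zE k : Posz k *: m = m *+ k by rewrite -[Posz k]natz scaler_nat.
case: z hz => k hz; first by rewrite zE.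
have y0 : y != 0 by case: hz.
have yk j : has_value u (chi (m *+ j)) (y ^+ j).
  by elim: j => [|j IH]; [rewrite chi0; exact: hv1|rewrite mulrS chiD exprS; exact: hvM].
rewrite NegzE scaleNr zE; apply: cong_charN (yk _) (hk _).
by rewrite expf_neq0.
Qed.

End Ideal.

(** The chart of a ray is an affine line times a torus. In coordinates given by a basis adapted to
    [e i], the maximal ideal is generated by the coordinates minus their values. *)
Lemma smooth_few_zeros i : primitive_vec (e i) -> (forall l, l != i -> u l != 0) -> smooth_pt e u.
Proof.
move=> pe hu; have [B Bu hB] := adapted_basis pe.
have ui l : u l = 0 -> l = i by move=> ul; apply/eqP; apply: contraT => /hu; rewrite ul eqxx.
pose y k := \prod_l u l ^ pairing (row k B) (e l).
have regB k : regular_char e u (row k B) by move=> l /ui ->; rewrite hB; case: eqP.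
have hy k : has_value u (chi (row k B)) (y k) := hv_chi (regB k).
have y0 k : y k != 0 \/ k = ord0 /\ u i = 0.
  have [ui0|ui0] := eqVneq (u i) 0; last first.
    left; apply/prodf_neq0 => l _; apply: expfz_neq0.
    by have [->|/hu] := eqVneq l i.
  have [->|k0] := eqVneq k ord0; [by right|left].
  apply/prodf_neq0 => l _; have [->|/hu ul] := eqVneq l i; last exact: expfz_neq0.
  by rewrite hB (negbTE k0) expr0z oner_neq0.
pose tau k := chi (row k B) - cstK n (y k).
have cong m : regular_char e u m -> cong_char tau m.
  (* Only the coordinate along [row ord0 B] can vanish at [u], and its exponent in [m] is the
     pairing with [e i], nonnegative when it does. The other exponents may have any sign. *)
  move=> hm; pose c := m *m invmx B.
  have mE : m = \sum_k c 0 k *: row k B.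
    by rewrite -mulmx_sum_row /c mulmxKV.
  have c0 : pairing m (e i) = c 0 ord0.
    rewrite mE /pairing; under eq_bigr => j _ do rewrite summxE mulr_suml.
    rewrite exchange_big (bigD1 ord0) //= [X in _ + X]big1 ?addr0 => [|k /negbTE k0].
      transitivity (c 0 ord0 * pairing (row ord0 B) (e i)); last by rewrite hB eqxx mulr1.
      by rewrite /pairing mulr_sumr; apply: eq_bigr => j _; rewrite !mxE mulrA.
    transitivity (c 0 k * pairing (row k B) (e i)); last by rewrite hB k0 mulr0.
    by rewrite /pairing mulr_sumr; apply: eq_bigr => j _; rewrite !mxE mulrA.
  rewrite mE; apply: (big_ind (cong_char tau)); [exact: cong_char0|exact: cong_charD|move=> k _].
  apply: (cong_charZ (hy k)); first by exists (y k); [exact: hy|exact: ideal_gen].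
  by case: (y0 k) => [|[-> ui0]]; [left|right; rewrite -c0; exact: hm].
exists tau; split=> [k|g [gF g0]].
  split; first by apply: ffB; [exact: ff_chi|exact: ff_cst].
  by rewrite -(subrr (y k)); apply: hvB; [exact: hy|exact: hv_cst].
have [P [Q [[s PE hs] Qspan gE [q q0 Qq]]]] := local_ring_frac (conj gF (ex_intro _ _ g0)).
have QK : Q != 0 := hv_neq0 q0 Qq.
have span_ff (t : seq (F * 'rV[int]_D.+1)) : function_field e (\sum_(x <- t) cstK n x.1 * chi x.2).
  by apply: ff_sum => x _; apply: ffM; [exact: ff_cst|exact: ff_chi].
rewrite gE mulrC; apply: idealM; first by case: Qspan => t QE _; apply: lrV q0 _ Qq; rewrite QE.
have P0 : has_value u P 0.
  rewrite -(mul0r q) (_ : P = g * Q); first exact: hvM.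
  by rewrite gE divfK.
suff [z Pz] : exists2 z, has_value u P z & in_ideal tau (P - cstK n z).
  by rewrite (hv_inj Pz P0) cstK0 subr0.
rewrite {}PE in P0 *; elim: s hs {P0} => [|x s IH] hs.
  by exists 0; rewrite big_nil ?cstK0 ?subrr; [exact: hv0|exact: ideal0].
have [|z hz iz] := IH; first by move=> x' x's; apply: hs; rewrite inE x's orbT.
have [y' hy' iy'] := cong _ (hs x (mem_head _ _)).
exists (x.1 * y' + z); rewrite big_cons; first by apply: hvD; first exact: hvM (hv_cst _ _) hy'.
have -> : cstK n x.1 * chi x.2 + \sum_(x <- s) cstK n x.1 * chi x.2 - cstK n (x.1 * y' + z)
    = cstK n x.1 * (chi x.2 - cstK n y') + (\sum_(x <- s) cstK n x.1 * chi x.2 - cstK n z).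
  rewrite cstKD cstKM mulrBr opprD; exact (addrACA _ _ _ _).
by apply: idealD iz; apply: idealM iy'; exact: lr_cst.
Qed.

End SmoothPoints.

(** * Numerators of global sections *)

Section PolynomialSections.

Variables (F : numClosedFieldType) (n : nat).
Local Notation K := {fraction {mpoly F[n]}}.
Local Notation tf := (@FracField.tofrac {mpoly F[n]}).

Lemma regular_polynomial (g : K) :
  (forall u, few_zeros u -> regular u g) -> exists p, g = tf p.
Proof.
move=> hg; have [p [q [q0 gE]]] := frac_ex g.
have tq : tf q != 0 by rewrite tofrac_eq0.
have [r pr] : exists r, p = q * r.
  apply: regular_dvd => // u /hg [c [p' [q' [q'u gE' _]]]]; exists p', q'; split=> //.
  apply: tofrac_inj; rewrite !tofracM; apply/eqP.
  by rewrite -(eqr_div _ _ tq (tofrac_neq0 q'u)) -gE -gE'.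
by exists r; rewrite gE pr tofracM mulrC (mulKf tq).
Qed.

(** The monomials without [z_i] form the restriction of [p] to [z_i = 0]. If their sum were nonzero,
    it would be nonzero at a torus point, and setting coordinate [i] to 0 does not change its
    value. *)
Lemma vanish_coordinate i (p : {mpoly F[n]}) :
  (forall u, few_zeros u -> u i = 0 -> p.@[u] = 0) -> forall m : 'X_{1..n}, m i = 0%N -> p@_m = 0.
Proof.
move=> hp m mi; pose Gam (v : 'rV[int]_n) := v 0 i = 0.
have cE : (component Gam 0 p)@_m = p@_m.
  by rewrite mcoeff_component /comp_pred boolp.asboolT // /Gam !mxE mi.
rewrite -cE; have [->|/torus_nonzero [u u0]] := eqVneq (component Gam 0 p) 0; first by rewrite mcoeff0.
pose v l := if l == i then 0 else u l.
have v0 l : v l = 0 -> l = i.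
  by rewrite /v; case: eqP => // _ ul; case/eqP: (u0 l).
have -> : (component Gam 0 p).@[u] = (component Gam 0 p).@[v].
  rewrite !mevalE; apply: eq_big_seq => k kp; congr (_ * _); apply: eq_bigr => l _.
  rewrite /v; case: eqP => // ->; suff -> : k i = 0%N by [].
  have := component_in_class kp; rewrite /Gam !mxE subr0 => -[].
  by [].
rewrite meval_component; last first.
  move=> k; rewrite /Gam (bigD1 i) //= /v eqxx mulf_eq0 negb_or !mxE subr0 => /andP [+ _].
  by rewrite expf_eq0 eqxx andbT lt0n negbK => /eqP ->.
rewrite hp ?eqxx //; last by rewrite /v eqxx.
by move=> a b /v0 -> /v0 ->.
Qed.

End PolynomialSections.

Lemma change_equation (L : fieldType) (g f h : L) k :
  h != 0 -> g * f ^+ k = g * h ^+ k * (f / h) ^+ k.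
Proof. by move=> h0; rewrite -mulrA -exprMn [h * _]mulrC divfK. Qed.

Lemma coefficient_ac (L : fieldType) (a b c d : L) : a * (b * c) / d = d^-1 * b * c * a.
Proof. by ring. Qed.

Lemma mulrA3 (L : fieldType) (a b c d : L) : a * b * c * d = a * (b * (c * d)).
Proof. by rewrite -!mulrA. Qed.

Section Forward.

Variables (F : numClosedFieldType) (D n : nat) (e : 'I_n -> 'rV[int]_D.+1).
Variable Sigma : {set {set 'I_n}}.
Variable sigma : 'I_D.+1 -> 'I_n.
Hypothesis sigma_basis : \det (\matrix_(k, a) e (sigma k) 0 a) != 0.
Hypothesis e_primitive : forall i, primitive_vec (e i).
Hypothesis few_zeros_inU : forall u : 'I_n -> F, few_zeros u -> inU Sigma u.
Hypothesis parallel_rays : forall i j (c : 'I_D.+1 -> F), i != j -> e j != - e i ->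
  (forall a b, c a * (e i 0 b)%:~R = c b * (e i 0 a)%:~R) ->
  (forall a b, c a * (e j 0 b)%:~R = c b * (e j 0 a)%:~R) -> forall a, c a = 0.

Local Notation K := {fraction {mpoly F[n]}}.
Local Notation tf := (@FracField.tofrac {mpoly F[n]}).
Local Notation FF := (@function_field F D.+1 n e).

Variables (beta : divclass n) (f : {mpoly F[n]}).
Hypotheses (f_neq0 : f != 0) (f_deg : in_degree e beta f).
Hypothesis X_Cartier : Cartier e Sigma f.

Lemma in_degreeP (b : divclass n) (p : {mpoly F[n]}) :
  in_degree e b p <-> in_class (alpha_image e) (\row_l b l) p.
Proof.
split=> hp m /hp [k hk]; exists k; first by apply/rowP => l; rewrite !mxE hk.
by move=> l; have /rowP /(_ l) := hk; rewrite !mxE.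
Qed.

Lemma local_eq_val u h : local_equation e f u h ->
  exists2 c, c != 0 & [/\ h != 0, has_value u (h / tf f) c & has_value u (tf f / h) c^-1].
Proof.
move=> [hF [c c0 hc]]; exists c => //; split=> //.
  by apply: contraNneq (hv_neq0 c0 hc) => ->; rewrite mul0r.
by have := hvV c0 hc; rewrite invf_div.
Qed.

Lemma smooth_few (u : 'I_n -> F) : few_zeros u -> smooth_pt e u.
Proof.
move=> hu; have [/existsP [i /eqP ui]|/existsPn h] := boolP [exists i, u i == 0].
  apply: (@smooth_few_zeros F D n e u i (@e_primitive i)) => l; apply: contraNneq => ul; exact/eqP/hu.
by apply: (@smooth_few_zeros F D n e u _ (@e_primitive (sigma ord0))) => l _; exact: h.
Qed.

(** The denominator [f ^+ k] is its own component of class k beta, so [component_frac] identifies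
    the numerator with its component of that class. *)
Lemma class_of_quotient (g : K) (k : nat) p : FF g -> g * tf f ^+ k = tf p ->
  in_class (alpha_image e) ((\row_l beta l) *+ k) p.
Proof.
move=> gF gE; have hal (m : 'rV[int]_D.+1) : alpha_image e (\row_i pairing m (e i)) by exists m.
have A0 : alpha_image e 0 by exact: alpha_image0.
have AB v v' : alpha_image e v -> alpha_image e v' -> alpha_image e (v - v') by exact: alpha_imageB.
have fk0 : f ^+ k != 0 by rewrite expf_neq0.
have fk : in_class (alpha_image e) ((\row_l beta l) *+ k) (f ^+ k).
  have hf : component (alpha_image e) (\row_l beta l) f = f by apply/component_id/in_degreeP.
  suff <- : component (alpha_image e) ((\row_l beta l) *+ k) (f ^+ k) = f ^+ k.
    exact: component_in_class.
  elim: k {gE fk0} => [|k IH].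
    rewrite expr0 mulr0n; apply: component_id => m.
    by rewrite -mpolyC1 msuppC oner_eq0 inE => /eqP ->; exists 0; apply/rowP => l; rewrite !mxE mnm0E pairing0.
  rewrite exprS mulrS addrC (component_mull A0 AB) ?IH //; exact/in_degreeP.
have tk0 : tf (f ^+ k) != 0 by rewrite tofrac_eq0.
have gE' : g = tf p / tf (f ^+ k) by rewrite -gE -tofracXn (mulfK tk0).
have cf := component_id fk.
have cf0 : component (alpha_image e) ((\row_l beta l) *+ k) (f ^+ k) != 0 by rewrite cf.
have := component_frac A0 AB hal gF fk0 gE' cf0; rewrite cf gE' => /(mulIf _) h.
have pE : p = component (alpha_image e) ((\row_l beta l) *+ k) p.
  by apply/tofrac_inj/h; rewrite invr_eq0.
rewrite pE; exact: component_in_class.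
Qed.

Lemma global_section_polynomial (w : dform F n D) : global_section_Omega e Sigma f w ->
  exists P : 'I_D.+1 -> {mpoly F[n]},
  [/\ w = contract e (\row_a (tf (P a) / tf f)),
      forall a, in_class (alpha_image e) (\row_l beta l) (P a) &
      forall (m : 'X_{1..n}) i, m i = 0%N -> forall a b, (P a)@_m * (e i 0 b)%:~R = (P b)@_m * (e i 0 a)%:~R].
Proof.
move=> [/forms_function_field [G wG GF] hloc].
have tf0 : tf f != 0 by rewrite tofrac_eq0.
have loc (u : 'I_n -> F) : few_zeros u -> exists c : 'I_D.+1 -> F,
    (forall a, has_value u (G 0 a * tf f) (c a)) /\
    forall i, u i = 0 -> forall a b, c a * (e i 0 b)%:~R = c b * (e i 0 a)%:~R.
  move=> hu; have [h hh] := X_Cartier (few_zeros_inU hu).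
  have [G' G'E [c [hc pc]]] := forms_local sigma_basis (hloc u (few_zeros_inU hu) (smooth_few hu) h hh).
  have GG' : h *: G = G' by apply: (contract_inj (F := F) sigma_basis); rewrite contractZ -wG.
  have [y y0 [h0 _ fh]] := local_eq_val hh.
  exists (fun a => y^-1 * c a); split=> [a|i ui a b]; last by rewrite -!mulrA (pc _ ui a b).
  have -> : G 0 a * tf f = tf f / h * G' 0 a.
    rewrite -GG' mxE mulrA (divfK h0); exact (mulrC _ _).
  exact: hvM.
have /fin_all_exists [P hP] : forall a, exists p, G 0 a * tf f = tf p.
  by move=> a; apply: regular_polynomial => u /loc [c [hc _]]; exists (c a).
exists P; split=> [|a|m i mi a b].
- rewrite wG; congr (contract e _); apply/rowP => a; by rewrite mxE -hP (mulfK tf0).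
- by have := class_of_quotient (k := 1) (GF a); rewrite expr1 mulr1n; apply.
(* A 2 by 2 minor of [P] against [e i]: it vanishes on [z_i = 0], so its monomials without [z_i]
   cancel. *)
pose p := (e i 0 b)%:~R *: P a - (e i 0 a)%:~R *: P b.
have := @vanish_coordinate F n i p; rewrite /p => /(_ _ _ mi) h.
apply/eqP; rewrite -subr_eq0 ![_@_m * _]mulrC -!mcoeffZ -mcoeffB; apply/eqP/h.
move=> u hu ui; have [c [hc pc]] := loc u hu.
have Pu a' : (P a').@[u] = c a'.
  by apply: hv_inj (hc a'); rewrite hP; exact: hv_tofrac.
by rewrite mevalB !mevalZ !Pu ![_%:~R * _]mulrC (pc i ui a b) subrr.
Qed.

Lemma section_polynomial k g : section_O e Sigma f k g ->
  exists2 p, g * tf f ^+ k = tf p & in_class (alpha_image e) ((\row_l beta l) *+ k) p.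
Proof.
move=> [gF hg].
have [p pE] : exists p, g * tf f ^+ k = tf p.
  apply: regular_polynomial => u hu; have uU := few_zeros_inU hu.
  have [h hh] := X_Cartier uU; have [_ [c hc]] := hg u uU h hh.
  have [y y0 [h0 _ fh]] := local_eq_val hh.
  exists (c * y^-1 ^+ k); have -> : g * tf f ^+ k = g * h ^+ k * (tf f / h) ^+ k.
    exact (change_equation _ _ _ h0).
  exact: hvM hc (hvX _ fh).
exists p => //; exact (class_of_quotient gF pE).
Qed.

Lemma ample_no_opposite i j (m : 'X_{1..n}) : ample e Sigma f -> e j = - e i ->
  alpha_image e (mvec m - \row_l beta l) -> m i = 0%N -> m j = 0%N -> False.
Proof.
move=> [k [N [s [k0 sO [hdef hinj _ _]]]]] eji [mu muE] mi mj.
have /fin_all_exists2 [p pE pc] : forall t, exists2 p, s t * tf f ^+ k = tf p &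
    in_class (alpha_image e) ((\row_l beta l) *+ k) p.
  by move=> t; apply: section_polynomial.
(* Since [m i = m j = 0] and [e j = - e i], the exponents [nu i] and [nu j] are opposite; being
   nonnegative, both are zero. *)
have p_indep t (nu : 'X_{1..n}) : nu \in msupp (p t) -> nu i = 0%N.
  move=> /pc [x xE].
  have nuE l : (nu l)%:Z = pairing x (e l) + (beta l) *+ k.
    by have /rowP /(_ l) := xE; rewrite !mxE mulmxnE !mxE => <-; rewrite subrK.
  have betaE l : beta l = (m l)%:Z - pairing mu (e l).
    by have /rowP /(_ l) := muE; rewrite !mxE => <-; rewrite opprB addrCA subrr addr0.
  have := nuE i; have := nuE j; rewrite !betaE mi mj eji.
  have pN y : pairing y (- e i) = - pairing y (e i).
    by rewrite /pairing -sumrN; apply: eq_bigr => a _; rewrite mxE mulrN.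
  rewrite !pN !sub0r opprK mulNrn; move: (pairing x (e i)) (pairing mu (e i) *+ k) => a b; lia.
(* Two torus points that differ only in [z_i]: every section numerator takes the same value at
   both. *)
pose u : 'I_n -> F := fun=> 1; pose v : 'I_n -> F := fun l => if l == i then 2 else 1.
have uv t : (p t).@[u] = (p t).@[v].
  rewrite !mevalE; apply: eq_big_seq => nu /p_indep nui; congr (_ * _); apply: eq_bigr => l _.
  by rewrite /u /v; case: eqP => // ->; rewrite nui.
have u0 l : u l != 0 by exact: oner_neq0.
have v0 l : v l != 0 by rewrite /v; case: ifP => _; rewrite ?pnatr_eq0 ?oner_neq0.
have uU : inU Sigma u by apply: few_zeros_inU => a b /eqP; rewrite (negbTE (u0 a)).
have vU : inU Sigma v by apply: few_zeros_inU => a b /eqP; rewrite (negbTE (v0 a)).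
have val x y : proj_map e f k s x y -> exists2 c, c != 0 & forall t, y t = (p t).@[x] * c.
  move=> [_ [h hh hy]]; have [c c0 [h0 hc _]] := local_eq_val hh.
  exists (c ^+ k) => [|t]; first by rewrite expf_neq0.
  apply: hv_inj (hy t) _.
  have tf0 : tf f != 0 by rewrite tofrac_eq0.
  have -> : s t * h ^+ k = tf (p t) * (h / tf f) ^+ k.
    rewrite -pE; exact (change_equation _ _ _ tf0).
  by apply: hvM; [exact: hv_tofrac|exact: hvX].
have [y hy] := hdef u uU; have [y' hy'] := hdef v vU.
have [c c0 yE] := val _ _ hy; have [c' c0' yE'] := val _ _ hy'.
have [|t [_ ht] vt] := hinj u v y y' uU vU hy hy'.
  exists (c' / c); first by rewrite mulf_neq0 ?invr_eq0.
  by move=> t; rewrite yE yE' uv; field.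
(* The element of D joining [u] to [v] is 2 in position [i] and 1 elsewhere, so a character that
   pairs to 1 with [e i] takes the value 2 on it instead of 1. *)
have [B _ hB] := adapted_basis (@e_primitive i).
have := ht (row ord0 B); rewrite (bigD1 i) //= hB eqxx expr1z big1 => [|l li].
  have := vt i; rewrite /u /v eqxx !mulr1 => <- /eqP.
  by rewrite (eqr_nat F 2 1).
have := vt l; rewrite /u /v (negbTE li) mulr1 => <-; exact: exp1rz.
Qed.

Lemma primitive_neq0 i : exists b, e i 0 b != 0.
Proof.
apply/rV0Pn/eqP => ei0; have := @e_primitive i 0 0; rewrite ei0 scale0r => /(_ erefl).
by case.
Qed.

Lemma ray_combination (m : 'X_{1..n}) (c : 'I_D.+1 -> F) :
  (forall i, m i = 0%N -> forall a b, c a * (e i 0 b)%:~R = c b * (e i 0 a)%:~R) ->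
  (forall i j, e j = - e i -> m i = 0%N -> m j = 0%N -> forall a, c a = 0) ->
  exists x : 'I_n -> F, (forall a, c a = \sum_i x i * (e i 0 a)%:~R) /\
    forall i, x i != 0 -> forall l, l != i -> (0 < m l)%N.
Proof.
move=> par opp; have [c0|/existsP [a0 ca0]] := boolP [forall a, c a == 0]; last first.
  have nc : ~ forall a, c a = 0 by move=> c0; rewrite c0 eqxx in ca0.
  have [/existsP [i /eqP mi]|/existsPn mpos] := boolP [exists i, m i == 0%N].
    have [b eb] := primitive_neq0 i; have eb' : (e i 0 b)%:~R != 0 :> F by rewrite intr_eq0.
    exists (fun l => if l == i then c b / (e i 0 b)%:~R else 0); split=> [a|j].
      rewrite (bigD1 i) //= eqxx big1 ?addr0 => [|l /negbTE ->]; last by rewrite mul0r.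
      by apply: (mulIf eb'); rewrite (par _ mi a b) mulrAC divfK.
    have [-> _ l li|_] := eqVneq j i; last by rewrite eqxx.
    (* A second missing variable [z_l] would force [c] to vanish: through [opp] if the rays are
       opposite, otherwise by parallelism to two independent rays. *)
    rewrite lt0n; apply/eqP => ml; apply: nc; rewrite eq_sym in li.
    have [eli|eli] := eqVneq (e l) (- e i); first exact: opp eli mi ml.
    by apply: (parallel_rays li eli); apply: par.
  have [N hN] := dual_basis F sigma_basis.
  pose y k := \sum_a c a * N k a.
  (* No variable is missing, so any expansion of [c] in basis rays serves; the coefficients are
     grouped by ray. *)
  exists (fun i => \sum_(k | sigma k == i) y k); split=> [a|i _ l _]; last by rewrite lt0n; apply: mpos.
  transitivity (\sum_k y k * (e (sigma k) 0 a)%:~R); last first.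
    rewrite (partition_big sigma xpredT) //=; apply: eq_bigr => i _; rewrite mulr_suml.
    by apply: eq_bigr => k /eqP ->.
  transitivity (\sum_b c b * (a == b)%:R).
    rewrite (bigD1 a) //= eqxx mulr1 big1 ?addr0 // => b; rewrite eq_sym => /negbTE ->.
    by rewrite mulr0.
  under eq_bigr => b _ do rewrite -hN mulr_sumr.
  rewrite exchange_big; apply: eq_bigr => k _; rewrite mulr_suml; apply: eq_bigr => b _.
  by rewrite /= mulrCA mulrC.
exists (fun=> 0); split=> [a|i]; last by rewrite eqxx.
by rewrite (eqP (forallP c0 a)) big1 // => i _; rewrite mul0r.
Qed.

Lemma forward_direction (w : dform F n D) : ample e Sigma f ->
  global_section_Omega e Sigma f w ->
  exists A : 'I_n -> {mpoly F[n]},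
    (forall i, in_degree e (shifted_class beta i) (A i)) /\
    w = scale_form (tf f)^-1 (\sum_(i < n) scale_form (tf (A i)) (Omega F e i)).
Proof.
move=> amp /global_section_polynomial.
case=> P [wE Pcl Ppar].
have /boolp.choice [x hx] : forall m : 'X_{1..n}, exists x : 'I_n -> F,
    (forall a, (P a)@_m = \sum_i x i * (e i 0 a)%:~R) /\
    forall i, x i != 0 -> forall l, l != i -> (0 < m l)%N.
  move=> m; apply: ray_combination => [i mi a b|i j eji mi mj a]; first exact: Ppar.
  apply/eqP; apply: contraT; rewrite -mcoeff_msupp => /Pcl mcl; exfalso.
  exact: (ample_no_opposite amp eji mcl mi mj).
pose U := undup (flatten [seq msupp (P a) | a <- enum 'I_D.+1]).
have Umem a m : m \in msupp (P a) -> m \in U.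
  by move=> mP; rewrite mem_undup; apply/flatten_mapP; exists a; rewrite ?mem_enum.
have Ucl m : m \in U -> alpha_image e (mvec m - \row_l beta l).
  by rewrite mem_undup => /flatten_mapP [a _ /Pcl].
(* [low i m] is the exponent of [z^m] divided by all [z_l] with [l != i]. The truncated predecessor
   is exact wherever [x m i] is nonzero. *)
pose low i (m : 'X_{1..n}) := [multinom if l == i then m l else (m l).-1 | l < n].
pose A i : {mpoly F[n]} := \sum_(m <- U) x m i *: 'X_[low i m].
pose Z i : {mpoly F[n]} := \prod_(l | l != i) 'X_l.
have AZ i : A i * Z i = \sum_(m <- U) x m i *: 'X_[m].
  rewrite mulr_suml; apply: eq_bigr => m _; rewrite -scalerAl.
  have [->|xi] := eqVneq (x m i) 0; first by rewrite !scale0r.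
  congr (_ *: _); rewrite /Z mpolyXE_id [RHS]mpolyXE_id !(bigD1 i (P := xpredT)) //=.
  rewrite mnmE eqxx -mulrA -big_split; congr (_ * _); apply: eq_bigr => l li /=.
  by rewrite mnmE (negbTE li) -exprSr prednK //; exact: (hx m).2 i xi l li.
have PE a : P a = \sum_i (e i 0 a)%:~R *: (A i * Z i).
  under eq_bigr => i _ do rewrite AZ scaler_sumr.
  rewrite exchange_big /=; apply/mpolyP => m; rewrite raddf_sum /=.
  have [mU|mU] := boolP (m \in U).
    rewrite (bigD1_seq m) ?undup_uniq //= [X in _ + X]big1 ?addr0 => [|k km].
      rewrite (hx m).1 raddf_sum; apply: eq_bigr => i _ /=.
      by rewrite !mcoeffZ mcoeffX eqxx mulr1 mulrC.
    by rewrite raddf_sum big1 // => i _; rewrite /= !mcoeffZ mcoeffX (negbTE km) !mulr0.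
  rewrite big1_seq => [|k /andP [_ kU]].
    by apply: memN_msupp_eq0; apply: contra mU => /Umem.
  rewrite raddf_sum big1 // => i _; rewrite /= !mcoeffZ mcoeffX.
  by case: eqP => [km|]; [rewrite -km kU in mU|rewrite !mulr0].
exists A; split=> [i m|].
  move=> mA; have [k [kU xk mk]] : exists k, [/\ k \in U, x k i != 0 & m = low i k].
    move: mA; rewrite /A big_seq; elim/big_ind: _ => [|p q hp hq|k kU].
    - by rewrite msupp0.
    - by move/msuppD_le; rewrite mem_cat => /orP [/hp|/hq].
    have [->|xk] := eqVneq (x k i) 0; first by rewrite scale0r msupp0.
    by move/msuppZ_le; rewrite msuppX inE => /eqP ->; exists k.
  have [mu hmu] := Ucl k kU; exists mu => l.
  have /rowP /(_ l) := hmu; rewrite !mxE => <-; rewrite mk mnmE /shifted_class.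
  case: eqP => [->|/eqP li] /=; first by ring.
  have := (hx k).2 i xk l li; move: (k l) (beta l) => kl bl; lia.
rewrite wE; transitivity (contract e (\sum_i ((tf f)^-1 * tf (A i) * (\prod_l zK F l / zK F i)) *: map_mx intr (e i))).
  congr (contract e _); apply/rowP => a; rewrite mxE PE rmorph_sum mulr_suml summxE.
  apply: eq_bigr => i _; rewrite !mxE -mul_mpolyC rmorphM /= -/(cstK n _) cstK_int tofracM.
  have -> : tf (Z i) = \prod_l zK F l / zK F i.
    rewrite rmorph_prod [in RHS](bigD1 i) //= mulrC mulKf ?zK_neq0 //.
  exact (coefficient_ac _ _ _ _).
rewrite contract_sum; apply/ffunP => js; rewrite ffunE !sum_ffunE mulr_sumr; apply: eq_bigr => i _.
rewrite [in RHS]ffunE Omega_contract !contractZ !ffunE.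
exact (mulrA3 _ _ _ _).
Qed.

End Forward.

(** * Smooth points lie on unimodular cones *)

Section PointDerivations.

Variables (F : fieldType) (D n : nat) (e : 'I_n -> 'rV[int]_D.+1) (u : 'I_n -> F).
Local Notation K := {fraction {mpoly F[n]}}.
Local Notation tf := (@FracField.tofrac {mpoly F[n]}).
Implicit Types (p q : {mpoly F[n]}) (g h : K).

(** The image of alpha plus the exponents supported on nonzero coordinates of [u]. The quotient of
    Z^n by it is the character group of the stabiliser of [u] in D, so that [good] polynomials are
    the invariants of this stabiliser. *)
Definition orbit_lattice (v : 'rV[int]_n) :=
  exists m, forall l, u l = 0 -> v 0 l = pairing m (e l).

Lemma orbit_lattice0 : orbit_lattice 0.
Proof. by exists 0 => l _; rewrite mxE pairing0. Qed.

Lemma orbit_latticeB v w : orbit_lattice v -> orbit_lattice w -> orbit_lattice (v - w).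
Proof.
move=> [m hm] [k hk]; exists (m - k) => l ul.
by rewrite !mxE hm // hk // pairingD pairingN.
Qed.

Definition good p := in_class orbit_lattice 0 p.

Lemma goodP p : good p <-> component orbit_lattice 0 p = p.
Proof.
by split=> [|<-]; [exact: component_id|exact: component_in_class].
Qed.

Lemma goodD p q : good p -> good q -> good (p + q).
Proof. exact: in_classD. Qed.

Lemma goodM p q : good p -> good q -> good (p * q).
Proof.
move=> hp /goodP hq; apply/goodP; rewrite -[X in component _ X]addr0.
by rewrite (component_mull orbit_lattice0 orbit_latticeB) ?hq.
Qed.

Lemma goodC c : good c%:MP.
Proof.
move=> m; rewrite msuppC; case: ifP => // _; rewrite inE => /eqP ->.
by exists 0 => l _; rewrite !mxE mnm0E pairing0.
Qed.

(** A derivation at [u] for which the Leibniz rule is asked only on [good] polynomials: coefficients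
    at irreducible exponents satisfy no more than that. *)
Record point_der (ell : {mpoly F[n]} -> F) : Prop := {
  pderD : forall p q, ell (p + q) = ell p + ell q;
  pder_mul : forall p q, good p -> good q -> ell (p * q) = ell p * q.@[u] + p.@[u] * ell q }.

(** Value and derivative of [g] at [u], extended to fractions of [good] polynomials by the quotient
    rule. *)
Definition has_jet (ell : {mpoly F[n]} -> F) g v c := exists p q,
  [/\ good p, good q, q.@[u] != 0, g = tf p / tf q &
      v = p.@[u] / q.@[u] /\ c = (ell p * q.@[u] - p.@[u] * ell q) / q.@[u] ^+ 2].

(** A monomial that does not vanish at [u] has exponent in [orbit_lattice]. Hence the invariant
    component of the denominator has the same nonzero value at [u], and the fraction can be taken
    between [good] polynomials. *)
Lemma local_ring_jet ell g : local_ring e u g -> exists v c, has_jet ell g v c.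
Proof.
case=> gF [_ [p [q [qu gE _]]]].
have hal (m : 'rV[int]_D.+1) : orbit_lattice (\row_i pairing m (e i)).
  by exists m => l _; rewrite mxE.
have qcu : (component orbit_lattice 0 q).@[u] = q.@[u].
  apply: meval_component => m hm; exists 0 => l ul; rewrite !mxE pairing0.
  suff -> : m l = 0%N by [].
  apply/eqP; apply: contraNT hm; rewrite -lt0n => ml.
  by rewrite (bigD1 l) //= ul expr0n (gtn_eqF ml) mul0r.
have q0 : q != 0 by apply: contraNneq qu => ->; rewrite meval0.
have qc0 : component orbit_lattice 0 q != 0.
  by apply: contraNneq qu => qc; rewrite -qcu qc meval0.
have gE' := component_frac orbit_lattice0 orbit_latticeB hal gF q0 gE qc0.
eexists; eexists; exists (component orbit_lattice 0 p), (component orbit_lattice 0 q).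
split; [exact: component_in_class|exact: component_in_class|by rewrite qcu|exact gE'|].
by split; reflexivity.
Qed.

Lemma jet_value ell g v c : has_jet ell g v c -> has_value u g v.
Proof. by move=> [p [q [_ _ q0 -> [-> _]]]]; exact: hv_frac. Qed.

Lemma jet_quotient_inj (p q r s p' q' r' s' : F) : q != 0 -> s != 0 ->
  p * s = r * q -> p' * s + p * s' = r' * q + r * q' ->
  (p' * q - p * q') / q ^+ 2 = (r' * s - r * s') / s ^+ 2.
Proof.
move=> q0 s0 h1 h2; apply/eqP; rewrite eqr_div ?expf_neq0 //; apply/eqP.
have -> : (p' * q - p * q') * s ^+ 2 = (p' * s + p * s') * q * s - p * s * s' * q - p * s * q' * s by ring.
by rewrite h2 h1; ring.
Qed.

Lemma jet_inj ell g v c v' c' : point_der ell ->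
  has_jet ell g v c -> has_jet ell g v' c' -> c = c'.
Proof.
move=> hl [p [q [gp gq q0 gE [_ ->]]]] [r [s [gr gs s0 gE' [_ ->]]]].
have E : p * s = r * q.
  apply: tofrac_inj; rewrite !tofracM; apply/eqP.
  by rewrite -(eqr_div _ _ (tofrac_neq0 q0) (tofrac_neq0 s0)) -gE -gE'.
apply: jet_quotient_inj => //; first by rewrite -!mevalM E.
by rewrite -!(pder_mul hl) // E.
Qed.

Lemma jet_cst ell a : point_der ell -> (forall c, ell c%:MP = 0) -> has_jet ell (cstK n a) a 0.
Proof.
move=> hl h0; exists a%:MP, 1%:MP; rewrite !mevalC !h0; split; try exact: goodC.
- exact: oner_neq0.
- by rewrite /cstK rmorph1 divr1.
by rewrite divr1 mul0r mulr0 subrr mul0r.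
Qed.

Lemma jetD ell g h v c v' c' : point_der ell ->
  has_jet ell g v c -> has_jet ell h v' c' -> has_jet ell (g + h) (v + v') (c + c').
Proof.
move=> hl [p [q [gp gq q0 -> [-> ->]]]] [r [s [gr gs s0 -> [-> ->]]]].
exists (p * s + r * q), (q * s); split; [by apply: goodD; apply: goodM|exact: goodM| | |].
- by rewrite mevalM mulf_neq0.
- by rewrite tofracD !tofracM (addf_div _ _ (tofrac_neq0 q0) (tofrac_neq0 s0)).
split; first by rewrite mevalD !mevalM addf_div.
by rewrite (pderD hl) !(pder_mul hl) // mevalD !mevalM quotient_rule_add.
Qed.

Lemma jetM ell g h v c v' c' : point_der ell ->
  has_jet ell g v c -> has_jet ell h v' c' -> has_jet ell (g * h) (v * v') (c * v' + v * c').
Proof.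
move=> hl [p [q [gp gq q0 -> [-> ->]]]] [r [s [gr gs s0 -> [-> ->]]]].
exists (p * r), (q * s); split; [exact: goodM|exact: goodM| | |].
- by rewrite mevalM mulf_neq0.
- by rewrite !tofracM mulf_div.
split; first by rewrite !mevalM mulf_div.
by rewrite !(pder_mul hl) // !mevalM quotient_rule_mul.
Qed.

Lemma jet_sum ell I (r : seq I) (G : I -> K) (v c : I -> F) : point_der ell ->
  (forall c, ell c%:MP = 0) ->
  (forall i, has_jet ell (G i) (v i) (c i)) ->
  has_jet ell (\sum_(i <- r) G i) (\sum_(i <- r) v i) (\sum_(i <- r) c i).
Proof.
move=> hl h0 hG; elim: r => [|i r IH]; last by rewrite !big_cons; exact: jetD.
by rewrite !big_nil -cstK0; exact: jet_cst.
Qed.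

(* The point derivations span a space of dimension at most [dim m/m^2 <= d]. *)
Lemma smooth_det_jets (x : 'I_D.+2 -> K) (ell : 'I_D.+2 -> {mpoly F[n]} -> F)
    (J : 'M[F]_D.+2) : smooth_pt e u ->
  (forall j, point_der (ell j)) -> (forall j c, ell j c%:MP = 0) ->
  (forall i, max_ideal e u (x i)) ->
  (forall i j, exists v, has_jet (ell j) (x i) v (J i j)) -> \det J = 0.
Proof.
move=> [t [tm tgen]] hl h0 xm hJ.
have /fin_all_exists [a ha] : forall i, exists a : 'I_D.+1 -> K,
    (forall k, local_ring e u (a k)) /\ x i = \sum_k a k * t k.
  by move=> i; exact: tgen.
have /fin_all_exists [av hav] : forall i, exists av : 'I_D.+1 -> F, forall k, has_value u (a i k) (av k).
  move=> i; have /fin_all_exists [y hy] : forall k, exists y, has_value u (a i k) y.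
    by move=> k; have [_] := (ha i).1 k.
  by exists y.
have tj k j : exists c, has_jet (ell j) (t k) 0 c.
  have [tF t0] := tm k.
  have [v [c hc]] := local_ring_jet (ell j) (conj tF (ex_intro _ _ t0)).
  by exists c; rewrite (hv_inj t0 (jet_value hc)).
have /fin_all_exists [tc htc] : forall k, exists tc : 'I_D.+2 -> F, forall j, has_jet (ell j) (t k) 0 (tc j).
  by move=> k; have /fin_all_exists [y hy] := tj k; exists y.
have JE : J = (\matrix_(i, k) av i k) *m (\matrix_(k, j) tc k j).
  apply/matrixP => i j; rewrite mxE; have [v hv] := hJ i j.
  have /fin_all_exists [b hb] : forall k, exists b, has_jet (ell j) (a i k) (av i k) b.
    move=> k; have [v' [b hb]] := local_ring_jet (ell j) ((ha i).1 k).
    by exists b; rewrite (hv_inj (hav i k) (jet_value hb)).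
  have hx : has_jet (ell j) (x i) (\sum_k av i k * 0) (\sum_k (b k * 0 + av i k * tc k j)).
    rewrite (ha i).2; apply: jet_sum => // k; apply: jetM => //; exact: htc.
  rewrite (jet_inj (hl j) hv hx); apply: eq_bigr => k _.
  by rewrite mulr0 add0r !mxE.
apply/eqP; apply: contraT => /eqP/eqP dJ.
have : J \in unitmx by rewrite unitmxE unitfE.
rewrite -row_full_unit /row_full => /eqP rJ.
have := mulmx_max_rank (\matrix_(i, k) av i k) (\matrix_(k, j) tc k j).
by rewrite -JE rJ ltnn.
Qed.

End PointDerivations.

(** * Point derivations along and across the torus orbit *)

Section Orbit.

Variables (F : numClosedFieldType) (D n : nat) (e : 'I_n -> 'rV[int]_D.+1) (u : 'I_n -> F).
Local Notation K := {fraction {mpoly F[n]}}.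
Local Notation tf := (@FracField.tofrac {mpoly F[n]}).
Local Notation chi := (chi F e).
Implicit Types (p q : {mpoly F[n]}) (g h : K) (m : 'rV[int]_D.+1).

(* Restriction to the slice through [u] transversal to its torus orbit. *)
Definition slice : {rmorphism {mpoly F[n]} -> {mpoly F[n]}} :=
  mmap (@mpolyC n F) (fun l => if u l == 0 then 'X_l else (u l)%:MP).

Definition slice_mnm (k : 'X_{1..n}) : 'X_{1..n} :=
  [multinom if (u l == 0)%R then k l else 0%N | l < n].

Lemma sliceC c : slice c%:MP = c%:MP. Proof. exact: mmapC. Qed.

Lemma sliceX (k : 'X_{1..n}) :
  slice 'X_[k] = (\prod_(l | u l != 0) u l ^+ k l) *: 'X_[slice_mnm k].
Proof.
rewrite /slice /= mmapX /mmap1 -mul_mpolyC mpolyXE_id rmorph_prod /=.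
rewrite (bigID (fun l => u l != 0)) /=; congr (_ * _).
  by apply: eq_bigr => l /negbTE ->; rewrite rmorphXn.
rewrite [RHS](bigID (fun l => u l != 0)) /= [X in _ = X * _]big1 ?mul1r => [|l /negbTE ul].
  by apply: eq_bigr => l; rewrite negbK => ul; rewrite mnmE ul.
by rewrite mnmE ul expr0.
Qed.

Lemma slice_coef0 p : (slice p)@_0%MM = p.@[u].
Proof.
pose g : {rmorphism {mpoly F[n]} -> F} := mcoeff 0%MM \o slice.
apply: (mpoly_rmorph_ext (f := g) (g := meval u)) => [c|l] /=.
  by rewrite sliceC mcoeffC eqxx mulr1 mevalC.
rewrite mmapX mmap1U mevalXU; case: eqP => [->|_]; last by rewrite mcoeffC eqxx mulr1.
by rewrite mcoeffX mnm1_eq0.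
Qed.

Lemma slice_supp p k : k \in msupp (slice p) -> exists2 k', k' \in msupp p & k = slice_mnm k'.
Proof.
rewrite [in slice p](mpolyE p) rmorph_sum big_seq; elim/big_ind: _ => [|x y hx hy|k' kp].
- by rewrite msupp0.
- by move/msuppD_le; rewrite mem_cat => /orP [/hx|/hy].
rewrite -mul_mpolyC rmorphM /= sliceC mul_mpolyC => /msuppZ_le; rewrite sliceX => /msuppZ_le.
by rewrite msuppX inE => /eqP ->; exists k'.
Qed.

Lemma slice_good p k : good e u p -> k \in msupp (slice p) -> orbit_lattice e u (mvec k).
Proof.
move=> gp /slice_supp [k' /gp [m hm] ->]; exists m => l ul.
by rewrite -hm // !mxE mnmE ul eqxx subr0.
Qed.

(** The indecomposable exponents of invariant monomials, that is, a Hilbert basis of the monoid they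
    form. *)
Definition irreducible_mnm (s : 'X_{1..n}) := s != 0%MM /\
  forall k1 k2, orbit_lattice e u (mvec k1) -> orbit_lattice e u (mvec k2) ->
    (k1 + k2)%MM = s -> k1 = 0%MM \/ k2 = 0%MM.

Definition slice_coef (s : 'X_{1..n}) p : F := (slice p)@_s.

(** Subtracting their values, two [good] polynomials restrict to sums of nonconstant monomials with
    exponents in the lattice; an irreducible exponent cannot occur in the product of two such
    sums. *)
Lemma slice_coef_der s : irreducible_mnm s -> point_der e u (slice_coef s).
Proof.
move=> [s0 hs]; split=> [p q|p q gp gq]; first by rewrite /slice_coef rmorphD mcoeffD.
rewrite /slice_coef rmorphM /=.
pose p1 := slice p - (p.@[u])%:MP; pose q1 := slice q - (q.@[u])%:MP.
have -> : slice p * slice q = p1 * q1 + q.@[u] *: slice p + p.@[u] *: slice q - (p.@[u] * q.@[u])%:MP.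
  by rewrite /p1 /q1 -!mul_mpolyC rmorphM /=; ring.
rewrite mcoeffB !mcoeffD !mcoeffZ mcoeffC (negbTE s0) mulr0 subr0.
suff -> : (p1 * q1)@_s = 0 by rewrite add0r mulrC.
apply/memN_msupp_eq0/negP => /msuppM_le /allpairsP [[k1 k2] /= [k1p k2q sE]].
have sub (r : {mpoly F[n]}) k : good e u r -> k \in msupp (slice r - (r.@[u])%:MP) ->
    orbit_lattice e u (mvec k) /\ k <> 0%MM.
  move=> gr kr; split.
    have [kr'|] := boolP (k \in msupp (slice r)); first exact: slice_good kr'.
    move: kr => /msuppB_le; rewrite mem_cat => /orP [-> //|]; rewrite msuppC.
    case: ifP => // _; rewrite inE => /eqP -> _; exists 0 => l _.
    by rewrite !mxE mnm0E pairing0.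
  move=> k0; move: kr; rewrite k0 mcoeff_msupp mcoeffB mcoeffC eqxx mulr1 slice_coef0.
  by rewrite subrr eqxx.
have [l1 n1] := sub _ _ gp k1p; have [l2 n2] := sub _ _ gq k2q.
by case: (hs k1 k2 l1 l2 (esym sE)).
Qed.

Lemma slice_coefC s c : s != 0%MM -> slice_coef s c%:MP = 0.
Proof. by move=> /negbTE s0; rewrite /slice_coef sliceC mcoeffC s0 mulr0. Qed.

(** The derivation [z_l d/dz_l] at [u], which is tangent to the torus orbit. *)
Definition log_der l p : F := u l * (mderiv l p).@[u].

Lemma log_der_der l : point_der e u (log_der l).
Proof.
split=> [p q|p q _ _]; first by rewrite /log_der mderivD mevalD mulrDr.
rewrite /log_der mderivM mevalD !mevalM; ring.
Qed.

Lemma log_derC l c : log_der l c%:MP = 0.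
Proof. by rewrite /log_der mderivC meval0 mulr0. Qed.

Lemma log_derX l (k : 'X_{1..n}) : log_der l 'X_[k] = (k l)%:R * ('X_[k] : {mpoly F[n]}).@[u].
Proof.
rewrite /log_der mderivX mevalZ mulrCA; have [->|kl] := posnP (k l); first by rewrite !mul0r.
congr (_ * _); rewrite -[X in X * _](mevalXU u) -mevalM -mpolyXD addmC submK //.
by rewrite lep1mP -lt0n.
Qed.

Lemma chi_frac m : regular_char e u m -> exists k1 k2 : 'X_{1..n},
  [/\ chi m = tf 'X_[k1] / tf 'X_[k2], forall l, (k1 l)%:Z - (k2 l)%:Z = pairing m (e l) &
      forall l, u l = 0 -> k2 l = 0%N].
Proof.
move=> hm; pose z l := pairing m (e l).
pose k1 := [multinom (if (0 <= z l)%R then absz (z l) else 0%N) | l < n].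
pose k2 := [multinom (if (0 <= z l)%R then 0%N else absz (z l)) | l < n].
have hk l : (k1 l)%:Z - (k2 l)%:Z = z l by rewrite !mnmE; case: ifP => h; lia.
exists k1, k2; split=> // [|l ul]; last by rewrite mnmE hm.
rewrite !tofracX -prodfV -big_split; apply: eq_bigr => l _ /=.
by rewrite -/(z l) -hk expfzDr ?zK_neq0 // -exprnN.
Qed.

Lemma goodX_char m (k1 k2 : 'X_{1..n}) : (forall l, (k1 l)%:Z - (k2 l)%:Z = pairing m (e l)) ->
  (forall l, u l = 0 -> k2 l = 0%N) -> good e u 'X_[k1] /\ good e u 'X_[k2].
Proof.
move=> h1 h2; split=> k; rewrite msuppX inE => /eqP ->.
  by exists m => l ul; rewrite -h1 h2 // !mxE.
by exists 0 => l ul; rewrite !mxE h2 // pairing0 subr0.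
Qed.

Lemma jet_log_der l m : regular_char e u m ->
  exists v, has_jet e u (log_der l) (chi m) v ((pairing m (e l))%:~R * v).
Proof.
move=> /chi_frac [k1 [k2 [cE hk h0]]]; have [g1 g2] := goodX_char hk h0.
have q0 : ('X_[k2] : {mpoly F[n]}).@[u] != 0.
  rewrite mevalX; apply/prodf_neq0 => j _; rewrite expf_eq0.
  by have [uj|] := eqVneq (u j) 0; rewrite ?andbF // h0.
exists (('X_[k1] : {mpoly F[n]}).@[u] / ('X_[k2] : {mpoly F[n]}).@[u]).
exists 'X_[k1], 'X_[k2]; split=> //; split=> //.
rewrite !log_derX -hk rmorphB /= -!pmulrn; move: q0; move: (_.@[u]) (_.@[u]) => q p q0.
by field.
Qed.

(** The denominator of the character involves only coordinates nonzero at [u], so its slice is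
    constant, and the slice of the numerator is a nonzero multiple of one monomial. *)
Lemma jet_slice_coef s m : regular_char e u m -> s != 0%MM ->
  (forall l, u l != 0 -> s l = 0%N) -> exists v c, has_jet e u (slice_coef s) (chi m) v c /\
    (c != 0 <-> forall l, u l = 0 -> (s l)%:Z = pairing m (e l)).
Proof.
move=> /chi_frac [k1 [k2 [cE hk h0]]] s0 hs; have [g1 g2] := goodX_char hk h0.
have q0 : ('X_[k2] : {mpoly F[n]}).@[u] != 0.
  rewrite mevalX; apply/prodf_neq0 => j _; rewrite expf_eq0.
  by have [uj|] := eqVneq (u j) 0; rewrite ?andbF // h0.
exists (('X_[k1] : {mpoly F[n]}).@[u] / ('X_[k2] : {mpoly F[n]}).@[u]).
exists (slice_coef s 'X_[k1] / ('X_[k2] : {mpoly F[n]}).@[u]); split.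
  exists 'X_[k1], 'X_[k2]; split=> //; split=> //.
  have -> : slice_coef s 'X_[k2] = 0.
    rewrite /slice_coef sliceX mcoeffZ mcoeffX.
    have -> : slice_mnm k2 = 0%MM.
      by apply/mnmP => l; rewrite mnmE mnm0E; case: eqP => // /h0.
    by rewrite eq_sym (negbTE s0) mulr0.
  by rewrite mulr0 subr0; field.
have p0 : \prod_(l | u l != 0) u l ^+ k1 l != 0.
  by apply/prodf_neq0 => l ul; rewrite expf_neq0.
rewrite mulf_eq0 invr_eq0 (negbTE q0) orbF /slice_coef sliceX mcoeffZ mcoeffX.
rewrite mulf_eq0 (negbTE p0) /= pnatr_eq0 eqb0 negbK; split=> [/eqP <- l ul|h].
  by rewrite mnmE ul eqxx -hk h0 // subr0.
apply/eqP/mnmP => l; rewrite mnmE; case: eqP => [ul|/eqP/hs //].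
by have := h l ul; rewrite -hk h0 // subr0 => -[].
Qed.

End Orbit.

Lemma scaled_dual_basis D n (e : 'I_n -> 'rV[int]_D.+1) (sigma : 'I_D.+1 -> 'I_n) :
  \det (\matrix_(k, a) e (sigma k) 0 a) != 0 ->
  exists (w : 'I_D.+1 -> 'rV[int]_D.+1) (N : nat), (0 < N)%N /\
    forall k l, pairing (w k) (e (sigma l)) = ((k == l) * N)%N%:Z.
Proof.
set M : 'M[int]_D.+1 := \matrix_(k, a) _ => dM.
(* The adjugate alone would give [\det M], of unknown sign; the second factor makes [N] the positive
   number [\det M ^+ 2]. *)
exists (fun k => \det M *: row k (\adj M)^T), (absz (\det M * \det M)); split.
  by rewrite absz_gt0 mulf_neq0.
move=> k l; have /matrixP /(_ l k) := mul_mx_adj M; rewrite !mxE => h.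
transitivity (\det M * \sum_j M l j * (\adj M) j k).
  by rewrite /pairing mulr_sumr; apply: eq_bigr => j _; rewrite !mxE; ring.
rewrite h eq_sym; case: (k == l); rewrite ?mulr0n ?mulr1n ?mul0n ?mul1n ?mulr0 //.
by rewrite gez0_abs // -expr2 sqr_ge0.
Qed.

Section Unimodular.

Variables (F : numClosedFieldType) (D n : nat) (e : 'I_n -> 'rV[int]_D.+1) (u : 'I_n -> F).
Variable sigma : 'I_D.+1 -> 'I_n.
Hypothesis sigma_basis : \det (\matrix_(k, a) e (sigma k) 0 a) != 0.
Hypothesis sigma_cover : forall l, u l = 0 -> exists k, sigma k = l.
Hypothesis e_primitive : forall i, primitive_vec (e i).
Local Notation K := {fraction {mpoly F[n]}}.
Local Notation chi := (chi F e).
Implicit Types (m : 'rV[int]_D.+1).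

Lemma sigma_inj : injective sigma.
Proof.
have [w [N [N0 hw]]] := scaled_dual_basis sigma_basis.
move=> k l kl; have := hw k l; rewrite -kl hw eqxx mul1n => -[].
by case: eqP => // _; rewrite mul0n => N1; rewrite N1 in N0.
Qed.

(** [r] is the least positive multiple of the axis cut out by a character. Both parts of a
    decomposition stay on the axis, so a nonzero part already has length at least [r]. *)
Lemma axis_generator k : u (sigma k) = 0 -> exists m (r : nat), (0 < r)%N /\
  (forall l, u l = 0 -> pairing m (e l) = ((l == sigma k) * r)%N%:Z) /\
  irreducible_mnm e u (U_(sigma k) *+ r)%MM.
Proof.
move=> uk; have [w [N [N0 hw]]] := scaled_dual_basis sigma_basis.
pose Q (r : nat) := (0 < r)%N /\
  exists m, forall l, u l = 0 -> pairing m (e l) = ((l == sigma k) * r)%N%:Z.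
have exQ : exists r, boolp.asbool (Q r).
  exists N; apply: boolp.asboolT; split=> //; exists (w k) => l ul.
  by have [j <-] := sigma_cover ul; rewrite hw (inj_eq sigma_inj) eq_sym.
case: (ex_minnP exQ) => r /boolp.asboolP [r0 [m hm]] rmin.
exists m, r; split=> //; split=> //; split.
  by apply/eqP => /mnmP /(_ (sigma k)); rewrite mulmnE mnm1E eqxx mul1n mnm0E => r1; rewrite r1 in r0.
have sE l : (U_(sigma k) *+ r)%MM l = ((l == sigma k) * r)%N by rewrite mulmnE mnm1E eq_sym.
have part (k1 k2 : 'X_{1..n}) : orbit_lattice e u (mvec k1) -> (k1 + k2 = U_(sigma k) *+ r)%MM ->
    k1 (sigma k) = 0%N \/ (r <= k1 (sigma k))%N.
  move=> [m1 hm1] k12; have [->|k10] := posnP (k1 (sigma k)); [by left|right].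
  apply: rmin; apply: boolp.asboolT; split=> //; exists m1 => l ul; rewrite -hm1 // mxE.
  have /mnmP /(_ l) := k12; rewrite mnmDE sE; case: eqP => [->|_]; rewrite ?mul1n // !mul0n.
  by move/eqP; rewrite addn_eq0 => /andP [/eqP -> _].
have off (k1 k2 : 'X_{1..n}) : (k1 + k2 = U_(sigma k) *+ r)%MM -> k1 (sigma k) = 0%N -> k1 = 0%MM.
  move=> k12 k10; apply/mnmP => l; rewrite mnm0E; have [->//|lk] := eqVneq l (sigma k).
  have /mnmP /(_ l) := k12; rewrite mnmDE sE (negbTE lk) mul0n => /eqP.
  by rewrite addn_eq0 => /andP [/eqP].
move=> k1 k2 l1 l2 k12; have k21 : (k2 + k1 = U_(sigma k) *+ r)%MM by rewrite addmC.
have [h1|h1] := part _ _ l1 k12; first by left; exact: off k12 h1.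
have [h2|h2] := part _ _ l2 k21; first by right; exact: off k21 h2.
have /mnmP /(_ (sigma k)) := k12; rewrite mnmDE sE eqxx mul1n; lia.
Qed.

(** Among the exponents with [s i = 1] choose one of least total degree. In a decomposition one part
    keeps the 1 at [i], and by minimality it is everything. *)
Lemma minimal_generator i : u i = 0 -> exists m (s : 'X_{1..n}),
  [/\ forall l, u l = 0 -> pairing m (e l) = (s l)%:Z, forall l, u l != 0 -> s l = 0%N,
      s i = 1%N & irreducible_mnm e u s].
Proof.
move=> ui; have [w [N [N0 hw]]] := scaled_dual_basis sigma_basis.
pose Q (t : nat) := exists m (s : 'X_{1..n}),
  [/\ forall l, u l = 0 -> pairing m (e l) = (s l)%:Z, forall l, u l != 0 -> s l = 0%N,
      s i = 1%N & (\sum_l s l = t)%N].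
have exQ : exists t, boolp.asbool (Q t).
  have [B _ hB] := adapted_basis (@e_primitive i).
  (* [m0] pairs to 1 with [e i] but may be negative on other rays. [T] bounds these pairings, so
     adding [T] times the dual vectors of the other basis rays makes them nonnegative and keeps the
     1. *)
  pose m0 := row ord0 B; pose T := (\sum_l absz (pairing m0 (e l)))%N.
  pose m := m0 + \sum_(k | sigma k != i) T%:Z *: w k.
  have pm k : pairing m (e (sigma k)) =
      pairing m0 (e (sigma k)) + ((sigma k != i) * (T * N))%N%:Z.
    rewrite pairingD; congr (_ + _).
    have -> : pairing (\sum_(k | sigma k != i) T%:Z *: w k) (e (sigma k)) =
        \sum_(j | sigma j != i) T%:Z * pairing (w j) (e (sigma k)).
      rewrite /pairing; under eq_bigr => j _ do rewrite summxE mulr_suml.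
      rewrite exchange_big; apply: eq_bigr => j _ /=; rewrite mulr_sumr.
      by apply: eq_bigr => a _; rewrite !mxE mulrA.
    have [ki|ki] := eqVneq (sigma k) i.
      rewrite mul0n big1 // => j ji; rewrite hw; have /negbTE -> : j != k by apply: contraNneq ji => ->; apply/eqP.
      by rewrite mul0n mulr0.
    rewrite (bigD1 k) //= hw eqxx !mul1n big1 ?addr0 // => j /andP [_ /negbTE jk].
    by rewrite hw jk mul0n mulr0.
  have pm0 l : u l = 0 -> 0 <= pairing m (e l).
    move=> /sigma_cover [k <-]; rewrite pm.
    have [ki|ki] := eqVneq (sigma k) i; first by rewrite mul0n addr0 ki hB eqxx.
    have hT : (absz (pairing m0 (e (sigma k))) <= T)%N by rewrite /T (bigD1 (sigma k)) //= leq_addr.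
    by rewrite mul1n; nia.
  have pmi : pairing m (e i) = 1.
    by have [k ki] := sigma_cover ui; rewrite -ki pm ki eqxx mul0n addr0 hB eqxx.
  pose s := [multinom if (u l == 0)%R then absz (pairing m (e l)) else 0%N | l < n].
  exists (\sum_l s l)%N; apply: boolp.asboolT; exists m, s; split=> // [l ul|l /negbTE ul|].
  - by rewrite mnmE ul eqxx gez0_abs // pm0.
  - by rewrite mnmE ul.
  by rewrite mnmE ui eqxx pmi.
case: (ex_minnP exQ) => t /boolp.asboolP [m [s [hm hs si tE]]] tmin.
exists m, s; split=> //; split.
  by apply/eqP => /mnmP /(_ i); rewrite si mnm0E.
have part (k1 k2 : 'X_{1..n}) : orbit_lattice e u (mvec k1) -> (k1 + k2)%MM = s ->
    k1 i = 1%N -> k2 = 0%MM.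
  move=> [m1 hm1] k12 k1i.
  have sE l : s l = (k1 l + k2 l)%N by rewrite -k12 mnmDE.
  have : (t <= \sum_l k1 l)%N.
    apply: tmin; apply: boolp.asboolT; exists m1, k1; split=> // [l ul|l ul].
      by rewrite -hm1 // mxE.
    by have := hs l ul; rewrite sE => /eqP; rewrite addn_eq0 => /andP [/eqP].
  rewrite -tE (eq_bigr _ (fun l _ => sE l)) big_split /= -[X in (_ <= X)%N]addn0 leq_add2l leqn0 sum_nat_eq0.
  by move=> /forallP h; apply/mnmP => l; rewrite mnm0E; apply/eqP/(implyP (h l)).
move=> k1 k2 l1 l2 k12; have : (k1 i + k2 i = 1)%N by rewrite -mnmDE k12.
case k1i : (k1 i) => [|[|x]] //=; rewrite ?add0n => k2i.
  by left; apply: (part k2 k1) => //; rewrite addmC.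
by right; apply: (part k1 k2).
Qed.

End Unimodular.

Section SmoothUnimodular.

Variables (F : numClosedFieldType) (D n : nat) (e : 'I_n -> 'rV[int]_D.+1) (u : 'I_n -> F).
Variable sigma : 'I_D.+1 -> 'I_n.
Hypothesis sigma_basis : \det (\matrix_(k, a) e (sigma k) 0 a) != 0.
Hypothesis sigma_cover : forall l, u l = 0 -> exists k, sigma k = l.
Hypothesis e_primitive : forall i, primitive_vec (e i).
Local Notation K := {fraction {mpoly F[n]}}.
Local Notation chi := (chi F e).
Implicit Types (m : 'rV[int]_D.+1).

(* At a smooth point the residues of the [s]-coefficients, for the irreducible
   exponents [s], and the logarithmic derivatives along the orbit are independent
   point derivations: there is no room for an irreducible exponent besides the
   [d] accounted for by the basis. *)
Lemma smooth_unimodular i : smooth_pt e u -> u i = 0 ->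
  exists m, forall l, u l = 0 -> pairing m (e l) = (l == i)%:Z.
Proof.
move=> sm ui; apply: boolp.contrapT => nom.
have sinj := sigma_inj sigma_basis.
have [w [N [N0 hw]]] := scaled_dual_basis sigma_basis.
pose G m (s : 'X_{1..n}) := [/\ forall l, u l = 0 -> pairing m (e l) = (s l)%:Z,
  forall l, u l != 0 -> s l = 0%N & irreducible_mnm e u s].
have [m0 [s0 [hm0 hs0 s0i irs0]]] := minimal_generator sigma_basis sigma_cover e_primitive ui.
have /fin_all_exists [ax hax] : forall k, exists ms : 'rV[int]_D.+1 * 'X_{1..n},
    u (sigma k) = 0 -> G ms.1 ms.2 /\ exists2 r, (0 < r)%N & ms.2 = (U_(sigma k) *+ r)%MM.
  move=> k; have [uk|uk] := eqVneq (u (sigma k)) 0; last by exists (0, 0%MM) => uk'; rewrite uk' eqxx in uk.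
  have [m [r [r0 [hm ir]]]] := axis_generator sigma_basis sigma_cover uk.
  exists (m, (U_(sigma k) *+ r)%MM) => _ /=; split; last by exists r.
  split=> // [l ul|l ul]; rewrite mulmnE mnm1E eq_sym ?hm //.
  by case: eqP => [lk|]; rewrite ?mul0n // lk uk eqxx in ul.
(* The index type [option 'I_D.+1] has D + 2 elements: one for each basis ray, along the orbit when
   [orb] holds and an axis exponent otherwise, and [None] for the extra exponent [s0]. *)
pose orb (a : option 'I_D.+1) := if a is Some k then u (sigma k) != 0 else false.
pose mm (a : option 'I_D.+1) := if a is Some k then if u (sigma k) == 0 then (ax k).1 else w k else m0.
pose ss (a : option 'I_D.+1) := if a is Some k then (ax k).2 else s0.
have slG a : ~~ orb a -> G (mm a) (ss a).
  case: a => [k|] //=; rewrite negbK => uk; rewrite uk.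
  by have [] := hax k (eqP uk).
have ss_inj a b : ~~ orb a -> ~~ orb b -> ss a = ss b -> a = b.
  (* If [s0] were an axis exponent, [s0 i = 1] would give [r = 1] on the axis [i], and [m0] would be
     the dual character excluded by [nom]. *)
  have axis_min k : u (sigma k) = 0 -> (ax k).2 <> s0.
    move=> uk; have [[hm _ _] [r r0 rE]] := hax k uk => E.
    have sl l : s0 l = ((sigma k == l) * r)%N by rewrite -E rE mulmnE mnm1E.
    have ki : sigma k = i by apply/eqP; have := s0i; rewrite sl; case: eqP.
    have r1 : r = 1%N by have := s0i; rewrite sl ki eqxx mul1n.
    apply: nom; exists m0 => l ul; rewrite hm0 // sl ki r1 muln1 eq_sym; by case: eqP.
  case: a b => [k|] [l|] //=; rewrite ?negbK.
  - move=> /eqP uk /eqP ul; have [_ [r r0 ->]] := hax k uk; have [_ [t t0 ->]] := hax l ul.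
    move/mnmP/(_ (sigma k)); rewrite !mulmnE !mnm1E eqxx mul1n.
    by case: eqP => [/sinj -> //|_]; rewrite mul0n => r1; rewrite r1 in r0.
  - by move=> /eqP uk _ /(axis_min _ uk).
  by move=> _ /eqP ul /esym /(axis_min _ ul).
have orb0 a l : orb a -> u l = 0 -> pairing (mm a) (e l) = 0.
  case: a => [k|] //= uk ul; rewrite (negbTE uk); have [j jl] := sigma_cover ul.
  by rewrite -jl hw; case: eqP => [kj|]; rewrite ?mul0n // kj jl ul eqxx in uk.
have reg a : regular_char e u (mm a).
  move=> l ul; have [oa|/slG [hm _ _]] := boolP (orb a); first by rewrite orb0.
  by rewrite hm.
pose V m := \prod_l u l ^ pairing m (e l).
have Vneq0 a : orb a -> V (mm a) != 0.
  move=> oa; apply/prodf_neq0 => l _; have [ul|ul] := eqVneq (u l) 0; last exact: expfz_neq0.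
  by rewrite orb0 // expr0z oner_neq0.
have Veq0 a : ~~ orb a -> V (mm a) = 0.
  move=> /slG [hm hs [snz _]]; have [l sl] : exists l, ss a l != 0%N.
    apply/existsP; apply: contraNT snz => /existsPn h; apply/eqP/mnmP => l.
    by rewrite mnm0E; apply/eqP; have := h l; rewrite negbK.
  have ul : u l = 0 by apply/eqP; apply: contraNT sl => /hs ->.
  by rewrite /V (bigD1 l) //= ul exp0rz hm // eqz_nat (negbTE sl) mul0r.
pose ell a := if orb a then log_der u (if a is Some k then sigma k else i) else slice_coef u (ss a).
have ell_der a : point_der e u (ell a).
  rewrite /ell; case: ifP => [_|/negbT/slG [_ _ ?]]; [exact: log_der_der|exact: slice_coef_der].
have ell_cst a c : ell a c%:MP = 0.
  by rewrite /ell; case: ifP => [_|/negbT/slG [_ _ [? _]]]; [exact: log_derC|exact: slice_coefC].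
pose x a := chi (mm a) - cstK n (V (mm a)).
have xmax a : max_ideal e u (x a).
  split; first by apply: ffB; [exact: ff_chi|exact: ff_cst].
  by rewrite -(subrr (V (mm a))); apply: hvB; [exact: hv_chi|exact: hv_cst].
(* Derivation [b] is nonzero on the function [x a] exactly when [a = b], so the matrix of jets is
   diagonal and nonsingular, against [smooth_det_jets]. *)
have jets a b : exists c, (exists v, has_jet e u (ell b) (x a) v c) /\ (c != 0 <-> a = b).
  suff [c [[v hv] cE]] : exists c, (exists v, has_jet e u (ell b) (chi (mm a)) v c) /\ (c != 0 <-> a = b).
    exists c; split=> //; exists (v + - V (mm a)); rewrite -[c]addr0 /x -cstKN.
    by apply: jetD => //; apply: jet_cst => // c'; exact: ell_cst.
  have [ob|ob] := boolP (orb b).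
    move: (ob); rewrite {1}/ell ob; case: b ob => [k|] //= uk _.
    have [v hv] := jet_log_der (sigma k) (reg a); exists ((pairing (mm a) (e (sigma k)))%:~R * v).
    split; first by exists v.
    have -> : v = V (mm a) := hv_inj (jet_value hv) (hv_chi (reg a)).
    have [oa|oa] := boolP (orb a); last first.
      rewrite Veq0 // mulr0 eqxx; split=> // ak; case/negP: oa; by rewrite ak /=.
    rewrite mulf_eq0 (negbTE (Vneq0 _ oa)) orbF intr_eq0.
    case: a oa {hv} => [j|] //= uj; rewrite (negbTE uj) hw eqz_nat muln_eq0 eqb0 negb_or negbK -lt0n N0 andbT.
    by split=> [/eqP ->|[->]].
  have [_ hs [snz _]] := slG _ ob.
  have [v [c [hv hc]]] := jet_slice_coef (reg a) snz hs; exists c; split.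
    by exists v; rewrite /ell (negbTE ob).
  rewrite hc; split=> [h|ab l ul]; last by have [hm _ _] := slG _ ob; rewrite ab hm.
  have [oa|oa] := boolP (orb a).
    case/negP: snz; apply/eqP/mnmP => l; rewrite mnm0E; have [ul|/hs //] := eqVneq (u l) 0.
    by have := h l ul; rewrite orb0 // => -[].
  have [hm hsa _] := slG _ oa; apply: ss_inj => //; apply/mnmP => l.
  have [ul|ul] := eqVneq (u l) 0; last by rewrite hsa // hs.
  by have := h l ul; rewrite hm // => -[].
have /fin_all_exists [J hJ] : forall a, exists Ja : option 'I_D.+1 -> F, forall b,
    (exists v, has_jet e u (ell b) (x a) v (Ja b)) /\ (Ja b != 0 <-> a = b).
  by move=> a; have /fin_all_exists [y hy] := jets a; exists y.
pose idx (k : 'I_D.+2) := unlift ord0 k.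
have idx_inj : injective idx.
  move=> k l; rewrite /idx.
  by case: (unliftP ord0 k) => [k'|] ->; case: (unliftP ord0 l) => [l'|] -> // [->].
pose M : 'M[F]_D.+2 := \matrix_(k, l) J (idx k) (idx l).
have : \det M = 0.
  apply: (@smooth_det_jets F D n e u (x \o idx) (ell \o idx)) => //= k l; rewrite mxE.
  exact: (hJ (idx k) (idx l)).1.
have -> : M = diag_mx (\row_k J (idx k) (idx k)).
  apply/matrixP => k l; rewrite !mxE; have [->|kl] := eqVneq k l; first by rewrite mulr1n.
  rewrite mulr0n; apply/eqP; apply: contraNT kl => /(hJ _ _).2 /idx_inj ->; exact: eqxx.
rewrite det_diag => /eqP/prodf_eq0 [k _]; rewrite mxE => /eqP Jk.
have := (hJ (idx k) (idx k)).2; rewrite Jk eqxx => -[_ h]; by have := h erefl.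
Qed.

End SmoothUnimodular.

(** * Regularity of the forms with given numerators *)

Section FormsOver.

Variables (F : fieldType) (n p : nat).
Local Notation K := {fraction {mpoly F[n]}}.
Variable A : K -> Prop.
Implicit Types w : dform F n p.

Lemma forms_over0 : forms_over A (0 : dform F n p).
Proof. by exists [::]; rewrite big_nil. Qed.

Lemma forms_overD w w' : forms_over A w -> forms_over A w' -> forms_over A (w + w').
Proof.
move=> [s [hs ->]] [t [ht ->]]; exists (s ++ t); rewrite big_cat; split=> // x.
by rewrite mem_cat => /orP [/hs|/ht].
Qed.

Lemma forms_over_sum I (r : seq I) (w : I -> dform F n p) :
  (forall i, forms_over A (w i)) -> forms_over A (\sum_(i <- r) w i).
Proof.
move=> h; elim: r => [|i r IH]; first by rewrite big_nil; exact: forms_over0.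
by rewrite big_cons; exact: forms_overD.
Qed.

Lemma forms_over_gen g (h : p.-tuple K) :
  A g -> (forall k, A (tnth h k)) -> forms_over A (scale_form g (wedge_d h)).
Proof.
move=> hg hh; exists [:: (g, h)]; rewrite big_seq1; split=> // x.
by rewrite inE => /eqP ->.
Qed.

End FormsOver.

Lemma scale_formA (F : fieldType) n p (a b : {fraction {mpoly F[n]}}) (w : dform F n p) :
  scale_form a (scale_form b w) = scale_form (a * b) w.
Proof. apply/ffunP => js; rewrite !ffunE; exact (mulrA _ _ _). Qed.

Lemma scale_form_sum (F : fieldType) n p (a : {fraction {mpoly F[n]}}) I (r : seq I)
    (w : I -> dform F n p) :
  scale_form a (\sum_(i <- r) w i) = \sum_(i <- r) scale_form a (w i).
Proof.
apply/ffunP => js; rewrite ffunE !sum_ffunE mulr_sumr; apply: eq_bigr => i _.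
by rewrite ffunE.
Qed.

Section ContractCharacters.

Variables (F : numClosedFieldType) (D n : nat) (e : 'I_n -> 'rV[int]_D.+1).
Local Notation K := {fraction {mpoly F[n]}}.
Local Notation tf := (@FracField.tofrac {mpoly F[n]}).
Local Notation chi := (chi F e).
Local Notation FF := (@function_field F D.+1 n e).
Variable b : 'I_D.+1 -> 'rV[int]_D.+1.
Local Notation Bm := (\matrix_(k, a) b k 0 a).
Hypothesis b_basis : \det Bm != 0.

Definition other_chars (k : 'I_D.+1) : D.-tuple K := [tuple chi (b (lift k j)) | j < D].

Lemma chi_sum I (r : seq I) (m : I -> 'rV[int]_D.+1) :
  chi (\sum_(i <- r) m i) = \prod_(i <- r) chi (m i).
Proof. apply: (big_morph (fun x => chi x)); [exact: chiD|exact: chi0]. Qed.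

Lemma cross_scale_rows (L : comNzRingType) (c : 'I_D -> L) (T : 'M[L]_(D, D.+1)) :
  cross (\matrix_(k, a) (c k * T k a)) = \prod_k c k *: cross T.
Proof.
apply/rowP => a; rewrite !mxE mulrCA; congr (_ * _).
have -> : col' a (\matrix_(k, j) (c k * T k j)) = diag_mx (\row_k c k) *m col' a T.
  by apply/matrixP => k j; rewrite mul_diag_mx !mxE.
rewrite det_mulmx det_diag; congr (_ * _); by apply: eq_bigr => k _; rewrite mxE.
Qed.

Lemma wedge_other_chars k : wedge_d (other_chars k) =
  contract e ((\prod_j chi (b (lift k j)) * (-1) ^+ k) *:
     map_mx intr (row k (\adj Bm)^T)).
Proof.
pose T : 'M[K]_(D, D.+1) :=
  \matrix_(j, a) (chi (b (lift k j)) * (row' k (map_mx intr Bm)) j a).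
rewrite (wedge_d_log_grad (e := e) (T := T)) => [|j]; last first.
  rewrite tnth_mktuple; have -> : row j T = chi (b (lift k j)) *: map_mx intr (b (lift k j)).
    by apply/rowP => a; rewrite !mxE.
  exact: log_grad_chi.
congr (contract e _); rewrite cross_scale_rows cross_row' scalerA; congr (_ *: _).
by apply/rowP => a; rewrite -map_mx_adj !mxE.
Qed.

(** Cramer's rule writes [v] as a combination of the rows of the transposed adjugate of [Bm], and
    contraction with row [k] is, up to sign and a character, the wedge of the differentials of all
    characters but the one of index [k]. *)
Lemma contract_vec (v : 'rV[int]_D.+1) g :
  contract e (g *: map_mx intr v) = \sum_k scale_form
    (g * (pairing (b k) v)%:~R * cstK n ((\det Bm)%:~R^-1 * (-1) ^+ k) *
      chi (- \sum_j b (lift k j))) (wedge_d (other_chars k)).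
Proof.
have dv a : \det Bm * v 0 a = \sum_k pairing (b k) v * (\adj Bm) a k.
  have /matrixP /(_ a 0) h : \adj Bm *m (Bm *m v^T) = \det Bm *: v^T.
    by rewrite mulmxA mul_adj_mx mul_scalar_mx.
  transitivity ((\det Bm *: v^T) a 0); first by rewrite !mxE.
  rewrite -h mxE; apply: eq_bigr => k _; rewrite mulrC; congr (_ * _).
  by rewrite mxE; apply: eq_bigr => j _; rewrite !mxE.
have dK : (\det Bm)%:~R != 0 :> F by rewrite intr_eq0.
have vE : g *: map_mx intr v = \sum_k (g * (pairing (b k) v)%:~R * cstK n (\det Bm)%:~R^-1) *:
    map_mx intr (row k (\adj Bm)^T) :> 'rV[K]_D.+1.
  apply/rowP => a; rewrite summxE; transitivity (g * cstK n (\det Bm)%:~R^-1 * (\det Bm * v 0 a)%:~R).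
    have cD : cstK n (\det Bm)%:~R^-1 * cstK n (\det Bm)%:~R = 1 :> K by rewrite -cstKM mulVf // cstK1.
    rewrite intrM -(cstK_int _ _ (\det Bm)) !mxE -mulrA; congr (g * _).
    by rewrite mulrA cD mul1r.
  rewrite dv (big_morph (fun z : int => z%:~R : K) (@intrD K) (erefl _)) mulr_sumr; apply: eq_bigr => k _; rewrite !mxE rmorphM /= mulrA.
  by congr (_ * _); exact (mulrAC _ _ _).
rewrite vE contract_sum; apply: eq_bigr => k _.
rewrite wedge_other_chars !contractZ scale_formA; congr (scale_form _ _).
rewrite chiN chi_sum; set P := \prod_j _.
have P0 : P != 0 by apply/prodf_neq0 => j _; exact: chi_neq0.
have -> : (-1) ^+ k = cstK n ((-1) ^+ k) :> K by rewrite /cstK !rmorphXn !rmorphN !rmorph1.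
rewrite cstKM; move: P P0; set x := g * _; set y := cstK n _; set s := cstK n _ => P P0.
have ss : s * s = 1 by rewrite -cstKM -expr2 sqrr_sign cstK1.
have alg (L : fieldType) (x' y' s' P' : L) : P' != 0 -> s' * s' = 1 ->
  x' * y' = x' * (y' * s') * P'^-1 * (P' * s').
  move=> h1 h2; rewrite -[LHS]mulr1 -h2; by field.
exact (alg _ _ _ _ _ P0 ss).
Qed.

(** Summands with zero pairing drop out, so their coefficients are exempt from the condition. At a
    point this exempts exactly the terms whose coefficient could have a pole. *)
Lemma forms_over_contract (A : K -> Prop) (v : 'rV[int]_D.+1) g :
  A 0 -> (forall k, A (chi (b k))) ->
  (forall k, pairing (b k) v != 0 -> A (g * (pairing (b k) v)%:~R *
     cstK n ((\det Bm)%:~R^-1 * (-1) ^+ k) * chi (- \sum_j b (lift k j)))) ->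
  forms_over A (contract e (g *: map_mx intr v)).
Proof.
move=> A0 Achi Ag; rewrite contract_vec; apply: forms_over_sum => k; apply: forms_over_gen.
  have [->|/Ag //] := eqVneq (pairing (b k) v) 0.
  by rewrite mulr0 !mul0r.
by move=> j; rewrite tnth_mktuple.
Qed.

End ContractCharacters.

Lemma mul_ac5 (L : fieldType) (h f a z x : L) : h * (f * a * z) * x = h * f * a * (z * x).
Proof. by ring. Qed.

Lemma mul_ac4 (L : fieldType) (h x z t : L) : h * x * z * t = h * t * x * z.
Proof. by ring. Qed.

(** * Regularity of the candidate forms at smooth points *)

Section Backward.

Variables (F : numClosedFieldType) (D n : nat) (e : 'I_n -> 'rV[int]_D.+1).
Variable Sigma : {set {set 'I_n}}.
Hypothesis e_primitive : forall i, primitive_vec (e i).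
Hypothesis inU_cover : forall u : 'I_n -> F, inU Sigma u ->
  exists2 sigma : 'I_D.+1 -> 'I_n, \det (\matrix_(k, a) e (sigma k) 0 a) != 0 &
    forall l, u l = 0 -> exists k, sigma k = l.

Local Notation K := {fraction {mpoly F[n]}}.
Local Notation tf := (@FracField.tofrac {mpoly F[n]}).
Local Notation FF := (@function_field F D.+1 n e).
Local Notation chi := (chi F e).

Lemma ff_same_class g (p q : {mpoly F[n]}) : q != 0 ->
  in_class (alpha_image e) g p -> in_class (alpha_image e) g q -> FF (tf p / tf q).
Proof.
move=> q0 hp hq.
have [nu nuq] : exists nu, nu \in msupp q.
  case E : (msupp q) => [|nu s]; last by exists nu; rewrite mem_head.
  by rewrite -msupp_eq0 E eqxx in q0.
have cls (r : {mpoly F[n]}) : in_class (alpha_image e) g r ->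
    in_class (alpha_image e) (mvec nu) r.
  move=> hr m mr; have -> : mvec m - mvec nu = (mvec m - g) - (mvec nu - g).
    by apply/rowP => l; rewrite !mxE; ring.
  by apply: alpha_imageB; [exact: hr|exact: hq].
have tr (r : {mpoly F[n]}) : in_class (alpha_image e) g r -> FF (tf r / tf 'X_[nu]).
  move=> /cls hr; pose u : 'I_n -> F := fun=> 1.
  have u0 l : u l = 0 -> nu l = 0%N by move/eqP; rewrite oner_eq0.
  have [s sE _] := regular_spanP hr u0; apply: ff_tr; exists s; exact sE.
have X0 : tf 'X_[nu] != 0 by rewrite tofrac_eq0 -msupp_eq0 msuppX.
have -> : tf p / tf q = (tf p / tf 'X_[nu]) / (tf q / tf 'X_[nu]).
  by rewrite -mulf_div divff ?invr_eq0 // mulr1.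
by apply: ffM; [exact: tr|apply/ffV/tr].
Qed.

Variables (beta : divclass n) (f : {mpoly F[n]}).
Hypotheses (f_neq0 : f != 0) (f_deg : in_degree e beta f).
Variable A : 'I_n -> {mpoly F[n]}.
Hypothesis A_deg : forall i, in_degree e (shifted_class beta i) (A i).

Let B i : K := (tf f)^-1 * tf (A i) * (\prod_l zK F l / zK F i).

Lemma prod_except i : \prod_l zK F l / zK F i = tf (\prod_(l | l != i) 'X_l) :> K.
Proof. by rewrite rmorph_prod (bigD1 i) //= mulrC mulKf ?zK_neq0. Qed.

Lemma coefficient_ff i : FF (B i).
Proof.
rewrite /B prod_except; set Z := \prod_(l | _) _.
have -> : (tf f)^-1 * tf (A i) * tf Z = tf (A i * Z) / tf f.
  by rewrite tofracM -mulrA mulrC.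
apply: (ff_same_class (g := \row_l beta l)) => //; last exact/in_degreeP.
pose k := [multinom (l != i : nat) | l < n].
have ZE : Z = 'X_[k].
  rewrite mpolyXE_id /Z big_mkcond; apply: eq_bigr => l _.
  by rewrite mnmE; case: eqP => _; rewrite ?expr0 ?expr1.
rewrite ZE => m /msuppM_le /allpairsP [[m1 m2] /= [/A_deg [x hx]]].
rewrite msuppX inE => /eqP -> ->; exists x; apply/rowP => l.
have := hx l; rewrite /shifted_class !mxE mnmDE mnmE PoszD => <-.
by case: eqP => _ /=; ring.
Qed.

Lemma omega_sum_contract :
  scale_form (tf f)^-1 (\sum_(i < n) scale_form (tf (A i)) (Omega F e i)) =
  \sum_i contract e (B i *: map_mx intr (e i)).
Proof.
rewrite scale_form_sum; apply: eq_bigr => i _.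
rewrite scale_formA Omega_contract !contractZ scale_formA; congr (scale_form _ _).
Qed.

(** For rays on whose divisors [u] lies, use the exact dual characters given by smoothness; for the
    remaining basis rays, scaled dual vectors suffice, since those coordinates are invertible at
    [u]. *)
Lemma local_basis (u : 'I_n -> F) sigma :
  \det (\matrix_(k, a) e (sigma k) 0 a) != 0 -> (forall l, u l = 0 -> exists k, sigma k = l) ->
  smooth_pt e u -> exists2 b : 'I_D.+1 -> 'rV[int]_D.+1,
    \det (\matrix_(k, a) b k 0 a) != 0 &
    forall k l, u (sigma l) = 0 -> pairing (b k) (e (sigma l)) = (k == l)%:Z.
Proof.
move=> hs cov sm; have [w [N [N0 hw]]] := scaled_dual_basis hs.
have sinj := sigma_inj hs.
have /fin_all_exists [b hb] : forall k, exists b : 'rV[int]_D.+1,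
    (u (sigma k) = 0 -> forall l, u l = 0 -> pairing b (e l) = (l == sigma k)%:Z) /\
    (u (sigma k) != 0 -> b = w k).
  move=> k; have [uk|uk] := eqVneq (u (sigma k)) 0.
    by have [m hm] := smooth_unimodular hs cov e_primitive sm uk; exists m; split.
  by exists (w k); split=> // uk'; rewrite uk' eqxx in uk.
have hbl k l : u (sigma l) = 0 -> pairing (b k) (e (sigma l)) = (k == l)%:Z.
  move=> ul; have [hb1 hb2] := hb k; have [uk|uk] := eqVneq (u (sigma k)) 0.
    by rewrite hb1 // (inj_eq sinj) eq_sym.
  rewrite hb2 // hw; case: eqP => [kl|] //; by rewrite kl ul eqxx in uk.
exists b => //; apply/det0P => -[v v0 vb]; case/negP: v0; apply/eqP/rowP => l.
(* A linear relation [v] among the [b k] is tested on the basis rays: the vanishing ones kill their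
   coefficients of [v], after which the scaled dual vectors kill the others. *)
have vp x : \sum_k v 0 k * pairing (b k) x = 0.
  transitivity (\sum_a (v *m \matrix_(k, a) b k 0 a) 0 a * x 0 a).
    under eq_bigr => k _ do rewrite /pairing mulr_sumr.
    rewrite exchange_big; apply: eq_bigr => a _ /=; rewrite mxE mulr_suml.
    by apply: eq_bigr => k _; rewrite !mxE mulrA.
  by rewrite vb big1 // => a _; rewrite mxE mul0r.
have v1 k : u (sigma k) = 0 -> v 0 k = 0.
  move=> uk; rewrite -[RHS](vp (e (sigma k))) (bigD1 k) //= hbl // eqxx mulr1.
  by rewrite big1 ?addr0 // => j /negbTE jk; rewrite hbl // jk mulr0.
rewrite mxE; have [/v1 //|ul] := eqVneq (u (sigma l)) 0.
have := vp (e (sigma l)); rewrite (bigD1 l) //= big1 => [|j jl].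
  rewrite addr0 (hb l).2 // hw eqxx mul1n => /eqP; rewrite mulf_eq0 eqz_nat.
  by rewrite (gtn_eqF N0) orbF => /eqP.
have [/v1 ->|uj] := eqVneq (u (sigma j)) 0; first by rewrite mul0r.
by rewrite (hb j).2 // hw (negbTE jl) mul0n mulr0.
Qed.

Lemma backward_direction : global_section_Omega e Sigma f
  (scale_form (tf f)^-1 (\sum_(i < n) scale_form (tf (A i)) (Omega F e i))).
Proof.
rewrite omega_sum_contract; split.
  apply: forms_over_sum => i.
  (* Over the function field every basis of characters works; the standard one is taken. *)
  have d1 : \det (\matrix_(k, a) row k (1%:M : 'M[int]_D.+1) 0 a) != 0.
    suff -> : \matrix_(k, a) row k (1%:M : 'M[int]_D.+1) 0 a = 1%:M by rewrite det1 oner_neq0.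
    by apply/matrixP => k a; rewrite !mxE.
  apply: (forms_over_contract d1); [exact: ff0|move=> k; exact: ff_chi|move=> k _].
  by do 3?[apply: ffM]; [exact: coefficient_ff|exact: ff_int|exact: ff_cst|exact: ff_chi].
move=> u /inU_cover [sigma hs cov] sm h [hF [c c0 hc]].
have [b b0 hb] := local_basis hs cov sm.
rewrite scale_form_sum; apply: forms_over_sum => i; rewrite -contractZ scalerA.
have regb k : regular_char e u (b k).
  by move=> l ul; have [j jl] := cov l ul; rewrite -jl hb ?jl //; case: eqP.
apply: (forms_over_contract b0); [exact: lr0|by move=> k; apply: lr_chi|move=> k bk].
split.
  do 3?[apply: ffM]; [|exact: ff_int|exact: ff_cst|exact: ff_chi].
  by apply: ffM => //; exact: coefficient_ff.
have [y hy] : regular u (h * B i * chi (- \sum_j b (lift k j))).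
  have [x hx] : regular u (\prod_l zK F l / zK F i * chi (- \sum_j b (lift k j))).
    (* [a l] is the exponent of [z_l] in the coefficient. At a vanishing [l = sigma j] it equals
       [(l != i) - (k != j)], negative only if [l = i] and [k != j]; then [b k] pairs to 0 with
       [e i], against [bk]. *)
    pose a l : int := (l != i)%:Z - pairing (\sum_j b (lift k j)) (e l).
    have a0 l : u l = 0 -> 0 <= a l.
      move=> ul; have [j jl] := cov l ul.
      have -> : a l = (l != i)%:Z - (k != j)%:Z.
        rewrite /a; congr (_ - _); rewrite /pairing.
        under eq_bigr => a' _ do rewrite summxE mulr_suml.
        rewrite exchange_big /=; transitivity (\sum_j' pairing (b (lift k j')) (e l)); first by [].
        under eq_bigr => j' _ do rewrite -jl hb ?jl //.
        have [kj|kj] := eqVneq k j.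
          by rewrite big1 // => j' _; rewrite -kj eq_sym (negbTE (neq_lift _ _)).
        case: (unlift_some kj) => j' j'E _; rewrite j'E (bigD1 j') //= eqxx big1 ?addr0 // => x xj.
        by rewrite (inj_eq lift_inj) (negbTE xj).
      case: (eqVneq l i) => [li|]; last by case: (k == j).
      case: (eqVneq k j) => // kj; case/negP: bk.
      by rewrite -li -jl hb ?jl // (negbTE kj).
    exists (\prod_l u l ^ a l).
    have -> : \prod_l zK F l / zK F i * chi (- \sum_j b (lift k j)) = \prod_l zK F l ^ a l :> K.
      rewrite prod_except rmorph_prod big_mkcond -big_split; apply: eq_bigr => l _ /=.
      rewrite pairingN expfzDr ?zK_neq0 //; congr (_ * _).
      by case: eqP => _; rewrite ?expr0z ?expr1z.
    apply: hv_prod => l _; have [ul|ul] := eqVneq (u l) 0.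
      have := a0 l ul; case: (a l) => // r _; exact: hvX (hv_zK u l).
    exact: hvXz ul (hv_zK u l).
  exists (c * (A i).@[u] * x).
  have -> : h * B i * chi (- \sum_j b (lift k j)) =
     h / tf f * tf (A i) * (\prod_l zK F l / zK F i * chi (- \sum_j b (lift k j))).
    rewrite /B; exact (mul_ac5 _ _ _ _ _).
  by apply: hvM hx; apply: hvM hc (hv_tofrac _ _).
exists (y * (pairing (b k) (e i))%:~R * ((\det (\matrix_(k, a) b k 0 a))%:~R^-1 * (-1) ^+ k)).
have -> (x z t : K) : h * B i * x * z * t = h * B i * t * x * z by exact (mul_ac4 _ _ _ _).
by apply: hvM (hv_cst _ _); apply: hvM hy (hv_int _ _).
Qed.

End Backward.

(** * Geometry of the fan *)

Section FanGeometry.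

Variables (R : realType) (D n : nat) (e : 'I_n -> 'rV[int]_D.+1).
Variable Sigma : {set {set 'I_n}}.
Hypothesis fan_Sigma : simplicial_complete_fan R e Sigma.

Let E : 'M[R]_(n, D.+1) := \matrix_(i, a) ray_real R e i 0 a.
Let S (B : {set 'I_n}) : 'M[R]_D.+1 := (\sum_(i in B) <<row i E>>)%MS.

Lemma row_E i : row i E = ray_real R e i.
Proof. by apply/rowP => a; rewrite !mxE. Qed.

Lemma rank_S (B : {set 'I_n}) : (\rank (S B) <= #|B|)%N.
Proof.
rewrite /S -sum1_card; elim/big_rec2: _ => [|i k M iB IH]; first by rewrite mxrank0.
rewrite (leq_trans (mxrank_adds_leqif _ _)) // leq_add // genmxE rank_leq_row //.
Qed.

Lemma row_sub_S (B : {set 'I_n}) i : i \in B -> (row i E <= S B)%MS.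
Proof. by move=> iB; rewrite (submx_trans _ (sumsmx_sup i iB (submx_refl _))) // genmxE. Qed.

Lemma rank_E : \rank E = D.+1.
Proof.
apply/eqP; rewrite -/(row_full E) -sub1mx; apply/row_subP => k.
have [I _ [a [_ ->]]] := fan_complete fan_Sigma (row k (1%:M : 'M[R]_D.+1)).
apply: summx_sub => i _; apply: scalemx_sub; rewrite -row_E; exact: row_sub.
Qed.

Lemma rank_cone I : I \in Sigma -> \rank (S I) = #|I|.
Proof.
move=> IS; apply/eqP; rewrite eqn_leq rank_S /=.
pose M : 'M[R]_(#|I|, D.+1) := \matrix_(k, a) ray_real R e (enum_val k) 0 a.
have rM k : row k M = row (enum_val k) E by apply/rowP => a; rewrite !mxE.
have MS : (M <= S I)%MS by apply/row_subP => k; rewrite rM row_sub_S // enum_valP.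
suff /eqP <- : row_free M by exact: mxrankS.
rewrite -kermx_eq0; apply/eqP/row_matrixP => r; rewrite row0.
have vM : row r (kermx M) *m M = 0 by rewrite -row_mul mulmx_ker row0.
move: (row r (kermx M)) vM => v vM.
pose a i := \sum_(k | enum_val k == i) v 0 k.
have ak k : a (enum_val k) = v 0 k.
  by rewrite /a (big_pred1 k) // => l /=; rewrite (inj_eq enum_val_inj).
have := fan_simplicial fan_Sigma IS (a := a); rewrite big_enum_val.
under eq_bigr => k _ do rewrite ak -row_E -rM.
rewrite -mulmx_sum_row => /(_ vM) h; apply/rowP => k.
by rewrite -ak h ?enum_valP // mxE.
Qed.

(** The rays of a complete fan span the space, so a maximal independent set of rays containing those
    of the cone is a basis. *)
Lemma cone_basis I : I \in Sigma -> exists2 sigma : 'I_D.+1 -> 'I_n,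
  \det (\matrix_(k, a) e (sigma k) 0 a) != 0 & forall l, l \in I -> exists k, sigma k = l.
Proof.
move=> IS; pose P B := \rank (S B) == #|B|.
have PI : P I by apply/eqP; exact: rank_cone.
have [B /maxsetP [/eqP PB Bmax] IB] := maxset_exists PI.
have ES : (E <= S B)%MS.
  apply/row_subP => j; apply: contraT => jS.
  have jB : j \notin B by apply: contra jS; exact: row_sub_S.
  have SU : S (j |: B) = (<<row j E>> + S B)%MS by rewrite /S big_setU1.
  have lt : (S B < S (j |: B))%MS.
    rewrite /ltmx SU addsmxSr /=; apply: contra jS => h.
    by apply: submx_trans h; rewrite (submx_trans _ (addsmxSl _ _)) // genmxE.
  have PjB : P (j |: B).
    rewrite /P eqn_leq rank_S /= cardsU1 jB add1n -PB.
    by move: lt; rewrite ltmxErank => /andP [].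
  by move: jB; rewrite -(Bmax _ PjB (subsetUr _ _)) !inE eqxx.
have cB : #|B| = D.+1.
  by apply/eqP; rewrite -PB eqn_leq rank_leq_col /=; have := mxrankS ES; rewrite rank_E.
pose sigma (k : 'I_D.+1) : 'I_n := enum_val (cast_ord (esym cB) k).
exists sigma => [|l /(subsetP IB) lB]; last first.
  by exists (cast_ord cB (enum_rank_in lB l)); rewrite /sigma cast_ordK enum_rankK_in.
pose M : 'M[R]_D.+1 := map_mx intr (\matrix_(k, a) e (sigma k) 0 a).
have SM : (S B <= M)%MS.
  apply/sumsmx_subP => i iB; rewrite genmxE.
  have -> : row i E = row (cast_ord cB (enum_rank_in iB i)) M.
    by apply/rowP => a; rewrite !mxE /sigma cast_ordK enum_rankK_in.
  exact: row_sub.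
have : row_full M by rewrite /row_full eqn_leq rank_leq_col /=; have := mxrankS (submx_trans ES SM); rewrite rank_E.
by rewrite row_full_unit unitmxE unitfE det_map_mx intr_eq0.
Qed.

(** The common generator would lie in the intersection of two distinct ray cones, which [fan_meet]
    identifies with the zero cone. *)
Lemma rays_distinct i j : i != j -> e i != e j.
Proof.
move=> ij; apply/eqP => eij.
have ci k : e k = e i -> in_cone e [set k] (ray_real R e i).
  move=> ek; exists (fun=> 1); split=> [?|]; first exact: ler01.
  by rewrite big_set1 scale1r /ray_real ek.
have := fan_meet fan_Sigma (fan_rays fan_Sigma i) (fan_rays fan_Sigma j) (ci i erefl) (ci j (esym eij)).
have -> : [set i] :&: [set j] = set0.
  by apply/setP => k; rewrite !inE; apply/negbTE/negP => /andP [/eqP -> /eqP ijE]; rewrite ijE eqxx in ij.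
move=> [a [_]]; rewrite big_set0 => /rowP r0.
have [b] := primitive_neq0 (fan_primitive fan_Sigma) i.
by have := r0 b; rewrite !mxE => /eqP; rewrite intr_eq0 => ->.
Qed.

(** A nonzero [c] makes the two generators proportional. Characters of value 1 on each of them show
    that the ratio and its inverse are integers, so the generators are equal or opposite. *)
Lemma fan_parallel_rays (F : numClosedFieldType) i j (c : 'I_D.+1 -> F) : i != j -> e j != - e i ->
  (forall a b, c a * (e i 0 b)%:~R = c b * (e i 0 a)%:~R) ->
  (forall a b, c a * (e j 0 b)%:~R = c b * (e j 0 a)%:~R) -> forall a, c a = 0.
Proof.
move=> ij eji pi pj a; apply/eqP; apply: contraT => ca.
pose x := e i 0 a; pose y := e j 0 a.
have xy b : y * e i 0 b = x * e j 0 b.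
  apply: (@intr_inj F); apply: (mulfI ca); rewrite !intrM.
  by rewrite mulrCA pi [RHS]mulrCA pj; ring.
have [Bi _ hBi] := adapted_basis (fan_primitive fan_Sigma (i := i)).
have [Bj _ hBj] := adapted_basis (fan_primitive fan_Sigma (i := j)).
have pxy m : y * pairing m (e i) = x * pairing m (e j).
  by rewrite /pairing !mulr_sumr; apply: eq_bigr => b _; rewrite mulrCA xy mulrCA.
have yx : y = x * pairing (row ord0 Bi) (e j) by rewrite -pxy hBi eqxx mulr1.
have xy' : x = y * pairing (row ord0 Bj) (e i) by rewrite pxy hBj eqxx mulr1.
have x0 : x != 0.
  apply/eqP => x0; have [b eb] := primitive_neq0 (fan_primitive fan_Sigma) i.
  have := pi a b; rewrite -/x x0 mulr0 => /eqP; rewrite mulf_eq0 (negbTE ca) /= intr_eq0.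
  by rewrite (negbTE eb).
have : y = x \/ y = - x.
  have : (pairing (row ord0 Bi) (e j)) * (pairing (row ord0 Bj) (e i)) = 1.
    by apply: (mulfI x0); rewrite mulr1 mulrA -yx -xy'.
  rewrite yx; move: (pairing _ _) (pairing _ _) => s t st.
  have : t = 1 \/ t = -1.
    have : (absz s * absz t == 1)%N by rewrite -abszM mulrC st.
    by rewrite muln_eq1 => /andP [_ /eqP t1]; lia.
  by case=> ->; [left|right]; rewrite ?mulr1 ?mulrN1.
case=> yE; [case/negP: (rays_distinct ij)|case/negP: eji]; apply/eqP/rowP => b; apply: (mulfI x0).
  by rewrite -xy yE.
by rewrite -xy yE mxE mulNr mulrN.
Qed.

End FanGeometry.

Theorem corollary9p16 (R : realType) (d n : nat) (d_gt0 : (0 < d)%N)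
    (e : 'I_n -> 'rV[int]_d) (Sigma : {set {set 'I_n}})
    (fan_Sigma : simplicial_complete_fan R e Sigma)
    (beta : divclass n) (f : {mpoly R[i][n]})
    (f_neq0 : f != 0) (f_deg : in_degree e beta f)
    (X_Cartier : Cartier e Sigma f) (X_ample : ample e Sigma f)
    (w : dform R[i] n d.-1) :
  global_section_Omega e Sigma f w <->
  exists A : 'I_n -> {mpoly R[i][n]},
    (forall i, in_degree e (shifted_class beta i) (A i)) /\
    w = scale_form (tofrac f)^-1 (\sum_(i < n) scale_form (tofrac (A i)) (Omega R[i] e i)).
Proof.
case: d d_gt0 e fan_Sigma f_deg X_Cartier X_ample w => [//|D] _ e fan_Sigma f_deg X_Cartier X_ample w.
have e_prim := fan_primitive fan_Sigma.
(* Any cone provides a basis of rays; the one containing the origin is at hand. *)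
have [I0 I0S _] := fan_complete fan_Sigma 0.
have [sigma hs _] := cone_basis fan_Sigma I0S.
have few_inU (u : 'I_n -> R[i]) : few_zeros u -> inU Sigma u.
  move=> hu; have [i ui] : exists i, forall l, u l = 0 -> l = i.
    have [/existsP [i /eqP ui]|/existsPn h] := boolP [exists i, u i == 0].
      by exists i => l ul; exact: hu.
    (* No coordinate vanishes, so any ray serves as a default. *)
    by exists (sigma ord0) => l /eqP ul; have := h l; rewrite ul.
  exists [set i]; first exact: (fan_rays fan_Sigma).
  apply/prodf_neq0 => l; rewrite inE; apply: contraNneq => /ui ->; exact: eqxx.
split=> [|[A [A_deg ->]]].
  exact: (forward_direction hs e_prim few_inU (@fan_parallel_rays R D n e Sigma fan_Sigma _)
    f_neq0 f_deg X_Cartier X_ample).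
apply: (backward_direction e_prim _ f_neq0 f_deg A_deg) => u [I IS uI].
have [tau ht cov] := cone_basis fan_Sigma IS; exists tau => // l ul; apply: cov.
by apply: contraT => lI; move: uI; rewrite (bigD1 l) //= ul mul0r eqxx.
Qed.
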